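(* Under $\mathbb{P}$, every event in the $\sigma$-algebra of non-local future events $\mathcal{T}_{RI\rightarrow}$ has probability either $0$ or $1$.
   Context: Weighted graph and Markov chain. $\mathcal{G}=(\mathbb{V},\mathcal{E})$ is a simple undirected connected locally finite graph with countable vertex set; $\mathbf{a}=(a_{x,y})_{(x,y)\in\mathcal{E}}$ is a family of positive conductances with $a_{x,y}=a_{y,x}$; $a_x:=\sum_{z\sim x}a_{x,z}$. $X=(X_n)_{n\ge 0}$ is the Markov chain on $\mathbb{V}$ with transition probabilities $p_{x,y}=a_{x,y}/a_x$ if $(x,y)\in\mathcal{E}$ and $0$ otherwise; it is assumed to be transient. $P_x$ is the law of $X$ started from $x$. For $K\subset\mathbb{V}$, $\tau_K^+=\inf\{n\ge 1: X_n\in K\}$ ($\inf\emptyset=\infty$). For finite $K$, the equilibrium measure is $e_K(x)=a_xP_x[\tau_K^+=\infty]$ for $x\in K$ and $e_K(x)=0$ otherwise. Trajectories. $W^+$ (resp. $W$) is the set of nearest-neighbour trajectories in $\mathcal{G}$ indexed by $\{0,1,2,\dots\}$ (resp. by $\mathbb{Z}$) that visit each vertex only finitely many times, with the $\sigma$-algebra $\mathcal{W}^+$ (resp. $\mathcal{W}$) generated by the coordinate maps. $W_K\subset W$ is the set of trajectories that hit $K$. $W^*$ is the quotient of $W$ by time-translation ($w\sim w'$ iff $w_{n+k}=w'_n$ for all $n$, for some $k\in\mathbb{Z}$), $\pi^*:W\to W^*$ is the projection, $\mathcal{W}^*$ is the $\sigma$-algebra inherited from $\mathcal{W}$ (quotient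 $\sigma$-algebra), and $W_K^*=\pi^*(W_K)$. Interlacement process. For finite $K$, $\nu_K$ is the measure on $(W,\mathcal{W})$ characterized by $\nu_K(\{w:(w_{-n})_{n\ge 0}\in A,\ w_0=x,\ (w_n)_{n\ge 0}\in B\})=P_x[A\mid\tau_K^+=\infty]\,e_K(x)\,P_x[B]$ for $x\in\mathbb{V}$, $A,B\in\mathcal{W}^+$ (read as $0$ if $e_K(x)=0$). $\nu$ is the unique measure on $(W^*,\mathcal{W}^* )$ such that for every finite $K\subset\mathbb{V}$ the restriction of $\nu$ to $W_K^*$ equals $\nu_K\circ(\pi^* )^{-1}$. $\Omega$ is the set of point measures $\omega=\sum_{i\ge 1}\delta_{w_i^*}$ on $W^*$ with $\omega(W_K^* )<\infty$ for all finite $K$, $\mathcal{A}$ is the $\sigma$-algebra on $\Omega$ generated by the maps $\omega\mapsto\omega(D)$, $D\in\mathcal{W}^*$, and $\mathbb{P}$ is the law on $(\Omega,\mathcal{A})$ of a Poisson point process with intensity measure $\nu$. Non-local future events. For finite $K$ and $w\in W_K$, let $\lambda_K(w)=\sup\{n\in\mathbb{Z}:w_n\in K\}$ and $\mathrm{Out}_{K\to}(w)=(w_{\lambda_K(w)+n})_{n\ge 0}$. For $\omega=\sum_{i\ge1}\delta_{w_i^*}\in\Omega$ with arbitrary representatives $w_i$ of $w_i^*$, set $\mathrm{Out}_{K\to}(\omega)=\sum_{i: w_i^*\in W_K^*}\delta_{\mathrm{Out}_{K\to}(w_i)}+\sum_{i:w_i^*\notin W_K^*}\delta_{w_i^*}$,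 a random point measure (on the disjoint union of $W^+$ and $W^*$; point measures carry the $\sigma$-algebra generated by evaluations on measurable sets). $\mathcal{T}_{RI\rightarrow}=\bigcap_{K\subset\mathbb{V}\text{ finite}}\sigma(\mathrm{Out}_{K\to})$. *)

(* Defs.v *)
From HB Require Import structures.
From mathcomp Require Import all_boot all_order all_algebra finmap.
From mathcomp Require Import generic_quotient.
From mathcomp Require Import all_classical all_reals all_analysis.
From mathcomp Require Import measurable_realfun.

Set Implicit Arguments.
Unset Strict Implicit.
Unset Printing Implicit Defensive.

Import Order.TTheory GRing.Theory Num.Theory.

Local Open Scope classical_set_scope.
Local Open Scope ring_scope.
Local Open Scope quotient_scope.

(** Simple connected locally finite graph with countable vertex set and positive
    symmetric conductances. [root] only witnesses that the graph is non-empty;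
    the values of [cond] off the edges are irrelevant. *)
Record wgraph (R : realType) := WGraph {
  vertex :> countType;
  root : vertex;
  adj : rel vertex;
  cond : vertex -> vertex -> R;
  adj_sym : symmetric adj;
  adj_irr : irreflexive adj;
  adj_connected : forall x y, exists p, path adj x p /\ last x p = y;
  adj_locfin : forall x, finite_set [set y | adj x y];
  cond_gt0 : forall x y, adj x y -> 0 < cond x y;
  cond_sym : forall x y, adj x y -> cond x y = cond y x }.

(** Generator of the sigma-algebra of the maps [c i] when the target [U] is
    discrete, i.e. all its subsets are measurable. *)
Definition coord_sets (T I U : Type) (c : I -> T -> U) : set (set T) :=
  [set A | exists i (B : set U), A = c i @^-1` B].

Section chain.
Context {R : realType} (G : wgraph R).

(** The vertex set, pointed by [root]. *)
Definition site : Type := G.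
HB.instance Definition _ := Countable.on site.
HB.instance Definition _ := isPointed.Build site (root G).

Definition vweight (x : site) : R := \sum_(z \in [set z | adj x z]) cond x z.

Definition trans_prob (x y : site) : R :=
  if adj x y then cond x y / vweight x else 0.

(** Arbitrary vertex sequences, the canonical space of the Markov chain. *)
Definition walk := g_sigma_algebraType
  (coord_sets (fun n (w : nat -> site) => w n)).

(** [P] is the law of the chain started from [x]: the one-step Markov property in
    product form, which determines all cylinder probabilities. *)
Definition markov_law (x : site) (P : probability walk R) : Prop :=
  P [set w | w 0%N = x] = 1%E /\
  forall (n : nat) (s : nat -> site),
    P [set w | forall i, (i <= n.+1)%N -> w i = s i] =
    (P [set w | forall i, (i <= n)%N -> w i = s i] *
     (trans_prob (s n) (s n.+1))%:E)%E.

(** The event that the hitting time of [K] at times n >= 1 is infinite. *)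
Definition no_return (K : {fset site}) : set walk :=
  [set w | forall n, (0 < n)%N -> w n \notin K].

(** The family of laws P_x of the chain with transition probabilities
    [trans_prob], every state being transient (return probability < 1). *)
Record transient_chain := TransientChain {
  law :> site -> probability walk R;
  law_markov : forall x, markov_law x (law x);
  law_transient : forall x, (0 < law x (no_return [fset x]%fset))%E }.

(** W+ and W, as sets of sequences. *)
Definition ftraj_set : set (nat -> site) :=
  [set w | (forall n, adj (w n) (w n.+1)) /\
           (forall x, finite_set [set n | w n = x])].

Definition itraj_set : set (int -> site) :=
  [set w | (forall n, adj (w n) (w (n + 1))) /\
           (forall x, finite_set [set n | w n = x])].

End chain.
Arguments ftraj_set {R} G.
Arguments itraj_set {R} G.

(** Measurable types are pointed, so W+ and W must be shown non-empty: under
    transience the chain almost surely follows a trajectory of W+ (last exit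
    decomposition and Borel-Cantelli), and folding one gives an element of W. *)
Section transience_facts.
Context {R : realType} {G : wgraph R}.
Local Notation V := (site G).

Definition prefix_event (n : nat) (s : nat -> V) : set (walk G) :=
  [set w | forall i, (i <= n)%N -> w i = s i].

Definition walk_shift (n : nat) (w : walk G) : walk G := fun i => w (n + i)%N.

Lemma measurable_coord n (B : set V) : measurable [set w : walk G | B (w n)].
Proof. by apply: sub_sigma_algebra; exists n, B. Qed.

Lemma prefix_eventS n s :
  prefix_event n.+1 s = prefix_event n s `&` [set w | w n.+1 = s n.+1].
Proof.
apply/seteqP; split=> [w ws|w [ws wS] i].
  by split=> [i ni|]; apply: ws => //; exact: leqW.
by rewrite leq_eqVlt => /predU1P[->//|/ws].
Qed.

Lemma prefix_event0 s : prefix_event 0 s = [set w | w 0%N = s 0%N].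
Proof.
apply/seteqP; split=> [w|w w0 i]; first exact.
by rewrite leqn0 => /eqP ->.
Qed.

Lemma measurable_prefix n s : measurable (prefix_event n s).
Proof.
elim: n => [|n IH].
  rewrite prefix_event0; exact: (@measurable_coord 0 [set s 0%N]).
rewrite prefix_eventS; apply: measurableI => //.
exact: (@measurable_coord n.+1 [set s n.+1]).
Qed.

Definition prefix_sets : set (set (walk G)) :=
  [set A | [\/ A = set0, A = setT | exists n s, A = prefix_event n s]].

Lemma prefix_cover n (w : walk G) :
  prefix_event n (nth (root G) (mkseq w n.+1)) w.
Proof. by move=> i ni; rewrite nth_mkseq. Qed.

Lemma walk_measurableE : @measurable _ (walk G) = <<s prefix_sets >>.
Proof.
apply/seteqP; split; apply: smallest_sub; try exact: smallest_sigma_algebra.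
- move=> _ [n [B ->]].
  rewrite (_ : _ @^-1` _ = \bigcup_(h : seq V)
      if `[< B (nth (root G) h n) >] then prefix_event n (nth (root G) h)
      else set0).
    apply: (@countable_bigcupT_measurable _ (g_sigma_algebraType prefix_sets)).
      exact: countableP.
    move=> h; apply: sub_sigma_algebra.
    by case: ifPn => _; [apply: Or33; exists n, (nth (root G) h)|apply: Or31].
  apply/seteqP; split=> [w Bw|w [h _]].
    exists (mkseq w n.+1) => //; rewrite ifT; first exact: prefix_cover.
    by apply/asboolP; rewrite nth_mkseq.
  by case: ifPn => // /asboolP Bh /(_ n) /= ->.
- move=> _ [->|->|[n [s ->]]]; [exact: measurable0|exact: measurableT|].
  exact: measurable_prefix.
Qed.

Lemma setI_prefix_sets : setI_closed prefix_sets.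
Proof.
move=> _ _ [->|->|[n [s ->]]] [->|->|[m [t ->]]];
  rewrite ?(set0I, setI0, setTI, setIT);
  try (by apply: Or31); try (by apply: Or32);
  try (by apply: Or33; do 2 eexists).
wlog nm : n m s t / (n <= m)%N.
  by case/orP: (leq_total n m) => [/[swap] /[apply]//|mn]; rewrite setIC; apply.
have [st|/existsNP[i /not_implyP[ni st]]] :=
    pselect (forall i, (i <= n)%N -> s i = t i).
  apply: Or33; exists m, t; apply/seteqP; split=> [w [] //|w wt].
  by split=> // i ni; rewrite wt ?st// (leq_trans ni).
apply: Or31; apply/seteqP; split=> // w [ws wt]; apply: st.
by rewrite -ws// wt// (leq_trans ni).
Qed.

Lemma measurable_walk_shift n : measurable_fun setT (walk_shift n).
Proof.
apply: (@measurability _ _ (walk G) (walk G) setT (walk_shift n)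
  (coord_sets (fun n (w : nat -> V) => w n))) => //.
move=> _ [_ [i [B ->]] <-]; rewrite setTI.
exact: (@measurable_coord (n + i) B).
Qed.

Context (X : transient_chain G).
Local Open Scope ereal_scope.

Lemma lawS x n s : X x (prefix_event n.+1 s) =
  X x (prefix_event n s) * (trans_prob (s n) (s n.+1))%:E.
Proof. by have [_ ->] := law_markov X x. Qed.

Lemma null_sub x (A B : set (walk G)) : measurable A -> measurable B ->
  A `<=` B -> X x B = 0 -> X x A = 0.
Proof. exact: subset_measure0. Qed.

Lemma law0 x y : x <> y -> X x [set w | w 0%N = y] = 0.
Proof.
move=> xy; have [X1 _] := law_markov X x.
apply: (null_sub (B := ~` [set w | w 0%N = x])).
- exact: (@measurable_coord 0 [set y]).
- by apply: measurableC; exact: (@measurable_coord 0 [set x]).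
- by move=> w /= -> yx; apply: xy.
- rewrite probability_setC ?X1 ?subee//.
  exact: (@measurable_coord 0 [set x]).
Qed.

Lemma markov_prefix x n s m t :
  X x (walk_shift n @^-1` prefix_event m t `&` prefix_event n s) =
  X x (prefix_event n s) * X (s n) (prefix_event m t).
Proof.
have [ts|ts] := pselect (s n = t 0%N); last first.
  rewrite (_ : _ `&` _ = set0) ?measure0; last first.
    apply/seteqP; split=> // w [wt ws]; apply: ts.
    by rewrite -(wt 0%N)// -ws// /walk_shift addn0.
  rewrite (_ : X (s n) _ = 0) ?mule0//.
  apply: (null_sub (B := [set w | w 0%N = t 0%N])).
  - exact: measurable_prefix.
  - exact: (@measurable_coord 0 [set t 0%N]).
  - by move=> w; exact.
  - exact: law0.
pose c i := if (i <= n)%N then s i else t (i - n)%N.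
have ctE i : c (n + i)%N = t i.
  rewrite /c; case: ifPn => [|_]; last by rewrite addKn.
  by rewrite -{2}[n]addn0 leq_add2l leqn0 => /eqP ->; rewrite addn0.
have catE k : walk_shift n @^-1` prefix_event k t `&` prefix_event n s =
              prefix_event (n + k) c.
  apply/seteqP; split=> [w [wt ws] i|w wc].
    rewrite /c; case: ifPn => [/ws//|]; rewrite -ltnNge => ni.
    rewrite -leq_subLR => /wt <-; rewrite /walk_shift subnKC// ltnW//.
  split=> [i ik|i ni]; first by rewrite /walk_shift wc ?ctE// leq_add2l.
  by rewrite wc ?/c ?ni// (leq_trans ni)// leq_addr.
elim: m => [|m IH].
  rewrite catE addn0 (_ : prefix_event n c = prefix_event n s); last first.
    by apply/seteqP; split=> w ws i ni; rewrite ws// /c ni.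
  by rewrite prefix_event0 -ts (law_markov X (s n)).1 mule1.
rewrite catE addnS lawS -catE IH lawS muleA.
by rewrite -addnS !ctE.
Qed.

Lemma markov_property x n s B : measurable B ->
  X x (walk_shift n @^-1` B `&` prefix_event n s) =
  X x (prefix_event n s) * X (s n) B.
Proof.
move=> mB.
have /fineK pE := fin_num_measure (X x) _ (measurable_prefix n s).
have p0 : (0 <= fine (X x (prefix_event n s)))%R by rewrite fine_ge0.
rewrite -pE.
have mS := measurable_walk_shift n.
pose m1 : {measure set walk G -> \bar R} :=
  pushforward (mrestr (X x) (measurable_prefix n s)) (walk_shift n).
pose m2 : {measure set walk G -> \bar R} := mscale (NngNum p0) (X (s n)).
change (m1 mS B = m2 B).
apply: (@measure_unique _ _ _ prefix_sets (fun=> setT) walk_measurableE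
  setI_prefix_sets _ _ (m1 mS) m2 _ _ _ mB).
- by move=> _; exact: Or32.
- by rewrite bigcup_const//; exists 0%N.
- move=> _ [->|->|[m [t ->]]]; first by rewrite !measure0.
  + by rewrite /m1 /m2 /= /pushforward /mrestr /mscale /= preimage_setT setTI
      probability_setT mule1 pE.
  + by rewrite /m1 /m2 /= /pushforward /mrestr /mscale /= markov_prefix pE.
- move=> _; rewrite /m1 /= /pushforward /mrestr preimage_setT setTI.
  by rewrite -pE ltry.
Qed.

Lemma measurable_no_return (K : {fset V}) : measurable (no_return K).
Proof.
rewrite (_ : no_return K = \bigcap_n [set w : walk G | w n.+1 \notin K]).
  apply: bigcapT_measurable => n.
  exact: (@measurable_coord n.+1 [set x | x \notin K]).
by apply/seteqP; split=> [w wK n _|w wK [//|n] _]; [exact: wK|exact: (wK n)].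
Qed.

Let hist (y : V) (h : seq V) : set (walk G) :=
  if (0 < size h)%N && (last (root G) h == y)
  then prefix_event (size h).-1 (nth (root G) h) else set0.

Let hist_exit (y : V) (h : seq V) : set (walk G) :=
  walk_shift (size h).-1 @^-1` no_return [fset y]%fset `&` hist y h.

Let measurable_hist y h : measurable (hist y h).
Proof. by rewrite /hist; case: ifPn => // _; exact: measurable_prefix. Qed.

Let measurable_hist_exit y h : measurable (hist_exit y h).
Proof.
apply: measurableI => //; rewrite -[X in measurable X]setTI.
by apply: measurable_walk_shift => //; exact: measurable_no_return.
Qed.

Let law_hist_exit x y h :
  X x (hist_exit y h) = X y (no_return [fset y]%fset) * X x (hist y h).
Proof.
rewrite /hist_exit /hist; case: ifPn => [/andP[h0 /eqP hy]|_]; last first.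
  by rewrite setI0 !measure0 mule0.
rewrite markov_property; last exact: measurable_no_return.
by rewrite muleC nth_last hy.
Qed.

Let hist_exit_inj y h h' w : hist_exit y h w -> hist_exit y h' w -> h = h'.
Proof.
rewrite /hist_exit /hist => -[+ +] [+ +].
case: ifPn => // /andP[h0 /eqP hy] + wh.
case: ifPn => // /andP[h'0 /eqP h'y] + + wh'.
wlog hh' : h h' h0 h'0 hy h'y wh wh' / (size h <= size h')%N.
  case/orP: (leq_total (size h) (size h')) => hh' H; first exact: H.
  by move=> ? ?; apply/esym/H.
move=> e e'; move: hh'; rewrite leq_eqVlt => /orP[/eqP hh'|hh'].
  apply: (@eq_from_nth _ (root G)) => // i ih.
  by rewrite -wh ?wh'// -ltnS prednK// -hh'.
have wy : w (size h').-1 = y by rewrite wh'// nth_last.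
have lt : ((size h).-1 < (size h').-1)%N by rewrite -ltnS !prednK.
have := e ((size h').-1 - (size h).-1)%N.
rewrite subn_gt0 lt => /(_ isT).
rewrite /walk_shift (subnKC (ltnW lt)) wy => /negP[].
exact: fset11.
Qed.

Let seqe (F : seq V -> set (walk G)) (k : nat) : set (walk G) :=
  if pickle_inv k is Some h then F h else set0.

Lemma finite_visits_ae x y :
  (X x).-negligible [set w | ~ finite_set [set n | w n = y]].
Proof.
set p := X y (no_return [fset y]%fset).
have p0 : 0 < p by exact: law_transient.
have pfin : p \is a fin_num by apply: fin_num_measure; exact: measurable_no_return.
have mF F : (forall h, measurable (F h)) -> forall k, measurable (seqe F k).
  by move=> mF k; rewrite /seqe; case: pickle_inv.
have le1 : p * \sum_(k <oo) X x (seqe (hist y) k) <= 1.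
  rewrite -(fineK pfin) -nneseriesZl; last by move=> k _; exact: measure_ge0.
  have eqE k : (fine p)%:E * X x (seqe (hist y) k) = X x (seqe (hist_exit y) k).
    rewrite (fineK pfin) /seqe; case: pickle_inv => [h|].
      by rewrite law_hist_exit.
    by rewrite !measure0 mule0.
  under eq_eseriesr do rewrite eqE.
  have tE : trivIset setT (seqe (hist_exit y)).
    apply/trivIsetP => i j _ _ ij; apply/seteqP; split=> // w [].
    rewrite /seqe.
    have := @pickle_invK (seq V : countType) i.
    have := @pickle_invK (seq V : countType) j.
    case: (pickle_inv i) => [h|//]; case: (pickle_inv j) => [h'|//] /= ej ei.
    move=> eh eh'; move/eqP: ij; apply.
    by rewrite -ei -ej (hist_exit_inj eh eh').
  have mE k : measurable (seqe (hist_exit y) k) by exact: mF.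
  have := measure_semi_bigcup (X x) mE tE (bigcupT_measurable _ mE).
  move=> <-; apply: probability_le1; exact: bigcupT_measurable.
have Soo : \sum_(k <oo) X x (seqe (hist y) k) < +oo.
  rewrite ltey; apply/eqP => Soo; move: le1.
  by rewrite Soo gt0_muley// leye_eq.
have mH k : measurable (seqe (hist y) k) by exact: mF.
exists (lim_sup_set (seqe (hist y))); split.
- by apply: bigcapT_measurable => n; exact: bigcup_measurable.
- exact: lim_sup_set_cvg0.
- move=> w winf N _; apply: contrapT => noN; apply: winf.
  pose f n := choice.pickle (mkseq w n.+1).
  have finj : injective f.
    move=> i j /(pcan_inj pickleK_inv)/(congr1 size).
    by rewrite !size_mkseq => -[].
  apply: (@sub_finite_set _ _ (f @^-1` `I_N)); last first.
    by apply: finite_preimage; [exact: in2W|exact: finite_II].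
  move=> n /= wn; rewrite ltnNge; apply/negP => Nn; apply: noN.
  exists (f n) => //; rewrite /seqe /f pickleK_inv /hist size_mkseq.
  rewrite ifT; first exact: prefix_cover.
  by rewrite -nth_last size_mkseq nth_mkseq//= wn eqxx.
Qed.

Lemma nearest_neighbour_ae x n :
  (X x).-negligible [set w | ~ adj (w n) (w n.+1)].
Proof.
pose F h := if adj (nth (root G) h n) (nth (root G) h n.+1) then set0
  else prefix_event n.+1 (nth (root G) h).
apply: (@negligibleS _ _ _ _ (\bigcup_k seqe F k)).
  move=> w wn; exists (choice.pickle (mkseq w n.+2)) => //.
  rewrite /seqe pickleK_inv /F ifF; first exact: prefix_cover.
  by rewrite !nth_mkseq//; exact/negP.
apply: negligible_bigcup => k; rewrite /seqe.
case: pickle_inv => [h|]; last exact: negligible_set0.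
rewrite /F; case: ifPn => [_|nadj]; first exact: negligible_set0.
apply/negligibleP; first exact: measurable_prefix.
by have := lawS x n (nth (root G) h); rewrite /trans_prob (negbTE nadj) mule0.
Qed.

Lemma ftraj_set_nonempty : ftraj_set G !=set0.
Proof.
apply/set0P/eqP => F0.
have : (X (root G)).-negligible [set: walk G].
  pose inf k := if pickle_inv k is Some y then
    [set w : walk G | ~ finite_set [set n | w n = y]] else set0.
  apply: (@negligibleS _ _ _ _
    ((\bigcup_n [set w : walk G | ~ adj (w n) (w n.+1)]) `|` \bigcup_k inf k)).
    move=> w _; have /not_andP[/existsNP[n wn]|/existsNP[y wy]] :
        ~ ftraj_set G w by rewrite F0.
    + by left; exists n.
    + by right; exists (choice.pickle y) => //; rewrite /inf pickleK_inv.
  apply: negligibleU; apply: negligible_bigcup => k.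
    exact: nearest_neighbour_ae.
  rewrite /inf; case: pickle_inv => [y|]; last exact: negligible_set0.
  exact: finite_visits_ae.
move=> /(measure_negligible measurableT) X0.
by have /eqP := probability_setT (X (root G)); rewrite X0 eq_sym onee_eq0.
Qed.

Lemma itraj_set_nonempty : itraj_set G !=set0.
Proof.
have [u [uadj ufin]] := ftraj_set_nonempty.
exists (fun n => u `|n|%N); split=> [[n|n]|x].
- by rewrite -PoszD addn1 /= uadj.
- have -> : (Negz n + 1 = - Posz n)%R by rewrite NegzE -addn1 PoszD opprD subrK.
  by rewrite abszN absz_nat /= adj_sym.
- have -> : [set n : int | u `|n|%N = x] =
      (Posz @` [set n | u n = x]) `|` ((fun n => - Posz n)%R @` [set n | u n = x]).
    apply/seteqP; split=> [[n|n] /= un|_ [[n un <-]|[n un <-]] /=].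
    + by left; exists n.
    + by right; exists n.+1.
    + by [].
    + by rewrite abszN absz_nat.
  by rewrite finite_setU; split; exact: finite_image.
Qed.
End transience_facts.

Section trajectory_operations.
Context {R : realType} {G : wgraph R}.

Lemma itraj_shift_subproof (w : itraj_set G) k :
  (fun n => val w (n + k)) \in itraj_set G.
Proof.
have [wadj wfin] := set_mem (valP w); apply/mem_set; split=> [n|x].
  by rewrite addrAC; exact: wadj.
apply: (@finite_preimage _ _ [set n | val w n = x] (fun n => n + k)) => //.
by move=> i j _ _ /addIr.
Qed.

Lemma itraj_fwd_subproof (w : itraj_set G) :
  (fun n : nat => val w n%:Z) \in ftraj_set G.
Proof.
have [wadj wfin] := set_mem (valP w); apply/mem_set; split=> [n|x].
  by rewrite -addn1 PoszD; exact: wadj.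
apply: (@finite_preimage _ _ [set n | val w n = x] Posz) => //.
by move=> i j _ _ [].
Qed.

Lemma itraj_bwd_subproof (w : itraj_set G) :
  (fun n : nat => val w (- n%:Z)) \in ftraj_set G.
Proof.
have [wadj wfin] := set_mem (valP w); apply/mem_set; split=> [n|x].
  rewrite adj_sym; have := wadj (- n.+1%:Z).
  by rewrite -addn1 PoszD opprD subrK.
apply: (@finite_preimage _ _ [set n | val w n = x] (fun n : nat => - n%:Z)) => //.
by move=> i j _ _ /oppr_inj[].
Qed.

End trajectory_operations.

Section sum_sigma_algebra.
Context d1 d2 (T1 : measurableType d1) (T2 : measurableType d2).

Definition sum_measurable : set (set (T1 + T2)) :=
  [set D | measurable (inl @^-1` D) /\ measurable (inr @^-1` D)].

Let sum_measurable0 : sum_measurable set0.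
Proof. by split; rewrite preimage_set0. Qed.

Let sum_measurableC A : sum_measurable A -> sum_measurable (~` A).
Proof. by move=> [A1 A2]; split; rewrite preimage_setC; exact: measurableC. Qed.

Let sum_measurable_bigcup (F : (set (T1 + T2))^nat) :
  (forall i, sum_measurable (F i)) -> sum_measurable (\bigcup_i F i).
Proof.
by move=> mF; split; rewrite preimage_bigcup;
  apply: bigcupT_measurable => i; case: (mF i).
Qed.

HB.instance Definition _ := isPointed.Build (T1 + T2)%type (inl point).
HB.instance Definition _ := @isMeasurable.Build default_measure_display
  (T1 + T2)%type sum_measurable sum_measurable0 sum_measurableC
  sum_measurable_bigcup.

End sum_sigma_algebra.

Section point_measures.
Context d (T : measurableType d) (R : realType).
Local Open Scope ereal_scope.

(** A point measure is encoded by an enumeration of its atoms in which [None]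
    contributes nothing, so that finite sums of Dirac masses are included. *)
Definition atom (t : option T) : {measure set T -> \bar R} :=
  if t is Some a then dirac a else mzero.

Definition point_measure (s : nat -> option T) : {measure set T -> \bar R} :=
  mseries (fun i => atom (s i)) 0.

(** Generator of the sigma-algebra making all evaluations at measurable sets
    measurable. *)
Definition evaluation_sets (S : set {measure set T -> \bar R}) :
    set (set S) :=
  \bigcup_(D in measurable)
    preimage_set_system setT (fun mu : S => val mu D) measurable.

Definition pmeasure_set : set {measure set T -> \bar R} :=
  [set mu | exists s, mu = point_measure s].

Lemma point_measure_in s : point_measure s \in pmeasure_set.
Proof. by apply/mem_set; exists s. Qed.

Definition pmeasure_base : Type := pmeasure_set.
HB.instance Definition _ := gen_eqMixin pmeasure_base.
HB.instance Definition _ := gen_choiceMixin pmeasure_base.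
HB.instance Definition _ := isPointed.Build pmeasure_base
  (exist (fun m => m \in pmeasure_set) _ (point_measure_in (fun=> None))).

Definition pmeasure :=
  g_sigma_algebraType (@evaluation_sets pmeasure_set : set (set pmeasure_base)).

Definition to_pmeasure (s : nat -> option T) : pmeasure :=
  exist (fun m => m \in pmeasure_set) _ (point_measure_in s).

End point_measures.

Section trajectories.
Context {R : realType} {G : wgraph R} (X : transient_chain G).

Definition ftraj_base of transient_chain G : Type := ftraj_set G.
HB.instance Definition _ := Choice.copy (ftraj_base X) (set_type (ftraj_set G)).
HB.instance Definition _ := isPointed.Build (ftraj_base X)
  (exist (fun w => w \in ftraj_set G) _
    (mem_set (svalP (cid (ftraj_set_nonempty X))))).

Definition itraj_base of transient_chain G : Type := itraj_set G.
HB.instance Definition _ := Choice.copy (itraj_base X) (set_type (itraj_set G)).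
HB.instance Definition _ := isPointed.Build (itraj_base X)
  (exist (fun w => w \in itraj_set G) _
    (mem_set (svalP (cid (itraj_set_nonempty X))))).

(** The measurable spaces W+ and W. *)
Definition ftraj := g_sigma_algebraType
  (coord_sets (fun n (w : ftraj_base X) => val w n)).

Definition itraj := g_sigma_algebraType
  (coord_sets (fun n (w : itraj_base X) => val w n)).

Definition shift (k : int) (w : itraj) : itraj :=
  exist (fun w => w \in itraj_set G) _ (itraj_shift_subproof w k).
Definition fwd (w : itraj) : ftraj :=
  exist (fun w => w \in ftraj_set G) _ (itraj_fwd_subproof w).
Definition bwd (w : itraj) : ftraj :=
  exist (fun w => w \in ftraj_set G) _ (itraj_bwd_subproof w).

(** W* is the quotient of W by time translation, with the quotient
    sigma-algebra. *)
Definition shift_equiv (w w' : itraj) : bool :=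
  `[< exists k, shift k w = w' >].

Lemma itraj_eq (w w' : itraj) : val w =1 val w' -> w = w'.
Proof. by move=> ww'; apply/val_inj/funext. Qed.

Lemma shift0 w : shift 0 w = w.
Proof. by apply: itraj_eq => n /=; rewrite addr0. Qed.

Lemma shiftD k l w : shift k (shift l w) = shift (k + l) w.
Proof. by apply: itraj_eq => n /=; rewrite addrA. Qed.

Lemma shift_equiv_refl : reflexive shift_equiv.
Proof. by move=> w; apply/asboolP; exists 0; exact: shift0. Qed.

Lemma shift_equiv_sym : symmetric shift_equiv.
Proof.
by move=> w w'; apply/asboolP/asboolP => -[k <-]; exists (- k);
  rewrite shiftD addNr shift0.
Qed.

Lemma shift_equiv_trans : transitive shift_equiv.
Proof.
move=> w2 w1 w3 /asboolP[k <-] /asboolP[l <-]; apply/asboolP.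
by exists (l + k); rewrite shiftD.
Qed.

Canonical shift_equiv_rel :=
  EquivRel shift_equiv shift_equiv_refl shift_equiv_sym shift_equiv_trans.

Definition mtraj := {eq_quot shift_equiv}.
HB.instance Definition _ := Choice.on mtraj.
HB.instance Definition _ := isPointed.Build mtraj (\pi_mtraj point).

Definition mtraj_measurable : set (set mtraj) :=
  image_set_system setT (fun w : itraj => \pi_mtraj w) measurable.

Lemma sigma_mtraj : sigma_algebra setT mtraj_measurable.
Proof. exact/sigma_algebra_image/sigma_algebra_measurable. Qed.
Lemma mtraj_measurable0 : mtraj_measurable set0.
Proof. by case: sigma_mtraj. Qed.
Lemma mtraj_measurableC A : mtraj_measurable A -> mtraj_measurable (~` A).
Proof. by case: sigma_mtraj => _ + _ => /[apply]; rewrite setTD. Qed.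
Lemma mtraj_measurable_bigcup (F : (set mtraj)^nat) :
  (forall i, mtraj_measurable (F i)) -> mtraj_measurable (\bigcup_i F i).
Proof. by case: sigma_mtraj => _ _; apply. Qed.

HB.instance Definition _ := @isMeasurable.Build default_measure_display
  mtraj mtraj_measurable mtraj_measurable0 mtraj_measurableC
  mtraj_measurable_bigcup.

(** W_K and its projection W_K^*. *)
Definition hitting (K : {fset site G}) : set itraj :=
  [set w | exists n, val w n \in K].
Definition mhitting (K : {fset site G}) : set mtraj :=
  (fun w => \pi_mtraj w) @` hitting K.

Definition equilibrium (K : {fset site G}) (x : site G) : R :=
  if x \in K then vweight x * fine (X x (no_return K)) else 0.

(** Events of W+ seen as events of the canonical space. *)
Definition walks_of (B : set ftraj) : set (walk G) := val @` B.

(** P_x[A | no return to K]; when the conditioning event is null the quotient is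
    0 and so is [equilibrium K x]. *)
Definition law_given_no_return (K : {fset site G}) x (A : set ftraj) : R :=
  fine (X x (walks_of A `&` no_return K)) / fine (X x (no_return K)).

(** The characterization of nu_K on rectangles. *)
Definition is_nu_on (K : {fset site G}) (nuK : {measure set itraj -> \bar R}) :=
  forall (x : site G) (A B : set ftraj), measurable A -> measurable B ->
    nuK [set w | [/\ A (bwd w), val w 0 = x & B (fwd w)]] =
    (law_given_no_return K x A * equilibrium K x
       * fine (X x (walks_of B)))%:E.

(** The restriction of [nu] to W_K^* is the image of nu_K, for all finite K. *)
Definition is_intensity (nuK : {fset site G} -> {measure set itraj -> \bar R})
    (nu : {measure set mtraj -> \bar R}) :=
  forall K (D : set mtraj), measurable D ->
    nu (D `&` mhitting K) = nuK K [set w | D (\pi_mtraj w)].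

(** Locally finite point measures on W*. Measures are functions on all subsets,
    and membership fixes the values on all of them. *)
Definition config_set : set {measure set mtraj -> \bar R} :=
  [set om | pmeasure_set om /\ forall K, (om (mhitting K) < +oo)%E].

Lemma config_set_point : point_measure R (fun=> None) \in config_set.
Proof.
apply/mem_set; split; first by exists (fun=> None).
by move=> K; rewrite /point_measure /= /mseries eseries0.
Qed.

Definition config_base : Type := config_set.
HB.instance Definition _ := gen_eqMixin config_base.
HB.instance Definition _ := gen_choiceMixin config_base.
HB.instance Definition _ := isPointed.Build config_base
  (exist (fun m => m \in config_set) _ config_set_point).

Definition config :=
  g_sigma_algebraType (@evaluation_sets _ _ _ config_set : set (set config_base)).

Definition count (om : config) (D : set mtraj) : \bar R := val om D.

(** Poisson point process of intensity [nu]: Poisson counts (infinite almost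
    surely on sets of infinite intensity), independent on disjoint sets. *)
Definition is_poisson (nu : {measure set mtraj -> \bar R})
    (PP : probability config R) :=
  [/\ (forall (D : set mtraj) (k : nat), measurable D -> (nu D < +oo)%E ->
         PP [set om | count om D = k%:R%:E] =
         (expR (- fine (nu D)) * fine (nu D) ^+ k / k`!%:R)%:E),
      (forall D : set mtraj, measurable D -> nu D = +oo%E ->
         PP [set om | count om D = +oo%E] = 1%E) &
      (forall (n : nat) (D : 'I_n -> set mtraj) (B : 'I_n -> set (\bar R)),
         (forall i, measurable (D i)) -> (forall i, measurable (B i)) ->
         trivIset setT D ->
         PP [set om | forall i, B i (count om (D i))] =
         (\prod_(i < n) PP [set om | B i (count om (D i))])%E)].

(** The supremum is attained when [w] hits [K], see [last_visitP]. *)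
Definition last_visit (K : {fset site G}) (w : itraj) : int :=
  supremum 0 [set n | val w n \in K].

Lemma last_visitP (K : {fset site G}) (w : itraj) : hitting K w ->
  val w (last_visit K w) \in K /\
  forall n, val w n \in K -> (n <= last_visit K w)%R.
Proof.
move=> [n0 wn0]; set S := [set n | val w n \in K].
have finS : finite_set S.
  rewrite (_ : S = \bigcup_(x in [set` K]) [set n | val w n = x]).
    by apply: bigcup_finite => // x _; have [_] := set_mem (valP w); exact.
  by apply/seteqP; split=> [n wn|n [x xK] /= wn]; [exists (val w n)|rewrite /S /= wn].
pose m := \big[Order.max/n0]_(n <- fset_set S) n.
have mS : S m.
  rewrite /m big_seq; apply: (big_ind S) => //.
    by move=> i j Si Sj; rewrite maxEle; case: ifPn.
  by move=> i; rewrite in_fset_set// inE.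
have mub : ubound S m.
  by move=> n Sn; apply: le_bigmax_seq => //; rewrite in_fset_set// inE.
have msup : supremums S m by split=> // u; exact.
suff -> : last_visit K w = m by split=> //; exact: mub.
rewrite /last_visit /supremum -/S ifF; last by apply/negbTE/set0P; exists m.
by apply: (is_subset1_supremums _ msup); apply: xgetPex; exists m.
Qed.

Definition out_traj (K : {fset site G}) (w : itraj) : ftraj :=
  fwd (shift (last_visit K w) w).

(** The value does not depend on the representative [repr c], see
    [out_atom_pi]. *)
Definition out_atom (K : {fset site G}) (c : mtraj) : ftraj + mtraj :=
  if c \in mhitting K then inl (out_traj K (repr c)) else inr c.

Lemma out_traj_shift (K : {fset site G}) k (w : itraj) : hitting K w ->
  out_traj K (shift k w) = out_traj K w.
Proof.
move=> wK; have kwK : hitting K (shift k w).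
  by case: wK => n wn; exists (n - k); rewrite /= subrK.
have [lK lmax] := last_visitP wK; have [l'K l'max] := last_visitP kwK.
rewrite /out_traj shiftD (_ : last_visit K w = last_visit K (shift k w) + k)//.
apply/eqP; rewrite eq_le lmax// andbT -lerBlDr l'max//=.
by rewrite subrK.
Qed.

Lemma out_atom_pi (K : {fset site G}) (w : itraj) : hitting K w ->
  out_atom K (\pi_mtraj w) = inl (out_traj K w).
Proof.
move=> wK; rewrite /out_atom ifT; last by apply/mem_set; exists w.
have /eqmodP/asboolP[k <-] : \pi_mtraj w = \pi_mtraj (repr (\pi_mtraj w)).
  by rewrite reprK.
by rewrite out_traj_shift.
Qed.

Lemma config_atoms (om : config) :
  exists s : nat -> option mtraj, val om = point_measure R s.
Proof. by case: (set_mem (valP om)). Qed.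

(** An enumeration of the atoms; [out] depends only on the multiset they form,
    which [om] determines. *)
Definition atoms (om : config) : nat -> option mtraj :=
  sval (cid (config_atoms om)).

Definition out (K : {fset site G}) (om : config) :
    pmeasure (ftraj + mtraj)%type R :=
  to_pmeasure R (fun i => omap (out_atom K) (atoms om i)).

Definition future_algebra : set (set config) :=
  \bigcap_(K in [set: {fset site G}]) g_sigma_algebra_preimage (out K).

End trajectories.
Arguments future_algebra {R G} X.

(* Main.v *)
(** The counts [N B] of trajectories are Poisson and independent, so their law
    is governed by the generating functions of the products [phi] of [s_i ^ N(B_i)],
    which determine all events (two power series that agree on [0, 1[ coincide).
    It is therefore enough to show that a future event [E] is uncorrelated with
    [phi] when the cells [B_i] with [s_i <> 1] lie in [W_K^*].

    For [K'] containing [K], [E] is a function of the counts of sets of the form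
    [Out_K' \in C]; approximate it by finitely many cells [A_j] of this form, each
    with a fixed exit point [x_j] from [K']. Given the counts of these cells, the
    conditional expectation of [phi] is the product of [m_j ^ N(A_j)] with
    [(1 - m_j) nu(A_j) <= nu(A_j `&` W_K^* )], and its variance is at most the sum
    of the [(1 - m_j)^2 nu(A_j)].

    Reversing the chain at its last exit from [K'] gives
    [nu(A_j `&` W_K^* ) = h(x_j) nu(A_j)], with [h(x)] the probability to hit [K]
    from [x]. The variance is thus at most the integral of [h] at the exit point
    from [K'] over [W_K^*]. It tends to 0 when [K'] grows: by transience and a
    maximal inequality, [h] is small along the path at all late times. *)
Require Import Defs.
From mathcomp Require Import all_boot all_order all_algebra finmap.
From mathcomp Require Import generic_quotient.
From mathcomp Require Import all_classical all_reals all_analysis.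
From mathcomp Require Import measurable_realfun ring lra.

Set Implicit Arguments.
Unset Strict Implicit.
Unset Printing Implicit Defensive.
Import Order.TTheory GRing.Theory Num.Theory numFieldNormedType.Exports.

Local Open Scope classical_set_scope.
Local Open Scope ring_scope.

(** * Bounded random variables *)

(** The future event [E] is not independent of [phi]: the final parts of the trajectories of W_K^*
    are visible in Out_K', so only an asymptotic decorrelation can be hoped for. It is uniform
    because the proportion h(x_j) of trajectories of A_j that meet [K] depends on A_j only through
    its exit point. The variance bound is the same for every finite family of cells refining the
    exit point, so K' is fixed before [E] is approximated, and the number of cells needed for the
    approximation never enters.

    No abstract conditional expectation is constructed: it is given by its formula, and shown to
    have the same integrals as [phi] over the events of the cell counts by comparing generating
    functions.

    The trajectories that miss K' also form cells, possibly of infinite intensity. They are harmless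
    because they miss [K], but they are the reason why counts, powers and generating functions are
    defined at [+oo]. *)

Section bounded_expectation.
Context d (T : measurableType d) (R : realType) (P : probability T R).
Implicit Types f g : T -> R.

(** A class stable under the ring operations and made of integrable functions, so that the
    real-valued [mean] is linear with no integrability condition to carry. *)
Definition bounded_measurable f :=
  measurable_fun setT f /\ exists C, forall x, `|f x| <= C.

Lemma bounded_measurable_cst r : bounded_measurable (cst r).
Proof. by split; [exact: measurable_cst|exists `|r|]. Qed.

Lemma bounded_measurableM f g : bounded_measurable f -> bounded_measurable g ->
  bounded_measurable (fun x => f x * g x).
Proof.
move=> [mf [C fC]] [mg [D gD]]; split; first exact: measurable_funM.
by exists (C * D) => x; rewrite normrM ler_pM.
Qed.

Lemma bounded_measurableD f g : bounded_measurable f -> bounded_measurable g ->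
  bounded_measurable (fun x => f x + g x).
Proof.
move=> [mf [C fC]] [mg [D gD]]; split; first exact: measurable_funD.
by exists (C + D) => x; rewrite (le_trans (ler_normD _ _))// lerD.
Qed.

Lemma bounded_measurableB f g : bounded_measurable f -> bounded_measurable g ->
  bounded_measurable (fun x => f x - g x).
Proof.
move=> [mf [C fC]] [mg [D gD]]; split; first exact: measurable_funB.
by exists (C + D) => x; rewrite (le_trans (ler_normB _ _))// lerD.
Qed.

Lemma bounded_measurable_norm f : bounded_measurable f ->
  bounded_measurable (fun x => `|f x|).
Proof.
move=> [mf [C fC]]; split; first exact: measurableT_comp.
by exists C => x; rewrite normr_id.
Qed.

Lemma bounded_measurable_indic A : measurable A -> bounded_measurable \1_A.
Proof.
move=> mA; split; first exact: measurable_indic.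
by exists 1 => x; rewrite indicE; case: (_ \in _); rewrite ?normr1 ?normr0.
Qed.

Lemma bounded_measurable_sum (I : Type) (r : seq I) (F : I -> T -> R) :
  (forall i, bounded_measurable (F i)) ->
  bounded_measurable (fun x => \sum_(i <- r) F i x).
Proof.
move=> bF; elim: r => [|i r IH].
  under eq_fun do rewrite big_nil; exact: bounded_measurable_cst.
under eq_fun do rewrite big_cons; exact: bounded_measurableD.
Qed.

Lemma bounded_measurable_prod (I : Type) (r : seq I) (F : I -> T -> R) :
  (forall i, bounded_measurable (F i)) ->
  bounded_measurable (fun x => \prod_(i <- r) F i x).
Proof.
move=> bF; elim: r => [|i r IH].
  under eq_fun do rewrite big_nil; exact: bounded_measurable_cst.
under eq_fun do rewrite big_cons; exact: bounded_measurableM.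
Qed.

Lemma bounded_measurable_integrable f A : measurable A ->
  bounded_measurable f -> P.-integrable A (EFin \o f).
Proof.
move=> mA [mf [C fC]]; apply: measurable_bounded_integrable => //.
- by rewrite (le_lt_trans (probability_le1 P mA))// ltry.
- exact: measurable_funTS.
- exists C; split; first exact: num_real.
  by move=> M CM x _ /=; rewrite (le_trans (fC x))// ltW.
Qed.

Definition mean f : R := \int[P]_x f x.

Lemma mean_cst r : mean (cst r) = r.
Proof.
rewrite /mean Rintegral_cst//.
have := congr1 (fun x => r * fine x) (@probability_setT _ _ _ P).
by rewrite /= mulr1.
Qed.

Lemma meanD f g : bounded_measurable f -> bounded_measurable g ->
  mean (fun x => f x + g x) = mean f + mean g.
Proof. by move=> bf bg; apply: RintegralD => //; exact: bounded_measurable_integrable. Qed.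

Lemma meanB f g : bounded_measurable f -> bounded_measurable g ->
  mean (fun x => f x - g x) = mean f - mean g.
Proof. by move=> bf bg; apply: RintegralB => //; exact: bounded_measurable_integrable. Qed.

Lemma meanZl r f : bounded_measurable f -> mean (fun x => r * f x) = r * mean f.
Proof. by move=> bf; apply: RintegralZl => //; exact: bounded_measurable_integrable. Qed.

Lemma eq_mean f g : f =1 g -> mean f = mean g.
Proof. by move=> /funext ->. Qed.

Lemma le_mean f g : bounded_measurable f -> bounded_measurable g ->
  (forall x, f x <= g x) -> mean f <= mean g.
Proof.
by move=> bf bg fg; apply: le_Rintegral => //; exact: bounded_measurable_integrable.
Qed.

Lemma mean_le f r : bounded_measurable f -> (forall x, f x <= r) -> mean f <= r.
Proof.
move=> bf fr; rewrite -[leRHS]mean_cst; apply: le_mean => //.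
exact: bounded_measurable_cst.
Qed.

Lemma mean_ge0 f : (forall x, 0 <= f x) -> 0 <= mean f.
Proof. by move=> f0; apply: Rintegral_ge0. Qed.

Lemma norm_mean_le f g : bounded_measurable f -> bounded_measurable g ->
  (forall x, `|f x| <= g x) -> `|mean f| <= mean g.
Proof.
move=> bf bg fg.
apply: (le_trans (le_normr_Rintegral _ (bounded_measurable_integrable _ bf))) => //.
apply: le_mean => //; exact: bounded_measurable_norm.
Qed.

Lemma mean_sum (I : Type) (r : seq I) (F : I -> T -> R) :
  (forall i, bounded_measurable (F i)) ->
  mean (fun x => \sum_(i <- r) F i x) = \sum_(i <- r) mean (F i).
Proof.
move=> bF; elim: r => [|i r IH].
  by rewrite big_nil -[RHS](mean_cst 0); apply: eq_mean => x; rewrite big_nil.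
rewrite big_cons -IH -meanD//; last exact: bounded_measurable_sum.
by apply: eq_mean => x; rewrite big_cons.
Qed.

Lemma mean_indic A : measurable A -> mean \1_A = fine (P A).
Proof. by move=> mA; rewrite /mean /Rintegral integral_indic// setIT. Qed.

(** Integrate r |f| <= (r^2 + f^2) / 2. This replaces the Cauchy-Schwarz inequality and avoids
    square roots, at the cost of a free parameter [r]. *)
Lemma mean_norm_sqr_le f r : bounded_measurable f -> 0 < r ->
  mean (fun x => `|f x|) <= r / 2 + mean (fun x => f x * f x) / (2 * r).
Proof.
move=> bf r0; have bff := bounded_measurableM bf bf.
have := mean_cst (r / 2) => mc; rewrite -[X in X + _]mc [X in _ + X]mulrC -meanZl// -meanD//.
- apply: le_mean.
  + exact: bounded_measurable_norm.
  + apply: bounded_measurableD; first exact: bounded_measurable_cst.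
    apply: bounded_measurableM => //; exact: bounded_measurable_cst.
  + move=> x /=; rewrite -subr_ge0 [f x * f x](_ : _ = `|f x| ^+ 2).
      have -> : r / 2 + (2 * r)^-1 * `|f x| ^+ 2 - `|f x| =
          (2 * r)^-1 * (r - `|f x|) ^+ 2 by field; rewrite gt_eqF.
      by rewrite mulr_ge0 ?sqr_ge0// invr_ge0 mulr_ge0// ltW.
    by rewrite -expr2 real_normK// num_real.
- exact: bounded_measurable_cst.
- apply: bounded_measurableM => //; exact: bounded_measurable_cst.
Qed.

End bounded_expectation.

(** * Powers with a possibly infinite count as exponent *)

Section count_powers.
Context (R : realType).
Implicit Types (s t : R) (x y : \bar R).

Definition nat_valued x := x = +oo%E \/ exists k : nat, x = k%:R%:E.

(** [t ^ x] for a count [x], with [t ^ oo] the limit of the powers [t ^ n]; the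
    values at non-counts are junk. *)
Definition cpow t x : R :=
  if t == 1 then 1 else if x is r%:E then t ^+ Num.truncn r else 0.

Lemma cpow_nat t k : cpow t k%:R%:E = t ^+ k.
Proof. by rewrite /cpow; case: eqP => [->|_]; rewrite ?expr1n// natrK. Qed.

Lemma cpow1 x : cpow 1 x = 1.
Proof. by rewrite /cpow eqxx. Qed.

Lemma cpow_pinfty t : t != 1 -> cpow t +oo%E = 0.
Proof. by rewrite /cpow => /negbTE ->. Qed.

Lemma cpowD t x y : nat_valued x -> nat_valued y ->
  cpow t (x + y)%E = cpow t x * cpow t y.
Proof.
have [->|t1] := eqVneq t 1; first by rewrite !cpow1 mulr1.
move=> [->|[k ->]] [->|[l ->]].
- by rewrite cpow_pinfty// mulr0.
- by rewrite cpow_pinfty// mul0r.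
- by rewrite addey// cpow_pinfty// mulr0.
- by rewrite -EFinD -natrD !cpow_nat exprD.
Qed.

(** The bounds are there for [x = +oo]: with [s = 2] and [t = 1/2] the left side would be 1 and the
    right side 0. *)
Lemma cpowM s t x : 0 <= s <= 1 -> 0 <= t <= 1 -> nat_valued x ->
  cpow (s * t) x = cpow s x * cpow t x.
Proof.
move=> /andP[s0 s1] /andP[t0 t1].
have [->|sn1] := eqVneq s 1; first by rewrite cpow1 !mul1r.
have [->|tn1] := eqVneq t 1; first by rewrite cpow1 !mulr1.
move=> [->|[k ->]]; last by rewrite !cpow_nat exprMn.
rewrite !cpow_pinfty// ?mulr0//.
have s_lt1 : s < 1 by rewrite lt_neqAle sn1.
by rewrite lt_eqF// (le_lt_trans _ s_lt1)// ler_piMr.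
Qed.

Lemma cpow_itv t x : 0 <= t <= 1 -> 0 <= cpow t x <= 1.
Proof.
move=> /andP[t0 t1]; rewrite /cpow; case: eqP => _; first by rewrite ler01 lexx.
by case: x => [r||]; rewrite ?lexx ?ler01// exprn_ge0//= exprn_ile1.
Qed.

(** At most one term of the sum is non-zero, the one with [k = x]; the remainder is therefore 0, or
    [t ^ x] for a finite [x >= m]. *)
Lemma cpow_series t x m : 0 <= t < 1 -> nat_valued x ->
  0 <= cpow t x - \sum_(k < m) t ^+ k * (x == k%:R%:E)%:R <= t ^+ m.
Proof.
move=> /andP[t0 t1] [->|[l ->]].
  rewrite cpow_pinfty ?lt_eqF// big1 ?subrr ?lexx ?exprn_ge0// => k _.
  by rewrite mulr0.
rewrite cpow_nat; have [lm|ml] := ltnP l m.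
  rewrite (bigD1 (Ordinal lm))//= eqxx mulr1 big1 ?addr0 ?subrr ?lexx ?exprn_ge0//.
  move=> k kl; rewrite eqe eqr_nat (negbTE (_ : l != k)) ?mulr0//.
  by apply: contra_neq kl => lk; apply/val_inj.
rewrite big1 ?subr0 => [|k _].
  by rewrite exprn_ge0//= ler_wiXn2l// ltW.
by rewrite eqe eqr_nat gtn_eqF ?mulr0// (leq_trans (ltn_ord k)).
Qed.

Context d (T : measurableType d).

Lemma measurable_eq_nat (N : T -> \bar R) k : measurable_fun setT N ->
  measurable [set w | N w = k%:R%:E].
Proof.
by move=> mN; rewrite -[X in measurable X]setTI; exact: (mN measurableT [set k%:R%:E]).
Qed.

Lemma bounded_measurable_eq_nat (N : T -> \bar R) k : measurable_fun setT N ->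
  bounded_measurable (fun w => (N w == k%:R%:E)%:R : R).
Proof.
move=> mN; rewrite (_ : (fun w => _) = \1_[set w | N w = k%:R%:E]).
  exact/bounded_measurable_indic/measurable_eq_nat.
apply/funext => w; rewrite indicE; congr (nat_of_bool _)%:R.
by apply/eqP/idP => [|/set_mem//] => ?; apply/mem_set.
Qed.

Lemma bounded_measurable_cpow t (N : T -> \bar R) : 0 <= t <= 1 ->
  measurable_fun setT N -> (forall w, nat_valued (N w)) ->
  bounded_measurable (fun w => cpow t (N w)).
Proof.
move=> t01 mN vN; split; last first.
  exists 1 => w; have /andP[c0 c1] := cpow_itv (N w) t01.
  by rewrite ger0_norm.
have [->|t1] := eqVneq t 1.
  under eq_fun do rewrite cpow1; exact: measurable_cst.
have t_lt1 : 0 <= t < 1 by case/andP: t01 => -> t1'; rewrite lt_neqAle t1.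
apply: (@measurable_fun_cvg _ _ _ _
  (fun m w => \sum_(k < m) t ^+ k * (N w == k%:R%:E)%:R)) => // [m|w _].
  apply: (bounded_measurable_sum _ _).1 => k.
  apply: bounded_measurableM; first exact: bounded_measurable_cst.
  exact: bounded_measurable_eq_nat.
apply/cvgrPdist_le => e e0.
have : geometric 1 t @ \oo --> 0.
  by apply: cvg_geometric; case/andP: t_lt1 => t0 ?; rewrite ger0_norm.
move/cvgrPdist_le => /(_ _ e0); apply: filterS => m.
rewrite sub0r normrN /= mul1r => tm.
have /andP[s0 s1] := cpow_series m t_lt1 (vN w).
rewrite ger0_norm// (le_trans s1)//.
by rewrite (le_trans _ tm)// ler_norm.
Qed.

End count_powers.

(** * Uniqueness of generating functions *)

Section determining_class.
Context d (T : measurableType d) (R : realType) (P : probability T R).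

Lemma mean_indicM (f : T -> R) A :
  mean P (fun w => f w * \1_A w) = \int[P]_(w in A) f w.
Proof.
rewrite [RHS]Rintegral_mkcond; apply: eq_mean => w.
by rewrite patchE indicE; case: ifPn => _; rewrite ?mulr1 ?mulr0.
Qed.

Lemma mean_indicM_dynkin (f : T -> R) : bounded_measurable f ->
  mean P f = 0 ->
  dynkin [set A | measurable A /\ mean P (fun w => f w * \1_A w) = 0].
Proof.
move=> bf f0; split.
- split=> //; rewrite -[RHS]f0; apply: eq_mean => w.
  by rewrite indicT mulr1.
- move=> A [mA A0]; split; first exact: measurableC.
  have bA : bounded_measurable (fun w => f w * \1_A w).
    exact/bounded_measurableM/bounded_measurable_indic.
  rewrite -[RHS](subrr 0) -[in X in X - _]f0 -[in X in _ - X]A0 -meanB//.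
  apply: eq_mean => w; rewrite !indicE in_setC.
  by case: (_ \in _); rewrite /= ?mulr1 ?mulr0 ?subrr ?subr0.
- move=> F tF FH; have mF n := (FH n).1.
  have mU := bigcupT_measurable _ mF.
  split=> //; rewrite mean_indicM /Rintegral integral_bigcup//; last first.
    exact: bounded_measurable_integrable.
  rewrite eseries0// => n _ _.
  have := (FH n).2; rewrite mean_indicM /Rintegral => fn0.
  rewrite -[LHS]fineK ?fn0//; apply: integrable_fin_num => //.
  exact: bounded_measurable_integrable.
Qed.

(** Coefficients of a power series vanishing on [0, 1[ are 0: once the first [k]
    are, [|a_k| t^k <= C t^(k+1)]. *)
Lemma cpow_mean_uniqueness (v : T -> R) (N : T -> \bar R) :
  bounded_measurable v -> measurable_fun setT N ->
  (forall w, nat_valued (N w)) ->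
  (forall t, 0 <= t < 1 -> mean P (fun w => v w * cpow t (N w)) = 0) ->
  forall k, mean P (fun w => v w * (N w == k%:R%:E)%:R) = 0.
Proof.
move=> bv mN vN v0; have [_ [C vC]] := bv.
have C0 : 0 <= C by apply: le_trans (vC point).
have bN k : bounded_measurable (fun w => v w * (N w == k%:R%:E)%:R).
  by apply: bounded_measurableM => //; exact: bounded_measurable_eq_nat.
elim/ltn_ind => k IH; set a := mean _ _.
have aC t : 0 < t < 1 -> `|a| <= C * t.
  move=> /andP[t0 t1].
  have t01 : 0 <= t < 1 by rewrite ltW.
  have bt : bounded_measurable (fun w => v w * cpow t (N w)).
    apply: bounded_measurableM => //; apply: bounded_measurable_cpow => //.
    by rewrite (ltW t0) (ltW t1).
  have bS : bounded_measurable (fun w =>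
      \sum_(l < k.+1) t ^+ l * (v w * (N w == l%:R%:E)%:R)).
    apply: bounded_measurable_sum => l; apply: bounded_measurableM => //.
    exact: bounded_measurable_cst.
  have := norm_mean_le P (bounded_measurableB bt bS)
    (bounded_measurable_cst T (C * t ^+ k.+1)).
  rewrite mean_cst meanB// v0// mean_sum; last first.
    by move=> l; apply: bounded_measurableM => //; exact: bounded_measurable_cst.
  rewrite big_ord_recr/= big1 => [|l _]; last by rewrite meanZl// IH ?mulr0.
  rewrite meanZl// !add0r normrN normrM ger0_norm ?exprn_ge0 ?(ltW t0)//.
  rewrite exprSr mulrCA ler_pM2l ?exprn_gt0// => -> // w.
  have -> : v w * cpow t (N w) - \sum_(l < k.+1) t ^+ l * (v w * (N w == l%:R%:E)%:R) =
      v w * (cpow t (N w) - \sum_(l < k.+1) t ^+ l * (N w == l%:R%:E)%:R).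
    rewrite mulrBr mulr_sumr; congr (_ - _).
    by apply: eq_bigr => l _; rewrite mulrCA.
  rewrite normrM [leRHS]mulrCA -exprSr ler_pM//.
  by have /andP[s0 s1] := cpow_series k.+1 t01 (vN w); rewrite ger0_norm.
apply/eqP; rewrite -normr_eq0; apply: contraT => a0.
have {}a0 : 0 < `|a| by rewrite lt_neqAle eq_sym a0 normr_ge0.
(* This value of [t] lies in ]0, 1[ and gives C t <= |a| / 2, against [aC]. *)
have := aC (`|a| / (2 * (C + `|a|))).
have D0 : 0 < 2 * (C + `|a|) by rewrite mulr_gt0// ltr_wpDl.
rewrite divr_gt0// ltr_pdivrMr// mul1r mulrDr ltr_wpDl ?mulr_ge0//; last first.
  by rewrite ltr_pMl ?ltr1n.
move=> /(_ isT); rewrite mulrA -mulrDr ler_pdivlMr// => H.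
suff : C * `|a| < `|a| * (2 * (C + `|a|)) by rewrite ltNge H.
by nra.
Qed.

(** After multiplication by [v], the remainder of [cpow_series] is at most [C * t ^ m]. The mean
    against powers is thus a power series whose coefficients are the means against the events
    [N = k]. *)
Lemma mean_cpow_cvg (v : T -> R) (N : T -> \bar R) t :
  bounded_measurable v -> measurable_fun setT N ->
  (forall w, nat_valued (N w)) -> 0 <= t < 1 ->
  \sum_(k < m) t ^+ k * mean P (fun w => v w * (N w == k%:R%:E)%:R)
    @[m --> \oo] --> mean P (fun w => v w * cpow t (N w)).
Proof.
move=> bv mN vN t01; have [_ [C vC]] := bv.
have C0 : 0 <= C by apply: le_trans (vC point).
have bN k : bounded_measurable (fun w => v w * (N w == k%:R%:E)%:R).
  by apply: bounded_measurableM => //; exact: bounded_measurable_eq_nat.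
have btN (k : nat) : bounded_measurable (fun w => t ^+ k * (v w * (N w == k%:R%:E)%:R)).
  by apply: bounded_measurableM => //; exact: bounded_measurable_cst.
have bt : bounded_measurable (fun w => v w * cpow t (N w)).
  apply: bounded_measurableM => //; apply: bounded_measurable_cpow => //.
  by case/andP: t01 => -> /ltW ->.
apply/cvgrPdist_le => e e0.
have : geometric C t @ \oo --> 0.
  by apply: cvg_geometric; case/andP: t01 => t0 ?; rewrite ger0_norm.
move/cvgrPdist_le => /(_ _ e0); apply: filterS => m.
rewrite sub0r normrN /= => tm.
under eq_bigr do rewrite -meanZl//.
have bS : bounded_measurable (fun w =>
    \sum_(k < m) t ^+ k * (v w * (N w == k%:R%:E)%:R)).
  by apply: bounded_measurable_sum => k; exact: btN.
rewrite -(@mean_sum _ _ _ P 'I_m _ (fun k w => t ^+ k * (v w * (N w == k%:R%:E)%:R)))//.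
rewrite -meanB//.
have tm' : C * t ^+ m <= e by apply: le_trans tm; exact: ler_norm.
apply: le_trans tm'; rewrite -[leRHS](mean_cst P); apply: norm_mean_le.
- exact: bounded_measurableB.
- exact: bounded_measurable_cst.
move=> w; have -> : v w * cpow t (N w) - \sum_(l < m) t ^+ l * (v w * (N w == l%:R%:E)%:R) =
    v w * (cpow t (N w) - \sum_(l < m) t ^+ l * (N w == l%:R%:E)%:R).
  rewrite mulrBr mulr_sumr; congr (_ - _).
  by apply: eq_bigr => l _; rewrite mulrCA.
rewrite normrM ler_pM//.
by have /andP[s0 s1] := cpow_series m t01 (vN w); rewrite ger0_norm.
Qed.

Definition generated_algebra (J : Type) (N : J -> T -> \bar R) : set (set T) :=
  <<s [set A | exists j, exists2 U : set (\bar R), measurable U & A = N j @^-1` U] >>.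

(** Powers of counts are turned into indicators of events [N j = k] by [cpow_mean_uniqueness], one
    factor at a time. The resulting cylinders form a pi-system, and the events orthogonal to [f] a
    lambda-system. *)
Lemma determining_class (J : Type) (N : J -> T -> \bar R) (M : set (T -> R))
    (f : T -> R) :
  bounded_measurable f ->
  (forall j, measurable_fun setT (N j)) -> (forall j w, nat_valued (N j w)) ->
  M (cst 1) -> (forall g, M g -> bounded_measurable g) ->
  (forall j t g, 0 <= t < 1 -> M g -> M (fun w => cpow t (N j w) * g w)) ->
  (forall g, M g -> mean P (fun w => f w * g w) = 0) ->
  forall F, generated_algebra N F ->
  measurable F /\ mean P (fun w => f w * \1_F w) = 0.
Proof.
move=> bf mN vN M1 bM MN M0.
pose cyl (L : seq (J * nat)) :=
  [set w | all (fun p => N p.1 w == p.2%:R%:E) L].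
have mcyl L : measurable (cyl L).
  elim: L => [|[j k] L IH].
    by rewrite (_ : cyl _ = setT)//; apply/seteqP; split.
  rewrite (_ : cyl _ = [set w | N j w = k%:R%:E] `&` cyl L).
    by apply: measurableI => //; exact: measurable_eq_nat.
  by apply/seteqP; split=> [w /andP[/eqP]|w [/= Njk cw]]; rewrite /cyl /= ?Njk ?eqxx.
have cylE L w : (w \in cyl L) = all (fun p => N p.1 w == p.2%:R%:E) L.
  by apply/idP/idP => [/set_mem|?]; [|exact/mem_set].
have cyl1 j k L w :
    \1_(cyl ((j, k) :: L)) w = (N j w == k%:R%:E)%:R * \1_(cyl L) w :> R.
  by rewrite !indicE !cylE/= -natrM mulnb.
(* Since [g] is arbitrary in [M], it can absorb the power of the factor being replaced when the
   induction hypothesis is applied. *)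
have cyl0 L g : M g -> mean P (fun w => f w * \1_(cyl L) w * g w) = 0.
  elim: L g => [|[j k] L IH] g Mg.
    rewrite -[RHS](M0 g Mg); apply: eq_mean => w.
    by rewrite indicE mem_set ?mulr1.
  have bfL : bounded_measurable (fun w => f w * \1_(cyl L) w).
    exact/bounded_measurableM/bounded_measurable_indic.
  rewrite -[RHS](@cpow_mean_uniqueness
    (fun w => f w * \1_(cyl L) w * g w) (N j) _ _ _ _ k)//.
  - by apply: eq_mean => w; rewrite cyl1; ring.
  - by apply: bounded_measurableM => //; exact: bM.
  - move=> t t01; rewrite -[RHS](IH _ (MN j t g t01 Mg)); apply: eq_mean => w.
    by rewrite -mulrA; congr (_ * _); rewrite mulrC.
pose G := [set A | exists L, A = cyl L].
have GI : setI_closed G.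
  move=> _ _ [L ->] [L' ->]; exists (L ++ L'); apply/seteqP.
  split=> [w [wL wL']|w]; rewrite /cyl /= all_cat; first exact/andP.
  by move=> /andP.
have f0 : mean P f = 0.
  by rewrite -[RHS](M0 _ M1); apply: eq_mean => w; rewrite mulr1.
have GH F : <<s G >> F -> measurable F /\ mean P (fun w => f w * \1_F w) = 0.
  have LH := (dynkin_lambda_system _).1 (mean_indicM_dynkin bf f0).
  apply: (lambda_system_subset GI LH) => // _ [L ->]; split=> //; rewrite -[RHS](cyl0 L _ M1).
  by apply: eq_mean => w; rewrite mulr1.
move=> F sF; apply: GH; move: F sF; apply: smallest_sub.
  exact: smallest_sigma_algebra.
move=> _ [j [U _ ->]].
have sA : sigma_algebra setT <<s G >> by exact: smallest_sigma_algebra.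
have sub1 k : <<s G >> [set w | N j w = k%:R%:E].
  apply: sub_sigma_algebra; exists [:: (j, k)].
  by apply/seteqP; split=> w; rewrite /cyl /= andbT => /eqP.
pose V := \bigcup_k (if `[< U k%:R%:E >] then [set w | N j w = k%:R%:E] else set0).
have sV (Q : set (\bar R)) : <<s G >>
    (\bigcup_k (if `[< Q k%:R%:E >] then [set w | N j w = k%:R%:E] else set0)).
  case: sA => s0 _; apply => k; case: ifP => _ //; exact: sub1.
(* The event [N j w = +oo] is not a cylinder: a set [U] containing [+oo] is reached through its
   complement, which involves finite counts only. *)
have [Uoo|Uoo] := pselect (U +oo%E).
  rewrite (_ : _ @^-1` _ = setT `\`
      \bigcup_k (if `[< ~ U k%:R%:E >] then [set w | N j w = k%:R%:E] else set0)).
    by case: sA => _ + _; apply; exact: (sV (~` U)).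
  apply/seteqP; split=> w /=.
    move=> Uw; split=> // -[k _]; case: ifPn => // /asboolP nU /= Njk.
    by apply: nU; rewrite -Njk.
  move=> [_ nw]; have [->//|[k Njk]] := vN j w; rewrite Njk; apply: contrapT => nU.
  by apply: nw; exists k => //; rewrite ifT//; exact/asboolP.
rewrite (_ : _ @^-1` _ = V); first exact: sV.
apply/seteqP; split=> w /=.
  have [->//|[k Njk]] := vN j w; rewrite Njk => Uk; exists k => //.
  by rewrite ifT//; exact/asboolP.
by move=> [k _]; case: ifPn => // /asboolP + /= ->.
Qed.

End determining_class.

(** * Approximation by the events of a generating algebra *)

Section algebra_approximation.
Context d (T : measurableType d) (R : realType) (P : probability T R).

(** The probability of the symmetric difference, written as a mean so that it compares directly with
    the other means. *)
Definition indic_dist (A B : set T) : R := mean P (fun w => `|\1_A w - \1_B w|).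

Lemma bounded_measurable_indicB (A B : set T) : measurable A -> measurable B ->
  bounded_measurable (fun w => `|\1_A w - \1_B w| : R).
Proof.
move=> mA mB; apply: bounded_measurable_norm.
by apply: bounded_measurableB; exact: bounded_measurable_indic.
Qed.

Lemma indic_distC (A B : set T) : indic_dist (~` A) (~` B) = indic_dist A B.
Proof.
apply: eq_mean => w; rewrite !indicE !in_setC.
by case: (w \in A); case: (w \in B); rewrite /= ?subrr ?subr0 ?sub0r ?normrN.
Qed.

Lemma indic_distU (A B C D : set T) :
  measurable A -> measurable B -> measurable C -> measurable D ->
  indic_dist (A `|` B) (C `|` D) <= indic_dist A C + indic_dist B D.
Proof.
move=> mA mB mC mD; rewrite -meanD; try exact: bounded_measurable_indicB.
apply: le_mean.
- by apply: bounded_measurable_indicB; exact: measurableU.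
- by apply: bounded_measurableD; exact: bounded_measurable_indicB.
move=> w; rewrite !indicE !in_setU.
case: (w \in A); case: (w \in B); case: (w \in C); case: (w \in D);
  rewrite /= ?subrr ?subr0 ?sub0r ?normrN ?normr0 ?normr1 ?addr0 ?add0r ?lerDl
    ?lerDr ?ler01 ?lexx//.
Qed.

Lemma indic_dist_triangle (A B C : set T) :
  measurable A -> measurable B -> measurable C ->
  indic_dist A C <= indic_dist A B + indic_dist B C.
Proof.
move=> mA mB mC; rewrite -meanD; try exact: bounded_measurable_indicB.
apply: le_mean; first exact: bounded_measurable_indicB.
  by apply: bounded_measurableD; exact: bounded_measurable_indicB.
by move=> w; exact: ler_distD.
Qed.

(** The approximable events form a sigma-algebra: by continuity from below a countable union is
    within [e / 2] of a finite one, itself approximable up to [e / 2]. *)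
Lemma algebra_approximation (A : set (set T)) :
  A `<=` measurable -> A set0 -> setC_closed A -> setU_closed A ->
  forall F, <<s A >> F -> measurable F /\
    forall e, 0 < e -> exists2 G, A G & indic_dist F G <= e.
Proof.
move=> mA A0 AC AU.
set H := fun F => measurable F /\
    forall e, 0 < e -> exists2 G, A G & indic_dist F G <= e.
have HU F F' : H F -> H F' -> H (F `|` F').
  move=> [mF hF] [mF' hF']; split=> [|e e0]; first exact: measurableU.
  have e20 : 0 < e / 2 by rewrite divr_gt0.
  have [G AG FG] := hF _ e20; have [G' AG' FG'] := hF' _ e20.
  exists (G `|` G'); first exact: AU.
  rewrite (le_trans (indic_distU _ _ _ _))//; [exact: mA|exact: mA|].
  by rewrite [leRHS]splitr lerD.
have A_H F : A F -> H F.
  move=> AF; split=> [|e e0]; first exact: mA.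
  exists F => //; rewrite /indic_dist (@eq_mean _ _ _ _ _ (cst 0)) ?mean_cst ?ltW// => w.
  by rewrite subrr normr0.
apply: smallest_sub => //; split.
- exact: A_H.
- move=> F [mF hF]; rewrite setTD; split=> [|e e0]; first exact: measurableC.
  have [G AG FG] := hF _ e0; exists (~` G); first exact: AC.
  by rewrite indic_distC.
- move=> F HF; have mF n := (HF n).1.
  pose U n := \big[setU/set0]_(k < n.+1) F k.
  have HUn n : H (U n).
    elim: n => [|n IH]; first by rewrite /U big_ord_recr big_ord0/= set0U.
    by rewrite /U big_ord_recr; exact: HU.
  have mUoo := bigcupT_measurable _ mF.
  split=> // e e0.
  have e20 : 0 < e / 2 by rewrite divr_gt0.
  have UE : \bigcup_n F n = \bigcup_n U n by rewrite bigcup_bigsetU_bigcup.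
  have : fine (P (U n)) @[n --> \oo] --> fine (P (\bigcup_n F n)).
    apply: fine_cvg; rewrite fineK ?fin_num_measure// UE.
    apply: nondecreasing_cvg_mu => [n||]; first exact: (HUn n).1.
      by rewrite -UE.
    by move=> m n mn; apply/subsetPset; apply: subset_bigsetU.
  move/cvgrPdist_le => /(_ _ e20) [n _ /(_ n (leqnn n))/= Pn].
  have [G AG UG] := (HUn n).2 _ e20.
  exists G => //.
  rewrite (le_trans (indic_dist_triangle mUoo (HUn n).1 (mA _ AG)))//.
  rewrite [leRHS]splitr lerD// (le_trans _ Pn)//.
  rewrite -!mean_indic//; last exact: (HUn n).1.
  rewrite -meanB; try exact: bounded_measurable_indic; last first.
    exact/bounded_measurable_indic/(HUn n).1.
  rewrite (le_trans _ (ler_norm _))//.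
  rewrite le_eqVlt; apply/orP; left; apply/eqP/eq_mean => w.
  rewrite ger0_norm// subr_ge0 !indicE; case: (boolP (w \in U n)) => //.
  move/set_mem => Uw; rewrite mem_set// UE; by exists n.
Qed.

End algebra_approximation.

(** * Poisson counts *)

Section poisson_generating_function.
Context dS (S : measurableType dS) dO (Om : measurableType dO) (R : realType).

(** [is_poisson] with [config] and [count] replaced by an arbitrary random measure. *)
Definition poisson_counts (N : Om -> {measure set S -> \bar R})
    (nu : {measure set S -> \bar R}) (P : probability Om R) :=
  [/\ (forall (D : set S) (k : nat), measurable D -> (nu D < +oo)%E ->
         P [set om | N om D = k%:R%:E] =
         (expR (- fine (nu D)) * fine (nu D) ^+ k / k`!%:R)%:E),
      (forall D : set S, measurable D -> nu D = +oo%E ->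
         P [set om | N om D = +oo%E] = 1%E) &
      (forall (n : nat) (D : 'I_n -> set S) (B : 'I_n -> set (\bar R)),
         (forall i, measurable (D i)) -> (forall i, measurable (B i)) ->
         trivIset setT D ->
         P [set om | forall i, B i (N om (D i))] =
         (\prod_(i < n) P [set om | B i (N om (D i))])%E)].

Context (P : probability Om R) (N : Om -> {measure set S -> \bar R})
  (nu : {measure set S -> \bar R}).
Hypothesis mN : forall D, measurable D -> measurable_fun setT (N ^~ D).
Hypothesis vN : forall om D, measurable D -> nat_valued (N om D).
Hypothesis poissonN : poisson_counts N nu P.

Lemma measurable_count_preimage D (Q : set (\bar R)) : measurable D ->
  measurable Q -> measurable [set om | Q (N om D)].
Proof. by move=> mD mQ; rewrite -[X in measurable X]setTI; exact: mN. Qed.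

(** The generating function at [t] of the Poisson law of parameter [x], extended to [x = +oo] by its
    limit, which is 0 for [t < 1] and 1 for [t = 1]. *)
Definition poisson_gf (t : R) (x : \bar R) : R :=
  if t == 1 then 1 else if x is r%:E then expR (- ((1 - t) * r)) else 0.

Lemma bounded_measurable_cpow_count t D : 0 <= t <= 1 -> measurable D ->
  bounded_measurable (fun om => cpow t (N om D)).
Proof. by move=> t01 mD; apply: bounded_measurable_cpow => // [|w]; [exact: mN|exact: vN]. Qed.

Lemma mean_cpow_count t D : 0 <= t <= 1 -> measurable D ->
  mean P (fun om => cpow t (N om D)) = poisson_gf t (nu D).
Proof.
move=> t01 mD; have [PN PNoo _] := poissonN.
rewrite /poisson_gf; have [->|t1] := eqVneq t 1.
  by rewrite -[RHS](mean_cst P); apply: eq_mean => w; rewrite cpow1.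
have {}t01 : 0 <= t < 1 by case/andP: t01 => -> t1'; rewrite lt_neqAle t1.
have t0 : 0 <= t by case/andP: t01.
have t01' : 0 <= t <= 1 by case/andP: t01 => -> /ltW ->.
have bt := bounded_measurable_cpow_count t01' mD.
have [nuD|nuD] := eqVneq (nu D) +oo%E.
  rewrite nuD; pose A := [set om | N om D = +oo%E].
  have mA : measurable A by exact: (@measurable_count_preimage _ [set +oo%E]).
  have PA : P A = 1%E by exact: PNoo.
  apply/eqP; rewrite eq_le; apply/andP; split; last first.
    by apply: mean_ge0 => w; have /andP[] := cpow_itv (N w D) t01'.
  have -> : 0 = mean P (\1_(~` A)) :> R.
    by rewrite mean_indic ?probability_setC ?PA ?subee//; exact: measurableC.
  apply: le_mean => // [|w]; first exact/bounded_measurable_indic/measurableC.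
  have /andP[_ c1] := cpow_itv (N w D) t01'.
  rewrite indicE in_setC; case: (boolP (w \in A)) => //= /set_mem /= ->.
  by rewrite cpow_pinfty.
have nuD' : (nu D < +oo)%E by rewrite ltey.
rewrite -(fineK (_ : nu D \is a fin_num)) ?ge0_fin_numE//.
set x := fine (nu D).
have lim1 := mean_cpow_cvg (P := P) (bounded_measurable_cst Om 1) (mN mD)
  (fun w => vN w mD) t01.
under eq_mean do rewrite -[cpow _ _]mul1r.
suff SE m : \sum_(k < m) t ^+ k * mean P (fun w => 1 * (N w D == k%:R%:E)%:R) =
    expR (- x) * series (exp_coeff (t * x)) m.
  have lim2 : \sum_(k < m) t ^+ k * mean P (fun w => 1 * (N w D == k%:R%:E)%:R)
      @[m --> \oo] --> expR (- ((1 - t) * x)).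
    under eq_fun do rewrite SE.
    rewrite (_ : expR (- _) = expR (- x) * expR (t * x)); last first.
      by rewrite -expRD; congr expR; ring.
    apply: cvgM; first exact: cvg_cst.
    exact: is_cvg_series_exp_coeff.
  exact: norm_cvg_unique lim1 lim2.
rewrite /series/= big_mkord mulr_sumr; apply: eq_bigr => k _.
rewrite (_ : mean _ _ = expR (- x) * x ^+ k / k`!%:R).
  by rewrite /exp_coeff /= exprMn; ring.
rewrite -[RHS]/(fine (_)%:E) -PN// -mean_indic; last first.
  exact: (@measurable_count_preimage _ [set k%:R%:E]).
apply: eq_mean => w; rewrite indicE mul1r; congr (nat_of_bool _)%:R.
by apply/eqP/idP => [?|/set_mem//]; apply/mem_set.
Qed.

(** Mixing powers (indices in [A]) and events (the other indices) lets the powers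
    be introduced one at a time, by induction on [A]. *)
Lemma mean_indep_counts (J : finType) (D : J -> set S) (A : seq J)
    (t : J -> R) (B : J -> set (\bar R)) :
  (forall j, measurable (D j)) -> trivIset setT D ->
  (forall j, 0 <= t j <= 1) -> (forall j, measurable (B j)) ->
  let f (B : J -> set (\bar R)) A j om := if j \in A then cpow (t j) (N om (D j))
    else `[< B j (N om (D j)) >]%:R in
  mean P (fun om => \prod_j f B A j om) = \prod_j mean P (f B A j).
Proof.
move=> mD tD t01 mB f.
have asE (Q : Om -> Prop) : (fun om => `[< Q om >]%:R) = \1_[set om | Q om] :> (Om -> R).
  apply/funext => om; rewrite indicE.
  by case: asboolP => ?; [rewrite mem_set|rewrite memNset].
have bf Q A' j : measurable (Q j) -> bounded_measurable (f Q A' j).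
  move=> mQ; rewrite /f; case: (j \in A'); first exact: bounded_measurable_cpow_count.
  by rewrite asE; exact/bounded_measurable_indic/measurable_count_preimage.
elim: A B mB => [|j0 A IH] B mB.
  have [_ _ indep] := poissonN.
  pose ev : 'I_#|J| -> J := enum_val.
  have := indep #|J| (D \o ev) (B \o ev) (fun i => mD _) (fun i => mB _).
  have : trivIset setT (D \o ev).
    by move=> i i' _ _ ii'; apply: enum_val_inj; exact: tD.
  move=> /[swap] /[apply].
  have -> : [set om | forall i : 'I_#|J|, (B \o ev) i (N om ((D \o ev) i))] =
      [set om | forall j, B j (N om (D j))].
    apply/seteqP; split=> om /= h; last by move=> i; exact: h.
    by move=> j; have := h (enum_rank j); rewrite /ev enum_rankK.
  rewrite (_ : (\prod_(i < _) _)%E = (\prod_j mean P (f B [::] j))%:E).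
    move=> PB.
    rewrite -[RHS]/(fine (_)%:E) -PB -mean_indic; last first.
      rewrite (_ : [set _ | _] = \bigcap_(j in [set: J]) [set om | B j (N om (D j))]).
        apply: fin_bigcap_measurable => // j _; exact: measurable_count_preimage.
      by apply/seteqP; split=> om /= h j; [move=> _; exact: h|exact: h].
    apply: eq_mean => om; rewrite -asE.
    case: asboolP => [h|h]; first by rewrite big1// => j _; rewrite /f/= asboolT.
    have /existsNP[j nj] := h.
    by rewrite (bigD1 j)//= /f/= asboolF// mul0r.
  rewrite -prodEFin (reindex ev)/=; last first.
    by exists enum_rank => x _; [exact: enum_valK|exact: enum_rankK].
  apply: eq_bigr => i _; rewrite /f /= asE mean_indic ?fineK//.
    apply: fin_num_measure; exact: measurable_count_preimage.
  exact: measurable_count_preimage.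
have [j0A|j0A] := boolP (j0 \in A).
  have fE : f B (j0 :: A) = f B A.
    apply/funext => j; apply/funext => om; rewrite /f inE.
    by have [->|] := eqVneq j j0; rewrite ?j0A.
  by rewrite fE; exact: IH.
pose g om := \prod_(j | j != j0) f B A j om.
pose c := \prod_(j | j != j0) mean P (f B A j).
have bg : bounded_measurable g.
  rewrite /g; under eq_fun do rewrite big_mkcond.
  apply: bounded_measurable_prod => j; case: (j != j0); first exact: bf.
  exact: bounded_measurable_cst.
(* By the induction hypothesis with the event at [j0] replaced by [Q], [g - c] is orthogonal to
   every event on the count of [D j0], hence to the powers of this count. This is why [B] varies in
   the induction. *)
have meanQ Q : measurable Q ->
    mean P (fun om => (g om - c) * `[< Q (N om (D j0)) >]%:R) = 0.
  move=> mQ; have bQ : bounded_measurable (fun om => `[< Q (N om (D j0)) >]%:R : R).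
    by rewrite asE; exact/bounded_measurable_indic/measurable_count_preimage.
  pose BQ j := if j == j0 then Q else B j.
  have mBQ j : measurable (BQ j) by rewrite /BQ; case: eqP.
  have f0 : f BQ A j0 = fun om => `[< Q (N om (D j0)) >]%:R.
    by apply/funext => om; rewrite /f (negbTE j0A) /BQ eqxx.
  have fj j : j != j0 -> f BQ A j = f B A j.
    by move=> jj0; apply/funext => om; rewrite /f /BQ (negbTE jj0).
  have := IH _ mBQ; rewrite [RHS](bigD1 j0)//= f0.
  under [in RHS]eq_bigr do rewrite fj//.
  rewrite -/c (_ : (fun om => _) =
      (fun om => `[< Q (N om (D j0)) >]%:R * g om)); last first.
    apply/funext => om; rewrite (bigD1 j0)//= f0; congr (_ * _).
    by apply: eq_bigr => j jj0; rewrite fj.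
  move=> gQ; rewrite (_ : (fun om => _) = (fun om =>
      `[< Q (N om (D j0)) >]%:R * g om - c * `[< Q (N om (D j0)) >]%:R)); last first.
    by apply/funext => om; ring.
  rewrite meanB ?gQ ?meanZl//; first by rewrite mulrC subrr.
  - exact: bounded_measurableM.
  - by apply: bounded_measurableM => //; exact: bounded_measurable_cst.
have bgc : bounded_measurable (fun om => g om - c).
  by apply: bounded_measurableB => //; exact: bounded_measurable_cst.
have fj j : j != j0 -> f B (j0 :: A) j = f B A j.
  by move=> jj0; apply/funext => om; rewrite /f inE (negbTE jj0).
have f0 : f B (j0 :: A) j0 = fun om => cpow (t j0) (N om (D j0)).
  by apply/funext => om; rewrite /f inE eqxx.
rewrite [RHS](bigD1 j0)//= f0; under [in RHS]eq_bigr do rewrite fj//.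
rewrite -/c (_ : (fun om => _) =
    (fun om => (g om - c) * cpow (t j0) (N om (D j0)) +
      c * cpow (t j0) (N om (D j0)))); last first.
  apply/funext => om; rewrite (bigD1 j0)//= f0 -mulrDl subrK mulrC; congr (_ * _).
  by apply: eq_bigr => j jj0; rewrite fj.
have bt := bounded_measurable_cpow_count (t01 j0) (mD j0).
rewrite meanD ?meanZl//; [|exact: bounded_measurableM|]; last first.
  by apply: bounded_measurableM => //; exact: bounded_measurable_cst.
rewrite (_ : mean P (fun om => (g om - c) * _) = 0) ?add0r 1?mulrC//.
have [t1|t1] := eqVneq (t j0) 1.
  rewrite -[RHS](meanQ setT)//; apply: eq_mean => om.
  by rewrite t1 cpow1 asboolT.
have {}t01 : 0 <= t j0 < 1.
  by have /andP[-> t1'] := t01 j0; rewrite lt_neqAle t1.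
have m0 (k : nat) :
    mean P (fun om => (g om - c) * (N om (D j0) == k%:R%:E)%:R) = 0.
  rewrite -[RHS](meanQ [set k%:R%:E])//; apply: eq_mean => om.
  by congr (_ * (nat_of_bool _)%:R); apply/eqP/asboolP.
apply: norm_cvg_unique (mean_cpow_cvg (P := P) bgc (mN (mD j0))
  (fun w => vN w (mD j0)) t01) _.
rewrite /= (_ : (fun m => _) = cst 0); first exact: cvg_cst.
by apply/funext => m; apply: big1 => k _; rewrite m0 mulr0.
Qed.

(** A finite partition is encoded as a labelling by a finite type: disjointness and covering are
    automatic, and pairing two labellings gives the common refinement. *)
Definition cell (J : eqType) (r : S -> J) (j : J) : set S := r @^-1` [set j].

Lemma trivIset_cell (J : eqType) (r : S -> J) : trivIset setT (cell r).
Proof. by move=> i j _ _ [x [/= <- <-]]. Qed.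

Lemma mean_prod_cpow (J : finType) (r : S -> J) (t : J -> R) :
  (forall j, measurable (cell r j)) -> (forall j, 0 <= t j <= 1) ->
  mean P (fun om => \prod_j cpow (t j) (N om (cell r j))) =
  \prod_j poisson_gf (t j) (nu (cell r j)).
Proof.
move=> mr t01.
have /= := mean_indep_counts (enum J) mr (trivIset_cell (r := r)) t01
  (fun=> measurableT).
under eq_mean do under eq_bigr do rewrite mem_enum.
move=> ->; apply: eq_bigr => j _; rewrite -mean_cpow_count//.
by apply: eq_mean => om; rewrite mem_enum.
Qed.

End poisson_generating_function.

(** * Products of powers of counts over finite partitions *)

Section multiplicative_functionals.
Context dS (S : measurableType dS) dO (Om : measurableType dO) (R : realType).
Context (P : probability Om R) (N : Om -> {measure set S -> \bar R})
  (nu : {measure set S -> \bar R}).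
Hypothesis mN : forall D, measurable D -> measurable_fun setT (N ^~ D).
Hypothesis vN : forall om D, measurable D -> nat_valued (N om D).
Hypothesis poissonN : poisson_counts N nu P.

Definition count_product (J : finType) (r : S -> J) (t : J -> R) (om : Om) : R :=
  \prod_j cpow (t j) (N om (cell r j)).

Definition pair_fun (I J : eqType) (p : S -> I) (r : S -> J) : S -> (I * J)%type :=
  fun x => (p x, r x).

Lemma cell_pair (I J : eqType) (p : S -> I) (r : S -> J) i j :
  cell (pair_fun p r) (i, j) = cell p i `&` cell r j.
Proof. by apply/seteqP; split=> x; rewrite /cell /pair_fun /= => -[-> ->]. Qed.

Lemma measurable_cell_pair (I J : eqType) (p : S -> I) (r : S -> J) :
  (forall i, measurable (cell p i)) -> (forall j, measurable (cell r j)) ->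
  forall ij, measurable (cell (pair_fun p r) ij).
Proof. by move=> mp mr [i j]; rewrite cell_pair; exact: measurableI. Qed.

Lemma measure_cells (mu : {measure set S -> \bar R}) (I : finType) (p : S -> I) D :
  (forall i, measurable (cell p i)) -> measurable D ->
  mu D = (\sum_i mu (cell p i `&` D))%E.
Proof.
move=> mp mD; rewrite fsbig_seq ?index_enum_uniq//=.
rewrite -(@measure_fin_bigcup _ _ _ mu _ _ (fun i => cell p i `&` D))//.
- congr (mu _); apply/seteqP; split=> [x Dx|x [i _ []]//].
  by exists (p x) => //=; exact: mem_index_enum.
- by move=> i j _ _ [x [[<- _] [<- _]]].
- by move=> i _; exact: measurableI.
Qed.

Lemma nat_valued_sum (I : Type) (r : seq I) (x : I -> \bar R) :
  (forall i, nat_valued (x i)) -> nat_valued (\sum_(i <- r) x i)%E.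
Proof.
move=> vx; elim: r => [|i r IH]; first by rewrite big_nil; right; exists 0%N.
rewrite big_cons; case: (vx i) => [->|[k ->]]; case: IH => [->|[l ->]]; try by left.
by right; exists (k + l)%N; rewrite natrD.
Qed.

Lemma cpow_sum (I : Type) (r : seq I) (x : I -> \bar R) t :
  (forall i, nat_valued (x i)) ->
  cpow t (\sum_(i <- r) x i)%E = \prod_(i <- r) cpow t (x i).
Proof.
move=> vx; elim: r => [|i r IH].
  by rewrite !big_nil -[0%E]/(0%:R%:E) cpow_nat.
by rewrite !big_cons cpowD ?IH//; exact: nat_valued_sum.
Qed.

(** By additivity of the counts, both factors are products of powers over the common refinement,
    where [cpowM] multiplies the bases. *)
Lemma count_productM (I J : finType) (p : S -> I) (r : S -> J)
    (s : I -> R) (t : J -> R) om :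
  (forall i, measurable (cell p i)) -> (forall j, measurable (cell r j)) ->
  (forall i, 0 <= s i <= 1) -> (forall j, 0 <= t j <= 1) ->
  count_product p s om * count_product r t om =
  count_product (pair_fun p r) (fun ij => s ij.1 * t ij.2) om.
Proof.
move=> mp mr s01 t01.
have mpr i j : measurable (cell p i `&` cell r j) by exact: measurableI.
rewrite /count_product.
under eq_bigr => i _.
  rewrite (measure_cells (N om) mr (mp i)) cpow_sum; last first.
    by move=> j; apply: vN; rewrite setIC.
  over.
under [in X in _ * X]eq_bigr => j _.
  rewrite (measure_cells (N om) mp (mr j)) cpow_sum; last by move=> i; exact: vN.
  over.
rewrite [in X in _ * X]exchange_big/= -big_split/=.
rewrite [RHS](eq_bigr (fun ij => cpow (s ij.1 * t ij.2)
    (N om (cell p ij.1 `&` cell r ij.2)))) => [|[i j] _]; last by rewrite cell_pair.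
rewrite -(pair_bigA _ (fun i j => cpow (s i * t j) (N om (cell p i `&` cell r j)))).
apply: eq_bigr => i _; rewrite -big_split/=; apply: eq_bigr => j _.
by rewrite setIC cpowM//; apply: vN; exact: mpr.
Qed.

Lemma bounded_measurable_count_product (J : finType) (r : S -> J) (t : J -> R) :
  (forall j, measurable (cell r j)) -> (forall j, 0 <= t j <= 1) ->
  bounded_measurable (count_product r t).
Proof.
move=> mr t01; apply: bounded_measurable_prod => j.
exact: bounded_measurable_cpow_count.
Qed.

Lemma mean_count_product (J : finType) (r : S -> J) (t : J -> R) :
  (forall j, measurable (cell r j)) -> (forall j, 0 <= t j <= 1) ->
  mean P (count_product r t) = \prod_j poisson_gf (t j) (nu (cell r j)).
Proof. by move=> mr t01; exact: mean_prod_cpow. Qed.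

End multiplicative_functionals.

(** * Decorrelation *)

Section decorrelation.
Context dS (S : measurableType dS) dO (Om : measurableType dO) (R : realType).
Context (P : probability Om R) (N : Om -> {measure set S -> \bar R})
  (nu : {measure set S -> \bar R}).
Hypothesis mN : forall D, measurable D -> measurable_fun setT (N ^~ D).
Hypothesis vN : forall om D, measurable D -> nat_valued (N om D).
Hypothesis poissonN : poisson_counts N nu P.

Context (I J : finType) (p : S -> I) (r : S -> J) (s : I -> R) (W : set S)
  (h : J -> R).
Hypothesis mp : forall i, measurable (cell p i).
Hypothesis mr : forall j, measurable (cell r j).
Hypothesis mW : measurable W.
Hypothesis nuW : (nu W < +oo)%E.
Hypothesis s01 : forall i, 0 <= s i <= 1.
Hypothesis sW : forall i, s i != 1 -> cell p i `<=` W.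
Hypothesis h0 : forall j, 0 <= h j.
Hypothesis nuh : forall j, (nu (W `&` cell r j) <= (h j)%:E * nu (cell r j))%E.
Hypothesis hfin : forall j, nu (cell r j) = +oo%E -> h j = 0.

(** Read [s] as a function of the point through [p]: [e j] is the integral of [1 - s] over the cell
    [j] of [r], and [m j] the average of [s] there. As [fine +oo = 0], a cell of infinite intensity
    gets [l j = 0] and [m j = 1]. This is the right value, since [hfin] and [nuh] make [W] null on
    such a cell. *)
Let l j := fine (nu (cell r j)).
Let w j := fine (nu (W `&` cell r j)).
Let c i j := fine (nu (cell p i `&` cell r j)).
Let e j := \sum_i (1 - s i) * c i j.
Let m j := 1 - e j / l j.

Let fin_measure (A : set S) : measurable A -> (nu A < +oo)%E -> nu A = (fine (nu A))%:E.
Proof. by move=> mA fA; rewrite fineK// ge0_fin_numE. Qed.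

Let wE j : nu (W `&` cell r j) = (w j)%:E.
Proof.
apply: fin_measure; first exact: measurableI.
by rewrite (le_lt_trans _ nuW)// le_measure// ?inE//; exact: measurableI.
Qed.

Let cE i j : s i != 1 -> nu (cell p i `&` cell r j) = (c i j)%:E.
Proof.
move=> si; apply: fin_measure; first exact: measurableI.
rewrite (le_lt_trans _ nuW)// le_measure// ?inE//; first exact: measurableI.
by apply: subset_trans (sW si); exact: subIsetl.
Qed.

Let w_le j : w j <= h j * l j.
Proof.
have := nuh j; rewrite wE; have [lj|lj] := eqVneq (nu (cell r j)) +oo%E.
  by rewrite hfin// mul0r mul0e lee_fin.
by rewrite (fin_measure (mr j)) ?ltey// -EFinM lee_fin.
Qed.

Let e_ge0 j : 0 <= e j.
Proof.
apply: sumr_ge0 => i _; rewrite mulr_ge0 ?fine_ge0// subr_ge0.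
by have /andP[] := s01 i.
Qed.

Let e_le_w j : e j <= w j.
Proof.
rewrite -lee_fin -wE (measure_cells nu mp (measurableI _ _ mW (mr j))) -sumEFin.
apply: lee_sum => i _; have [si|si] := eqVneq (s i) 1.
  by rewrite si subrr mul0r.
rewrite setIA (setIidl (sW si)) cE// lee_fin ler_piMl ?fine_ge0//.
by rewrite gerBl; have /andP[] := s01 i.
Qed.

Let eE j : e j = (1 - m j) * l j.
Proof.
rewrite /m opprB addrCA subrr addr0; have [lj|lj] := eqVneq (l j) 0.
  rewrite lj mulr0; apply/le_anti; rewrite e_ge0 andbT.
  by rewrite (le_trans (e_le_w j))// (le_trans (w_le j))// lj mulr0.
by rewrite divfK.
Qed.

Let l_ge0 j : 0 <= l j. Proof. exact: fine_ge0. Qed.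

Let e_div_ge0 j : 0 <= e j / l j.
Proof. exact: divr_ge0. Qed.

Let e_le_l j : e j <= l j.
Proof.
have [lj|lj] := eqVneq (nu (cell r j)) +oo%E.
  rewrite (le_trans (e_le_w j))// (le_trans (w_le j))// hfin// mul0r//.
rewrite (le_trans (e_le_w j))// -lee_fin -wE -fin_measure ?ltey//.
by rewrite le_measure// ?inE//; exact: measurableI.
Qed.

Let e_div_le1 j : e j / l j <= 1.
Proof.
have [lj|lj] := eqVneq (l j) 0; first by rewrite lj invr0 mulr0.
by rewrite ler_pdivrMr ?mul1r ?e_le_l// lt_neqAle eq_sym lj l_ge0.
Qed.

Let m01 j : 0 <= m j <= 1.
Proof. by rewrite /m subr_ge0 e_div_le1 gerBl e_div_ge0. Qed.

Let m_infinite j : nu (cell r j) = +oo%E -> m j = 1.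
Proof. by move=> lj; rewrite /m /l lj invr0 mulr0 subr0. Qed.

Let poisson_gf_fin t (x : \bar R) : x \is a fin_num ->
  poisson_gf t x = expR (- ((1 - t) * fine x)).
Proof.
case: x => // x _; rewrite /poisson_gf; case: eqP => [->|//].
by rewrite subrr mul0r oppr0 expR0.
Qed.

(** [M] is the conditional expectation of [phi] given the counts of the cells of [r]. *)
Let M := count_product N r m.
Let phi := count_product N p s.

(** On a cell of finite intensity, [m] is made so that [\sum_i (1 - s i * t) * c i j = (1 - m j * t)
    * l j] for all [t]. On a cell of infinite intensity, both sides are 0 for [t < 1] because some
    piece has infinite intensity, and 1 for [t = 1] because the pieces with [s i != 1] are null. *)
Let poisson_gf_cell j t : 0 <= t <= 1 ->
  \prod_i poisson_gf (s i * t) (nu (cell p i `&` cell r j)) =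
  poisson_gf (m j * t) (nu (cell r j)).
Proof.
move=> /andP[t0 t1]; have [lj|lj] := eqVneq (nu (cell r j)) +oo%E; last first.
  have lfin : nu (cell r j) \is a fin_num by rewrite ge0_fin_numE ?ltey.
  have cfin i : nu (cell p i `&` cell r j) \is a fin_num.
    rewrite ge0_fin_numE// (le_lt_trans (_ : _ <= nu (cell r j))%E) ?ltey//.
    by rewrite le_measure// ?inE//; exact: measurableI.
  rewrite poisson_gf_fin//; under eq_bigr do rewrite poisson_gf_fin//.
  rewrite -expR_sum; congr expR.
  have lE : l j = \sum_i c i j.
    apply: EFin_inj; rewrite -fin_measure ?ltey// (measure_cells nu mp (mr j)).
    by rewrite -sumEFin; apply: eq_bigr => i _; rewrite fineK.
  have : t * e j = t * ((1 - m j) * l j) by rewrite eE.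
  rewrite -/(l j) {1}/e mulr_sumr => H.
  transitivity (- (l j * (1 - t)) - \sum_i t * ((1 - s i) * c i j)).
    rewrite lE mulr_suml -!sumrN -big_split/=; apply: eq_bigr => i _.
    by rewrite -/(c i j); ring.
  by rewrite H; ring.
have w0 : w j = 0.
  apply/le_anti; rewrite (le_trans (w_le j)) ?hfin ?mul0r//=.
  exact: fine_ge0.
have c0 i : s i != 1 -> nu (cell p i `&` cell r j) = 0%E.
  move=> si; apply/eqP; rewrite eq_le measure_ge0 andbT -[leRHS]/(0%:E) -w0 -wE.
  rewrite le_measure// ?inE; [exact: measurableI|exact: measurableI|].
  by apply: setSI; exact: sW.
rewrite m_infinite// mul1r; have [->|tn1] := eqVneq t 1.
  rewrite {2}/poisson_gf eqxx big1// => i _; rewrite mulr1.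
  have [->|si] := eqVneq (s i) 1; first by rewrite /poisson_gf eqxx.
  by rewrite c0// poisson_gf_fin//= mulr0 oppr0 expR0.
rewrite {2}/poisson_gf (negbTE tn1) lj.
have [i ci] : exists i, nu (cell p i `&` cell r j) = +oo%E.
  apply/not_existsP => nc; move: lj.
  rewrite (measure_cells nu mp (mr j)) => /eqP; rewrite esum_eqy => [|i _].
    by move=> /existsP[i /andP[_ /eqP]]; exact: nc.
  by rewrite gt_eqF// (lt_le_trans _ (measure_ge0 _ _)).
rewrite (bigD1 i)//= {1}/poisson_gf ci.
have /andP[si0 si1] := s01 i.
rewrite lt_eqF ?mul0r//.
have t_lt1 : t < 1 by rewrite lt_neqAle tn1.
by rewrite (le_lt_trans _ t_lt1)// ler_piMl.
Qed.

Let st01 (t : J -> R) : (forall j, 0 <= t j <= 1) ->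
  forall ij : I * J, 0 <= s ij.1 * t ij.2 <= 1.
Proof.
move=> t01 [i j] /=; have /andP[? ?] := s01 i; have /andP[? ?] := t01 j.
by rewrite mulr_ge0// mulr_ile1.
Qed.

Let mt01 (t : J -> R) : (forall j, 0 <= t j <= 1) ->
  forall j, 0 <= m j * t j <= 1.
Proof.
move=> t01 j; have /andP[? ?] := m01 j; have /andP[? ?] := t01 j.
by rewrite mulr_ge0// mulr_ile1.
Qed.

Let M_mul (t : J -> R) om : (forall j, 0 <= t j <= 1) ->
  M om * count_product N r t om = count_product N r (fun j => m j * t j) om.
Proof.
move=> t01; rewrite /M /count_product -big_split/=; apply: eq_bigr => j _.
by rewrite cpowM//; exact: vN.
Qed.

Let mean_phi_M (t : J -> R) : (forall j, 0 <= t j <= 1) ->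
  mean P (fun om => phi om * count_product N r t om) =
  mean P (fun om => M om * count_product N r t om).
Proof.
move=> t01; under [RHS]eq_mean do rewrite M_mul//.
rewrite [RHS](mean_count_product mN vN poissonN mr (mt01 t01)).
under eq_mean do rewrite /phi (count_productM vN)//.
rewrite (mean_count_product mN vN poissonN (measurable_cell_pair mp mr) (st01 t01)).
rewrite (eq_bigr (fun ij => poisson_gf (s ij.1 * t ij.2)
    (nu (cell p ij.1 `&` cell r ij.2)))) => [|[i j] _]; last by rewrite cell_pair.
rewrite -(pair_bigA _ (fun i j => poisson_gf (s i * t j) (nu (cell p i `&` cell r j)))).
by rewrite exchange_big/=; apply: eq_bigr => j _; rewrite poisson_gf_cell.
Qed.

Let bM : bounded_measurable M.
Proof. exact: bounded_measurable_count_product. Qed.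

Let bphi : bounded_measurable phi.
Proof. exact: bounded_measurable_count_product. Qed.

(** Multiplying a product of powers of the counts of [r] by one more power only changes one base, so
    [determining_class] extends [mean_phi_M] from these products to events. *)
Let mean_phi_M_indic F : generated_algebra (fun j om => N om (cell r j)) F ->
  measurable F /\ mean P (fun om => (phi om - M om) * \1_F om) = 0.
Proof.
pose G := [set g | exists2 t, (forall j, 0 <= t j <= 1) & g = count_product N r t].
apply: (determining_class (P := P) (N := fun j om => N om (cell r j)) (M := G)).
- exact: bounded_measurableB.
- by move=> j; exact: mN.
- by move=> j om; exact: vN.
- exists (fun=> 1) => [_|]; first by rewrite ler01 lexx.
  by apply/funext => om; rewrite /count_product big1// => j _; rewrite cpow1.
- by move=> _ [t t01 ->]; exact: bounded_measurable_count_product.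
- move=> j t _ t01 [u u01 ->]; have {}t01 : 0 <= t <= 1 by case/andP: t01 => -> /ltW ->.
  exists (fun k => if k == j then t * u k else u k) => [k|].
    case: eqP => // _; have /andP[? ?] := u01 k; case/andP: t01 => ? ?.
    by rewrite mulr_ge0// mulr_ile1.
  apply/funext => om; rewrite /count_product [in LHS](bigD1 j)//= [RHS](bigD1 j)//= eqxx.
  rewrite cpowM//; last exact: vN.
  by rewrite mulrA; congr (_ * _); apply: eq_bigr => k /negbTE ->.
- move=> _ [t t01 ->]; have := mean_phi_M t01 => /eqP; rewrite -subr_eq0 => /eqP <-.
  have bt := bounded_measurable_count_product mN vN mr t01.
  rewrite -meanB; try exact: bounded_measurableM.
  by apply: eq_mean => om; rewrite mulrBl.
Qed.

Let mean_M_phi : mean P M = mean P phi.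
Proof.
have t01 (j : J) : 0 <= (1 : R) <= 1 by rewrite ler01 lexx.
have := mean_phi_M t01; rewrite /count_product.
have -> : (fun om => phi om * \prod_(j : J) cpow 1 (N om (cell r j))) = phi.
  by apply/funext => om; rewrite big1 ?mulr1// => j _; rewrite cpow1.
move=> ->; apply: eq_mean => om.
by rewrite big1 ?mulr1// => j _; rewrite cpow1.
Qed.

Let gf_exp j t : (m j = 1 -> t = 1) ->
  poisson_gf t (nu (cell r j)) = expR (- ((1 - t) * l j)).
Proof.
move=> mt; have [lj|lj] := eqVneq (nu (cell r j)) +oo%E.
  by rewrite mt ?m_infinite// /poisson_gf eqxx subrr mul0r oppr0 expR0.
by rewrite poisson_gf_fin// ge0_fin_numE// ltey.
Qed.

Let variance_M :
  mean P (fun om => (M om - mean P M) * (M om - mean P M)) <= \sum_j h j * w j.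
Proof.
set mu := mean P M.
have bMM : bounded_measurable (fun om => M om * M om) by exact: bounded_measurableM.
have bmu : bounded_measurable (fun om : Om => 2 * mu * M om).
  by apply: bounded_measurableM => //; exact: bounded_measurable_cst.
rewrite (_ : (fun om => _) = (fun om => M om * M om - 2 * mu * M om + mu * mu));
  last by apply/funext => om; ring.
rewrite meanD; [|exact: bounded_measurableB|exact: bounded_measurable_cst].
rewrite meanB// meanZl// -/mu mean_cst.
have -> : mean P (fun om => M om * M om) = expR (- \sum_j (1 - m j * m j) * l j).
  under eq_mean do rewrite {2}/M M_mul//.
  rewrite (mean_count_product mN vN poissonN mr (mt01 m01)) -sumrN expR_sum.
  by apply: eq_bigr => j _; rewrite gf_exp// => ->; rewrite mulr1.
have -> : mu = expR (- \sum_j e j).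
  rewrite /mu (mean_count_product mN vN poissonN mr m01) -sumrN expR_sum.
  by apply: eq_bigr => j _; rewrite gf_exp// eE.
(* As (1 - m^2) l = 2 e - (1 - m) e, the second moment is [expR (- (2 * a - b))], while the squared
   mean is [expR (- (2 * a))]. The variance is then [expR (- (2 * a - b)) * (1 - expR (- b))], at
   most [b]. *)
pose a : R := \sum_j e j; pose b : R := \sum_j (1 - m j) * e j.
rewrite -/a.
have -> : \sum_j (1 - m j * m j) * l j = 2 * a - b.
  rewrite /a /b mulr_sumr -sumrB; apply: eq_bigr => j _.
  by rewrite eE; ring.
have b0 : 0 <= b.
  by apply: sumr_ge0 => j _; rewrite mulr_ge0// subr_ge0; have /andP[] := m01 j.
have ba : b <= a.
  apply: ler_sum => j _; rewrite ler_piMl// gerBl; by have /andP[] := m01 j.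
have -> : expR (- (2 * a - b)) - 2 * expR (- a) * expR (- a) + expR (- a) * expR (- a) =
    expR (- (2 * a - b)) * (1 - expR (- b)).
  have E : expR (- (2 * a - b)) * expR (- b) = expR (- a) * expR (- a).
    by rewrite -!expRD; congr expR; ring.
  by rewrite mulrBr mulr1 E; ring.
apply: (@le_trans _ _ b).
  apply: (@le_trans _ _ (1 - expR (- b))).
    apply: ler_piMl; first by rewrite subr_ge0 -expR0 ler_expR oppr_le0.
    rewrite -[leRHS]expR0 ler_expR oppr_le0 subr_ge0 (le_trans ba)// ler_peMl ?ler1n//.
    exact: le_trans b0 ba.
  by have := expR_ge1Dx (- b); lra.
(* Here [e j <= w j], and [e j / l j <= w j / l j <= h j] when [l j] is non-zero. *)
apply: ler_sum => j _; have -> : 1 - m j = e j / l j by rewrite /m opprB addrCA subrr addr0.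
apply: ler_pM => //; have [lj|lj] := eqVneq (l j) 0; first by rewrite lj invr0 mulr0.
rewrite ler_pdivrMr; last by rewrite lt_neqAle eq_sym lj l_ge0.
exact: le_trans (e_le_w j) (w_le j).
Qed.

(** [M] and the product of powers have the same covariance with the indicator of [F], and this
    covariance is at most the mean of [|M - mean P M|]. The parameter [d] is that of
    [mean_norm_sqr_le]. *)
Lemma cell_counts_decorrelation F d :
  generated_algebra (fun j om => N om (cell r j)) F -> 0 < d ->
  `|mean P (fun om => \1_F om * count_product N p s om) -
    mean P \1_F * mean P (count_product N p s)| <=
  d / 2 + (\sum_j h j * fine (nu (W `&` cell r j))) / (2 * d).
Proof.
move=> sF d0; have [mF F0] := mean_phi_M_indic sF.
have bF := bounded_measurable_indic R mF.
have bMF : bounded_measurable (fun om => (M om - mean P M) * \1_F om).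
  apply: bounded_measurableM => //; apply: bounded_measurableB => //.
  exact: bounded_measurable_cst.
have bc : bounded_measurable (fun om => M om - mean P M).
  apply: bounded_measurableB => //; exact: bounded_measurable_cst.
have -> : mean P (fun om => \1_F om * count_product N p s om) -
    mean P \1_F * mean P (count_product N p s) =
    mean P (fun om => (M om - mean P M) * \1_F om).
  rewrite -/phi -mean_M_phi mulrC -meanZl// -[RHS]addr0 -F0 -meanD//; last first.
    by apply: bounded_measurableM => //; exact: bounded_measurableB.
  rewrite -meanB; [|exact: bounded_measurableM|]; last first.
    by apply: bounded_measurableM => //; exact: bounded_measurable_cst.
  by apply: eq_mean => om; ring.
apply: le_trans (_ : mean P (fun om => `|M om - mean P M|) <= _).
  apply: norm_mean_le => //; first exact: bounded_measurable_norm.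
  move=> om; rewrite normrM ler_piMr// indicE.
  by case: (_ \in _); rewrite ?normr1 ?normr0.
apply: le_trans (mean_norm_sqr_le P bc d0) _.
rewrite lerD2l ler_pM2r ?invr_gt0 ?mulr_gt0//; exact: variance_M.
Qed.

End decorrelation.

(** * A zero-one law for Poisson processes *)

Section generated_algebra.
Context (R : realType) d (T : measurableType d).

Lemma generated_algebra_sub (J : Type) (N : J -> T -> \bar R) (A : set (set T)) :
  sigma_algebra setT A ->
  (forall j (U : set (\bar R)), measurable U -> A (N j @^-1` U)) ->
  generated_algebra N `<=` A.
Proof. by move=> sA NA; apply: smallest_sub => // _ [j [U mU ->]]; exact: NA. Qed.

Lemma sigma_algebra_generated (J : Type) (N : J -> T -> \bar R) :
  sigma_algebra setT (generated_algebra N).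
Proof. exact: smallest_sigma_algebra. Qed.

(** The same space with the smaller sigma-algebra, so that results on measurable functions can be
    used to prove membership in [generated_algebra]. *)
Definition generated_type (J : Type) (N : J -> T -> \bar R) :=
  g_sigma_algebraType (generated_algebra N).

Lemma measurable_generated_type (J : Type) (N : J -> T -> \bar R) A :
  @measurable _ (generated_type N) A = generated_algebra N A.
Proof.
rewrite propeqE; split=> [|mA]; last exact: sub_sigma_algebra.
by apply: smallest_sub => //; exact: (sigma_algebra_generated N).
Qed.

Lemma measurable_fun_generated (J : Type) (N : J -> T -> \bar R) j :
  measurable_fun setT (N j : generated_type N -> \bar R).
Proof.
move=> _ U mU; rewrite setTI measurable_generated_type.
by apply: sub_sigma_algebra; exists j, U.
Qed.

Lemma generated_algebra_subP (J J' : Type) (N : J -> T -> \bar R)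
    (N' : J' -> T -> \bar R) :
  (forall j, measurable_fun setT (N j : generated_type N' -> \bar R)) ->
  generated_algebra N `<=` generated_algebra N'.
Proof.
move=> mN; apply: generated_algebra_sub; first exact: sigma_algebra_generated.
move=> j U mU; rewrite -measurable_generated_type -[X in measurable X]setTI.
exact: mN.
Qed.

End generated_algebra.

Section poisson_zero_one.
Context dS (S : measurableType dS) dO (Om : measurableType dO) (R : realType).
Context (P : probability Om R) (N : Om -> {measure set S -> \bar R})
  (nu : {measure set S -> \bar R}).
Hypothesis mN : forall D, measurable D -> measurable_fun setT (N ^~ D).
Hypothesis vN : forall om D, measurable D -> nat_valued (N om D).
Hypothesis poissonN : poisson_counts N nu P.

Definition cell_algebra (J : eqType) (r : S -> J) : set (set Om) :=
  generated_algebra (fun j om => N om (cell r j)).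

Definition count_algebra (T : set (set S)) : set (set Om) :=
  generated_algebra (fun (B : {B | T B}) om => N om (sval B)).

Lemma cell_refineE (J J' : finType) (r : S -> J) (r' : S -> J') (f : J' -> J) j om :
  (forall x, f (r' x) = r x) -> (forall j, measurable (cell r' j)) ->
  N om (cell r j) = (\sum_(j' | f j' == j) N om (cell r' j'))%E.
Proof.
move=> fr mr'.
have cellE : cell r j = \bigcup_(j' in [set j' | f j' = j]) cell r' j'.
  apply/seteqP; split=> [x /= xj|x [j' /= fj' xj']].
    by exists (r' x) => //=; rewrite fr.
  by rewrite /cell /= -fr xj'.
have mc : measurable (cell r j).
  by rewrite cellE; apply: fin_bigcup_measurable => // ? _; exact: mr'.
rewrite (measure_cells (N om) mr' mc) [RHS]big_mkcond/=.
apply: eq_bigr => j' _; have [fj'|fj'] := eqVneq (f j') j.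
  congr (N om _); apply/setIidl => x /= xj'.
  by rewrite /cell /= -fr xj'.
rewrite (_ : _ `&` _ = set0) ?measure0//; apply/seteqP; split=> // x [xj' xj].
by move/eqP: fj'; apply; rewrite -xj' fr.
Qed.

Lemma cell_algebra_refine (J J' : finType) (r : S -> J) (r' : S -> J')
    (f : J' -> J) :
  (forall x, f (r' x) = r x) -> (forall j, measurable (cell r' j)) ->
  cell_algebra r `<=` cell_algebra r'.
Proof.
move=> fr mr'; apply: generated_algebra_subP => j.
have -> : (fun om => N om (cell r j)) = (fun om =>
    \sum_j' if f j' == j then N om (cell r' j') else 0)%E.
  by apply/funext => om; rewrite (cell_refineE _ _ fr mr') big_mkcond.
apply: (@emeasurable_sum _ (generated_type (fun j om => N om (cell r' j))) R _ _
    _ (fun j' om => if f j' == j then N om (cell r' j') else 0)%E) => j'.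
case: (f j' == j); last exact: measurable_cst.
exact: (measurable_fun_generated (N := fun j om => N om (cell r' j)) j').
Qed.

(** The events that depend on the counts of some finite partition with cells in [T] form an algebra,
    two partitions having a common refinement, and this algebra generates [count_algebra T]. *)
Lemma count_algebra_approximation (T : set (set S)) :
  sigma_algebra setT T -> T `<=` measurable ->
  forall E, count_algebra T E -> forall d, 0 < d ->
  exists (J : finType) (r : S -> J) F,
    [/\ forall j, T (cell r j), cell_algebra r F & indic_dist P E F <= d].
Proof.
move=> sT mT E TE d d0.
have [T0 TC TU] := sT.
have TI B C : T B -> T C -> T (B `&` C).
  move=> TB TC'; rewrite -[B `&` C]setCK setCI -setTD -(setTD B) -(setTD C).
  apply: (TC); rewrite -bigcup2E; apply: TU => -[|[|n]] //=; exact: TC.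
pose A := [set F | exists (J : finType) (r : S -> J),
  (forall j, T (cell r j)) /\ cell_algebra r F].
have Tpair (J J' : finType) (r : S -> J) (r' : S -> J') :
    (forall j, T (cell r j)) -> (forall j, T (cell r' j)) ->
    forall j, T (cell (pair_fun r r') j).
  by move=> Tr Tr' [j j']; rewrite cell_pair; exact: TI.
have AE : exists2 F, A F & indic_dist P E F <= d.
  apply: (algebra_approximation P (A := A) _ _ _ _ _).2 => //.
  - move=> F [J [r [Tr]]]; move: F; apply: generated_algebra_sub.
      exact: sigma_algebra_measurable.
    by move=> j U mU; rewrite -[X in measurable X]setTI; apply: mN => //; exact: mT.
  - exists unit, (fun=> tt); split; last exact: sigma_algebra0.
    move=> [] ; rewrite (_ : cell _ _ = setT `\` set0); first exact: TC.
    by rewrite setD0; apply/seteqP; split.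
  - move=> F [J [r [Tr rF]]]; exists J, r; split=> //.
    exact: sigma_algebraC.
  - move=> F F' [J [r [Tr rF]]] [J' [r' [Tr' rF']]].
    exists (J * J')%type, (pair_fun r r'); split; first exact: Tpair.
    have mrr j : measurable (cell (pair_fun r r') j) by apply: mT; exact: Tpair.
    have F1 : cell_algebra (pair_fun r r') F.
      exact: (cell_algebra_refine (r := r) (f := fst)).
    have F2 : cell_algebra (pair_fun r r') F'.
      exact: (cell_algebra_refine (r := r') (f := snd)).
    rewrite -bigcup2E; apply: sigma_algebra_bigcup => -[|[|n]] //=.
    exact: sigma_algebra0.
  - move: E TE; apply: generated_algebra_sub; first exact: smallest_sigma_algebra.
    move=> [B TB] U mU /=; apply: sub_sigma_algebra.
    exists bool, (fun x => `[< B x >]); split.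
      case; first by rewrite (_ : cell _ _ = B)//; apply/seteqP; split=> x /asboolP.
      rewrite (_ : cell _ _ = setT `\` B); first exact: TC.
      by apply/seteqP; split=> [x /negbT/asboolPn|x [_ /asboolPn/negbTE]].
    apply: sub_sigma_algebra; exists true, U => //.
    rewrite (_ : cell _ _ = B)//; apply/seteqP; split=> x /asboolP//.
by have [F [J [r [Tr rF]]] EF] := AE; exists J, r, F.
Qed.

(** Think of [e] as the exit point and of [h] as the hitting probability. The partition [r]
    approximating the event depends on the precision, but [h] depends on [e] alone: summing over the
    cells of [r] gives back the sum over the cells of [e]. The bound [3 * d] collects two
    approximation errors and [cell_counts_decorrelation] with parameter [d]. *)
Lemma decorrelation_of_approximation (I : finType) (p : S -> I) (s : I -> R)
    (W : set S) (T : set (set S)) (J : finType) (e : S -> J) (h : J -> R)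
    (E : set Om) (d : R) :
  (forall i, measurable (cell p i)) -> measurable W -> (nu W < +oo)%E ->
  (forall i, 0 <= s i <= 1) -> (forall i, s i != 1 -> cell p i `<=` W) ->
  sigma_algebra setT T -> T `<=` measurable -> count_algebra T E ->
  (forall j, T (cell e j)) -> (forall j, 0 <= h j) ->
  (forall j B, T B ->
    (nu (W `&` (B `&` cell e j)) <= (h j)%:E * nu (B `&` cell e j))%E) ->
  (forall j, h j != 0 -> (nu (cell e j) < +oo)%E) ->
  0 < d -> \sum_j h j * fine (nu (W `&` cell e j)) <= d * d -> measurable E ->
  `|mean P (fun om => \1_E om * count_product N p s om) -
    mean P \1_E * mean P (count_product N p s)| <= 3 * d.
Proof.
move=> mp mW nuW s01 sW sT mT TE Te h0 nuh hfin d0 hd mE.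
have [J' [r [F [Tr rF EF]]]] := count_algebra_approximation sT mT TE d0.
have mr j : measurable (cell r j) by exact: mT.
have me j : measurable (cell e j) by exact: mT.
have mre := measurable_cell_pair mr me.
have reF : cell_algebra (pair_fun r e) F by apply: (cell_algebra_refine (f := fst)) rF.
have mF : measurable F.
  move: F reF {rF EF}; apply: generated_algebra_sub; first exact: sigma_algebra_measurable.
  by move=> j U mU; rewrite -[X in measurable X]setTI; exact: mN.
pose h' (jk : J' * J) := h jk.2.
have nuh' jk : (nu (W `&` cell (pair_fun r e) jk) <=
    (h' jk)%:E * nu (cell (pair_fun r e) jk))%E.
  by case: jk => j k; rewrite cell_pair; exact: nuh.
have hfin' jk : nu (cell (pair_fun r e) jk) = +oo%E -> h' jk = 0.
  case: jk => j k; rewrite cell_pair /h'/= => nuoo.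
  apply/eqP/negPn/negP => /hfin; rewrite ltNge => /negP; apply.
  rewrite -nuoo le_measure// ?inE//.
  exact: measurableI.
have := cell_counts_decorrelation mN vN poissonN mp mre mW nuW s01 sW
  (fun jk => h0 jk.2) nuh' hfin' reF d0.
set sum := \sum_jk _; have -> : sum = \sum_j h j * fine (nu (W `&` cell e j)).
  rewrite /sum (eq_bigr (fun jk => h jk.2 * fine (nu (W `&` (cell r jk.1 `&` cell e jk.2)))));
    last by case=> j k _; rewrite cell_pair.
  rewrite -(pair_bigA _ (fun j k => h k * fine (nu (W `&` (cell r j `&` cell e k))))).
  rewrite exchange_big/=; apply: eq_bigr => k _; rewrite -mulr_sumr; congr (_ * _).
  rewrite (measure_cells nu mr (measurableI _ _ mW (me k))) -sum_fine.
    by apply: eq_bigr => j _; rewrite setICA.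
  move=> j _; rewrite ge0_fin_numE// (le_lt_trans _ nuW)// le_measure// ?inE//.
    by apply: measurableI => //; exact: measurableI.
  by move=> x [_ []].
have bphi := bounded_measurable_count_product mN vN mp s01.
set phi := count_product N p s in bphi *.
have bE := bounded_measurable_indic R mE.
have bF := bounded_measurable_indic R mF.
have phi01 om : 0 <= phi om <= 1.
  rewrite /phi /count_product prodr_ge0 => [|i _]; last first.
    by have /andP[] := cpow_itv (N om (cell p i)) (s01 i).
  by apply: prodr_ile1 => i _; exact: cpow_itv.
move=> dF.
have d1 : `|mean P (fun om => \1_E om * phi om) - mean P (fun om => \1_F om * phi om)| <= d.
  rewrite -meanB; try exact: bounded_measurableM.
  apply: le_trans EF; apply: norm_mean_le.
  - by apply: bounded_measurableB; exact: bounded_measurableM.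
  - exact: bounded_measurable_indicB.
  - move=> om; rewrite -mulrBl normrM ler_piMr//.
    by have /andP[? ?] := phi01 om; rewrite ger0_norm.
have d2 : `|mean P \1_F * mean P phi - mean P \1_E * mean P phi| <= d.
  rewrite -mulrBl normrM; apply: le_trans EF.
  rewrite distrC -meanB//.
  apply: le_trans (_ : mean P (fun om => `|\1_E om - \1_F om|) * 1 <= _);
    last by rewrite mulr1.
  apply: ler_pM => //.
    apply: norm_mean_le => //; first exact: bounded_measurableB.
    exact: bounded_measurable_indicB.
  rewrite ger0_norm; first by apply: mean_le => // om; have /andP[] := phi01 om.
  by apply: mean_ge0 => om; have /andP[] := phi01 om.
have d3 : d / 2 + (\sum_j h j * fine (nu (W `&` cell e j))) / (2 * d) <= d.
  rewrite [leRHS]splitr lerD2l ler_pdivrMr ?mulr_gt0// (le_trans hd)//.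
  by rewrite le_eqVlt; apply/orP; left; apply/eqP; field.
have -> : mean P (fun om => \1_E om * phi om) - mean P \1_E * mean P phi =
  (mean P (fun om => \1_E om * phi om) - mean P (fun om => \1_F om * phi om)) +
  (mean P (fun om => \1_F om * phi om) - mean P \1_F * mean P phi) +
  (mean P \1_F * mean P phi - mean P \1_E * mean P phi) by ring.
apply: le_trans (ler_normD _ _) _; apply: le_trans (lerD (ler_normD _ _) (lexx _)) _.
have -> : 3 * d = d + d + d by ring.
by rewrite lerD// lerD// (le_trans dF).
Qed.

(** Powers are only controlled on cells inside a window [W n]. No event is lost, because [N om D] is
    the increasing limit of the counts of [D] inside the windows. *)
Lemma count_algebra_windows (W : nat -> set S) (A : set Om) :
  (forall n, measurable (W n)) -> {homo W : m n / (m <= n)%N >-> m `<=` n} ->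
  \bigcup_n W n = setT -> count_algebra measurable A ->
  count_algebra [set D | measurable D /\ exists n, D `<=` W n] A.
Proof.
move=> mW homoW WT; move: A; apply: generated_algebra_subP => -[D mD] /=.
pose T' := [set D | measurable D /\ exists n, D `<=` W n].
apply: (@emeasurable_fun_cvg _
  (generated_type (fun (B : {B | T' B}) om => N om (sval B))) R setT
  (fun n om => N om (D `&` W n))).
  move=> n; have TD : T' (D `&` W n).
    by split; [exact: measurableI|exists n; exact: subIsetr].
  exact: (measurable_fun_generated (N := fun (B : {B | T' B}) om => N om (sval B))
    (exist _ _ TD)).
move=> om _; have DE : D = \bigcup_n (D `&` W n) by rewrite -setI_bigcupr WT setIT.
rewrite {2}DE; apply: nondecreasing_cvg_mu.
- by move=> n; exact: measurableI.
- by rewrite -DE.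
- by move=> m n mn; apply/subsetPset; apply: setIS; exact: homoW.
Qed.

(** The centred indicator [f] of [E] is orthogonal to the products of powers on windows, hence to
    all events of the counts, and in particular to [E] itself; this reads P(E) (1 - P(E)) = 0. Here
    [W n] plays the role of W_K^*, and [T] that of the sets of trajectories described by Out_K'. *)
Lemma poisson_zero_one (W : nat -> set S) (E : set Om) :
  (forall n, measurable (W n)) -> (forall n, (nu (W n) < +oo)%E) ->
  {homo W : m n / (m <= n)%N >-> m `<=` n} -> \bigcup_n W n = setT ->
  measurable E -> count_algebra measurable E ->
  (forall n d, 0 < d -> exists T (J : finType) (e : S -> J) (h : J -> R),
    [/\ sigma_algebra setT T, T `<=` measurable, count_algebra T E &
        forall j, T (cell e j)] /\
    [/\ forall j, 0 <= h j,
        forall j B, T B ->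
          (nu (W n `&` (B `&` cell e j)) <= (h j)%:E * nu (B `&` cell e j))%E,
        forall j, h j != 0 -> (nu (cell e j) < +oo)%E &
        \sum_j h j * fine (nu (W n `&` cell e j)) <= d]) ->
  P E = 0%E \/ P E = 1%E.
Proof.
move=> mW nuW homoW WT mE sE HE.
have bE := bounded_measurable_indic R mE.
set f := fun om => \1_E om - mean P \1_E : R.
have bf : bounded_measurable f.
  by apply: bounded_measurableB => //; exact: bounded_measurable_cst.
pose good (I : finType) (p : S -> I) (s : I -> R) :=
  [/\ forall i, measurable (cell p i), forall i, 0 <= s i <= 1 &
      exists n, forall i, s i != 1 -> cell p i `<=` W n].
have decorr (I : finType) (p : S -> I) (s : I -> R) : good I p s ->
    mean P (fun om => f om * count_product N p s om) = 0.
  move=> [mp s01 [n sW]].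
  have bphi := bounded_measurable_count_product mN vN mp s01.
  have -> : mean P (fun om => f om * count_product N p s om) =
      mean P (fun om => \1_E om * count_product N p s om) -
      mean P \1_E * mean P (count_product N p s).
    rewrite -meanZl// -meanB; last 2 first.
    - exact: bounded_measurableM.
    - by apply: bounded_measurableM => //; exact: bounded_measurable_cst.
    by apply: eq_mean => om; rewrite mulrBl.
  apply/eqP; rewrite -normr_eq0; apply/eqP/le_anti; rewrite normr_ge0 andbT.
  apply/ler_addgt0Pl => d d0; rewrite addr0.
  have d30 : 0 < d / 3 by rewrite divr_gt0.
  (* The square is the form required by [decorrelation_of_approximation], whose conclusion then
     reads [3 * (d / 3)]. *)
  have [T [J [e [h [[sT mT TE Te] [h0 nuh hfin hd]]]]]] := HE n _ (mulr_gt0 d30 d30).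
  have := decorrelation_of_approximation mp (mW n) (nuW n) s01 sW sT mT TE Te
    h0 nuh hfin d30 hd mE.
  by rewrite mulrCA mulfV ?mulr1.
pose T' := [set D | measurable D /\ exists n, D `<=` W n].
pose G := [set g | exists (I : finType) (p : S -> I) (s : I -> R),
  good I p s /\ g = count_product N p s].
have [_] : measurable E /\ mean P (fun om => f om * \1_E om) = 0.
  apply: (determining_class (P := P) (N := fun (B : {B | T' B}) om => N om (sval B))
    (M := G)) => //.
  - by move=> [D [mD DW]]; exact: mN.
  - by move=> [D [mD DW]] om; exact: vN.
  - exists unit, (fun=> tt), (fun=> 1); split.
      split=> [[]|_|]; last by exists 0%N => i; rewrite eqxx.
        by rewrite (_ : cell _ _ = setT)//; apply/seteqP; split.
      by rewrite ler01 lexx.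
    by apply/funext => om; rewrite /count_product big1// => j _; rewrite cpow1.
  - by move=> _ [I [p [s [[mp s01 _] ->]]]]; exact: bounded_measurable_count_product.
  - move=> [D [mD [n Dn]]] t _ t01 [I [p [s [[mp s01 [m sW]] ->]]]] /=.
    have {}t01 : 0 <= t <= 1 by case/andP: t01 => -> /ltW ->.
    pose q x := `[< D x >]; pose u b : R := if b then t else 1.
    have u01 b : 0 <= u b <= 1 by case: b; rewrite /u// ler01 lexx.
    have qT : cell q true = D by apply/seteqP; split=> x /asboolP.
    have mq b : measurable (cell q b).
      case: b; first by rewrite qT.
      rewrite (_ : cell _ _ = ~` D); first exact: measurableC.
      by apply/seteqP; split=> [x /negbT/asboolPn|x /asboolPn/negbTE].
    (* The new factor is a product over the partition of the space into [D] and its complement, with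
       base 1 off [D]. Cells of the refinement with base other than 1 lie in the larger of the two
       windows. *)
    exists (bool * I)%type, (pair_fun q p), (fun ij => u ij.1 * s ij.2); split; first split.
    + exact: measurable_cell_pair.
    + move=> [b i] /=; have /andP[? ?] := u01 b; have /andP[? ?] := s01 i.
      by rewrite mulr_ge0// mulr_ile1.
    + exists (maxn n m) => -[b i]; rewrite cell_pair /=.
      have [->|si _] := eqVneq (s i) 1; last first.
        by apply: subset_trans (homoW _ _ (leq_maxr n m)) => x [_ /(sW _ si)].
      case: b; last by rewrite mulr1 eqxx.
      by move=> _; rewrite qT; apply: subset_trans (homoW _ _ (leq_maxl n m)) => x [/Dn].
    + apply/funext => om; rewrite -(count_productM vN om mq mp u01 s01); congr (_ * _).
      by rewrite /count_product big_bool /= cpow1 mulr1 qT.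
  - by move=> _ [I [p [s [gd ->]]]]; exact: decorr.
  - exact: count_algebra_windows.
rewrite (_ : (fun om => _) = (fun om => (1 - mean P \1_E) * \1_E om)); last first.
  apply/funext => om; rewrite /f indicE; case: (_ \in _); rewrite ?mulr0 ?mulr1//.
rewrite meanZl// mean_indic// => /eqP; rewrite mulf_eq0 subr_eq0 => /orP[/eqP PE|/eqP PE].
  by right; rewrite -[LHS]fineK ?fin_num_measure// -PE.
by left; rewrite -[LHS]fineK ?fin_num_measure// PE.
Qed.

End poisson_zero_one.

(** * The Markov chain *)

Section countable_sums.
Context (R : realType).
Local Open Scope ereal_scope.

Lemma esum_pickle (V : countType) (a : V -> \bar R) : (forall v, 0 <= a v) ->
  \esum_(v in [set: V]) a v =
  \sum_(n <oo) (if @pickle_inv V n is Some v then a v else 0).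
Proof.
move=> a0; pose b n := if @pickle_inv V n is Some v then a v else 0.
have b0 n : 0 <= b n by rewrite /b; case: pickle_inv.
rewrite -/b nneseries_esumT//.
transitivity (\esum_(n in choice.pickle @` [set: V]) b n).
  rewrite esum_image; last by move=> x y _ _; exact: (pcan_inj pickleK_inv).
  by apply: eq_esum => v _; rewrite /b pickleK_inv.
rewrite esum_mkcond; apply: eq_esum => n _; case: ifPn => //.
move=> /negP nr; rewrite /b; have := @pickle_invK V n.
case: (@pickle_inv V n) => [v|//] /= vn; case: nr.
by apply/mem_set; exists v.
Qed.

Lemma esumZl (V : countType) (r : R) (a : V -> \bar R) : (0 <= r)%R ->
  (forall v, 0 <= a v) ->
  \esum_(v in [set: V]) (r%:E * a v) = r%:E * \esum_(v in [set: V]) a v.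
Proof.
move=> r0 a0; rewrite !esum_pickle//; last by move=> v; rewrite mule_ge0.
rewrite -nneseriesZl; last by move=> n _; case: pickle_inv.
by apply: eq_eseriesr => n _; case: pickle_inv => //; rewrite mule0.
Qed.

Lemma esumZr (V : countType) (r : R) (a : V -> \bar R) : (0 <= r)%R ->
  (forall v, 0 <= a v) ->
  \esum_(v in [set: V]) (a v * r%:E) = (\esum_(v in [set: V]) a v) * r%:E.
Proof.
move=> r0 a0; rewrite muleC -esumZl//.
by apply: eq_esum => v _; rewrite muleC.
Qed.

Lemma measure_countable_partition d (T : measurableType d)
    (mu : {measure set T -> \bar R}) (V : countType) (F : V -> set T) :
  (forall v, measurable (F v)) -> trivIset setT F ->
  mu (\bigcup_v F v) = \esum_(v in [set: V]) mu (F v).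
Proof.
move=> mF tF; pose Fn n := if @pickle_inv V n is Some v then F v else set0.
have mFn n : measurable (Fn n) by rewrite /Fn; case: pickle_inv.
have FnE : \bigcup_v F v = \bigcup_n Fn n.
  apply/seteqP; split=> [x [v _ Fv]|x [n _]].
    by exists (choice.pickle v) => //; rewrite /Fn pickleK_inv.
  by rewrite /Fn; case: pickle_inv => // v Fv; exists v.
rewrite esum_pickle// FnE measure_semi_bigcup//.
- by apply: eq_eseriesr => n _; rewrite /Fn; case: pickle_inv.
- move=> i j _ _ [x []]; rewrite /Fn.
  have := @pickle_invK V i; have := @pickle_invK V j.
  case: (@pickle_inv V i) => [v|//]; case: (@pickle_inv V j) => [v'|//] /= ej ei Fv Fv'.
  by rewrite -ei -ej (tF v v')//; exists x.
- exact: bigcupT_measurable.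
Qed.

Lemma measure_fibers d (T : measurableType d)
    (mu : {measure set T -> \bar R}) (V : countType) (f : T -> V) (C : set T) :
  (forall v, measurable (C `&` f @^-1` [set v])) ->
  mu C = \esum_(v in [set: V]) mu (C `&` f @^-1` [set v]).
Proof.
move=> mC; rewrite -measure_countable_partition//.
  congr (mu _); apply/seteqP; split=> [x Cx|x [v _ []]//].
  by exists (f x).
by move=> v w _ _ [x [[_ <-] [_ <-]]].
Qed.

End countable_sums.

(** * Markov property at a fixed time and reversibility *)

Section markov.
Context {R : realType} {G : wgraph R} (X : transient_chain G).
Local Notation V := (site G).
Local Open Scope ereal_scope.

Definition determined (k : nat) (A : set (walk G)) :=
  forall w w', (forall i, (i <= k)%N -> w i = w' i) -> A w -> A w'.

Definition step_prob (k : nat) (x y : V) : \bar R := X x [set w | w k = y].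

(** The pieces of an event that depends on the times up to [k]: it is a disjoint union of prefix
    events indexed by the countable type of finite sequences, and [markov_property] applies to each
    of them. *)
Let pre (k : nat) (A : set (walk G)) (h : seq V) : set (walk G) :=
  if `[< size h = k.+1 /\ A (nth (Defs.root G) h) >] then prefix_event k (nth (Defs.root G) h)
  else set0.

Let preE k A : determined k A -> A = \bigcup_h pre k A h.
Proof.
move=> dA; apply/seteqP; split=> [w Aw|w [h _]].
  exists (mkseq w k.+1) => //; rewrite /pre asboolT; first exact: prefix_cover.
  rewrite size_mkseq; split=> //; apply: dA Aw => i ik.
  exact: prefix_cover.
rewrite /pre; case: asboolP => // -[_ Ah] hw.
by apply: dA Ah => i ik; rewrite hw.
Qed.

Let triv_pre k A : trivIset setT (pre k A).
Proof.
move=> h h' _ _ [w []]; rewrite /pre; case: asboolP => // -[sh _] hw.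
case: asboolP => // -[sh' _] hw'.
apply: (@eq_from_nth _ (Defs.root G)) => [|i]; first by rewrite sh.
by rewrite sh ltnS => ik; rewrite -hw// -hw'.
Qed.

Let mpre k A h : measurable (pre k A h).
Proof. by rewrite /pre; case: asboolP => _ //; exact: measurable_prefix. Qed.

Lemma measurable_determined k A : determined k A -> measurable A.
Proof.
move=> dA; rewrite (preE dA); exact: countable_bigcupT_measurable.
Qed.

Lemma measurable_coord_eq k (y : V) : measurable [set w : walk G | w k = y].
Proof. exact: (@measurable_coord _ _ k [set y]). Qed.

Lemma measurable_walk_shift_preimage k (B : set (walk G)) : measurable B ->
  measurable (walk_shift k @^-1` B).
Proof.
by move=> mB; rewrite -[X in measurable X]setTI; exact: measurable_walk_shift.
Qed.

Lemma markov_determined x k y A B : determined k A -> measurable B ->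
  X x (A `&` [set w | w k = y] `&` walk_shift k @^-1` B) =
  X x (A `&` [set w | w k = y]) * X y B.
Proof.
move=> dA mB; set A' := A `&` _.
have dA' : determined k A'.
  move=> w w' ww' [Aw wk]; split; first exact: dA Aw.
  by rewrite /= -ww'.
have mS := measurable_walk_shift_preimage k mB.
have /fineK <- := fin_num_measure (X y) _ mB.
have m1 h : measurable (pre k A' h `&` walk_shift k @^-1` B) by exact: measurableI.
have t1 : trivIset setT (fun h => pre k A' h `&` walk_shift k @^-1` B).
  by move=> h h' _ _ [w [[hw _] [hw' _]]]; apply: (@triv_pre k A') => //; exists w.
rewrite {1}(preE dA') setI_bigcupl (measure_countable_partition _ m1 t1).
rewrite [in X in _ = X * _](preE dA') measure_countable_partition//.
rewrite -esumZr//; last by rewrite fine_ge0.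
apply: eq_esum => h _; rewrite fineK ?fin_num_measure// setIC.
rewrite /pre; case: asboolP => [[sh [_ hk]]|_]; last by rewrite setI0 !measure0 mul0e.
by apply: etrans (markov_property X x _ _ mB) _; rewrite hk.
Qed.

Lemma determinedT k : determined k setT.
Proof. by []. Qed.

Lemma markov_coord x k y B : measurable B ->
  X x ([set w | w k = y] `&` walk_shift k @^-1` B) = step_prob k x y * X y B.
Proof.
by move=> mB; have := markov_determined x y (determinedT (k := k)) mB; rewrite setTI.
Qed.

Lemma step_probD j k x y :
  step_prob (j + k) x y = \esum_(z in [set: V]) (step_prob j x z * step_prob k z y).
Proof.
rewrite {1}/step_prob (measure_fibers _ (f := fun w : walk G => w j)); last first.
  by move=> z; apply: measurableI; exact: measurable_coord_eq.
apply: eq_esum => z _; rewrite -markov_coord; last exact: measurable_coord_eq.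
by rewrite setIC.
Qed.

Lemma step_prob0 x y : step_prob 0 x y = (x == y)%:R%:E.
Proof.
have [->|xy] := eqVneq x y; first exact: (law_markov X y).1.
by apply: law0; exact/eqP.
Qed.

Lemma step_prob1 x y : step_prob 1 x y = (trans_prob x y)%:E.
Proof.
have [X1 XS] := law_markov X x.
have := XS 0%N (fun i => if i is 0%N then x else y).
rewrite -!/(prefix_event _ _) prefix_event0 X1 mul1e /= => <-.
have m1 : measurable [set w : walk G | w 1%N = y] by exact: measurable_coord_eq.
have m0 : measurable [set w : walk G | w 0%N = x] by exact: measurable_coord_eq.
rewrite prefix_eventS prefix_event0 /step_prob.
have := probability_setC (X x) m0; rewrite X1 subee// => X0.
set A1 := [set w | w 1%N = y]; set A0 := [set w | w 0%N = x].
have X10 : X x (A1 `&` ~` A0) = 0.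
  apply: (null_sub (B := ~` A0)) => //.
  - by apply: measurableI => //; exact: measurableC.
  - exact: measurableC.
have -> : X x A1 = X x ((A1 `&` A0) `|` (A1 `&` ~` A0)).
  by rewrite -setIUr setUv setIT.
transitivity (X x (A1 `&` A0) + X x (A1 `&` ~` A0)); last first.
  by rewrite X10 adde0 setIC.
apply: measureU.
- exact: measurableI.
- by apply: measurableI => //; exact: measurableC.
- by apply/seteqP; split=> // w [[_ ?] [_]].
Qed.

Lemma vweight_ge0 (x : V) : (0 <= vweight x)%R.
Proof. by apply: fsumr_ge0 => z /= /cond_gt0/ltW. Qed.

Lemma vweight_gt0 (x y : V) : adj x y -> (0 < vweight x)%R.
Proof.
move=> xy; rewrite /vweight (fsbigD1 y)//=; last exact: adj_locfin.
by rewrite ltr_pwDl ?cond_gt0//; apply: fsumr_ge0 => z /= [/cond_gt0/ltW].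
Qed.

Lemma vweight_trans_prob (x y : V) :
  (vweight x * trans_prob x y = vweight y * trans_prob y x)%R.
Proof.
rewrite /trans_prob adj_sym; case: ifPn => [yx|_]; last by rewrite !mulr0.
have xy : adj x y by rewrite adj_sym.
rewrite ![(vweight _ * _)%R]mulrC !divfK ?gt_eqF//; last 2 first.
- exact: vweight_gt0 yx.
- exact: vweight_gt0 xy.
exact: cond_sym.
Qed.

(** Detailed balance passes from one step to [k] steps by detaching the last step on one side and
    the first step on the other. *)
Lemma step_prob_rev k x y :
  (vweight x)%:E * step_prob k x y = (vweight y)%:E * step_prob k y x.
Proof.
elim: k x y => [|k IH] x y.
  by rewrite !step_prob0 eq_sym; case: eqP => [->|_]; rewrite ?mule0.
rewrite -[in LHS](addn1 k) -[in RHS](add1n k) !step_probD.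
rewrite -!esumZl ?vweight_ge0//; last 2 first.
- by move=> z; rewrite mule_ge0.
- by move=> z; rewrite mule_ge0.
apply: eq_esum => z _; rewrite !step_prob1 muleA IH [RHS]muleA -EFinM.
by rewrite vweight_trans_prob EFinM muleAC.
Qed.

End markov.

(** * Last exit decomposition and its reversal *)

Section last_exit.
Context {R : realType} {G : wgraph R} (X : transient_chain G).
Local Notation V := (site G).
Local Open Scope ereal_scope.

Lemma le_measure_negligible d (T : measurableType d)
    (mu : {measure set T -> \bar R}) (A B N : set T) :
  measurable A -> measurable B -> mu.-negligible N -> A `<=` B `|` N ->
  mu A <= mu B.
Proof.
move=> mA mB [N' [mN' N'0 NN']] AB.
apply: (@le_trans _ _ (mu (B `|` N'))).
  rewrite le_measure ?inE//; first exact: measurableU.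
  by apply: subset_trans AB _; apply: setUS.
apply: (@le_trans _ _ (mu B + mu N')); first exact: measureU2.
by rewrite N'0 adde0.
Qed.

Definition hits (K : {fset V}) : set (walk G) := [set w | exists k, w k \in K].

(** Used with [x] in a finite set [K] and [C] inside [no_return K]: the time [k] is then the last
    visit to [K], so the union is disjoint, and the walk leaves [K] at [x] with its future in
    [C]. *)
Definition exits_at (x : V) (C : set (walk G)) : set (walk G) :=
  \bigcup_k ([set w | w k = x] `&` walk_shift k @^-1` C).

Lemma measurable_exits_at x C : measurable C -> measurable (exits_at x C).
Proof.
move=> mC; apply: bigcupT_measurable => k; apply: measurableI.
  exact: measurable_coord_eq.
exact: measurable_walk_shift_preimage.
Qed.

Lemma measurable_hits K : measurable (hits K).
Proof.
rewrite (_ : hits K = \bigcup_k [set w : walk G | w k \in K]).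
  by apply: bigcupT_measurable => k; exact: (@measurable_coord _ _ k [set x | x \in K]).
by apply/seteqP; split=> w [k]; [exists k|move=> _; exists k].
Qed.

Lemma last_exit_unique (K : {fset V}) (w : walk G) k l :
  w k \in K -> w l \in K -> no_return K (walk_shift k w) ->
  no_return K (walk_shift l w) -> k = l.
Proof.
wlog kl : k l / (k <= l)%N.
  by move=> H; case/orP: (leq_total k l) => kl *; [exact: H|apply/esym/H].
move=> wk wl nk _; move: kl; rewrite leq_eqVlt => /predU1P[//|kl].
have := nk (l - k)%N; rewrite subn_gt0 kl => /(_ isT).
by rewrite /walk_shift subnKC ?(ltnW kl)// wl.
Qed.

(** The right side is the Green function from [y] to [x] times the probability of [C] from [x]. *)
Lemma law_exits_at (K : {fset V}) x y C : x \in K -> C `<=` no_return K ->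
  measurable C ->
  X y (exits_at x C) = \sum_(k <oo) (step_prob X k y x * X x C).
Proof.
move=> xK CK mC.
rewrite [LHS]measure_semi_bigcup.
- by apply: eq_eseriesr => k _; exact: markov_coord.
- move=> k; apply: measurableI; first exact: measurable_coord_eq.
  exact: measurable_walk_shift_preimage.
- move=> k l _ _ [w [[/= wk Ck] [/= wl Cl]]].
  by apply: (@last_exit_unique K w); rewrite ?wk ?wl//; exact: CK.
- exact: measurable_exits_at.
Qed.

(** With g the Green function and a the vertex weight, both sides are P_y[B] P_x[C] times a_y g(y,
    x) = a_x g(x, y). The path from [y] to [x] is read backwards: a last exit from [K'] at [x]
    becomes, seen from [x], a last visit to [K] at [y]. *)
Lemma law_exits_at_rev (K K' : {fset V}) x y B C :
  x \in K' -> y \in K -> B `<=` no_return K -> C `<=` no_return K' ->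
  measurable B -> measurable C ->
  (vweight y)%:E * X y B * X y (exits_at x C) =
  (vweight x)%:E * X x C * X x (exits_at y B).
Proof.
move=> xK' yK BK CK' mB mC.
rewrite (law_exits_at y xK' CK' mC) (law_exits_at x yK BK mB).
have step0 k u v : 0 <= step_prob X k u v by exact: measure_ge0.
have /fineK <- := fin_num_measure (X y) _ mB.
have /fineK <- := fin_num_measure (X x) _ mC.
set b := fine _; set c := fine _.
have b0 : (0 <= b)%R by rewrite fine_ge0.
have c0 : (0 <= c)%R by rewrite fine_ge0.
rewrite -!EFinM -!nneseriesZl; last 2 first.
- by move=> k _; rewrite mule_ge0// lee_fin.
- by move=> k _; rewrite mule_ge0// lee_fin.
apply: eq_eseriesr => k _; have := step_prob_rev X k y x.
have stepE u v : step_prob X k u v = (fine (step_prob X k u v))%:E.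
  by rewrite fineK// fin_num_measure//; exact: measurable_coord_eq.
rewrite (stepE y x) (stepE x y) -!EFinM => -[rev]; congr _%:E.
transitivity (b * c * (vweight y * fine (step_prob X k y x)))%R; first by ring.
by rewrite rev; ring.
Qed.

Lemma negligible_infinite_visits x :
  (X x).-negligible [set w | exists y, ~ finite_set [set n | w n = y]].
Proof.
pose F n := if @pickle_inv V n is Some y then
  [set w : walk G | ~ finite_set [set n | w n = y]] else set0.
apply: (@negligibleS _ _ _ _ (\bigcup_n F n)).
  by move=> w [y wy]; exists (choice.pickle y) => //; rewrite /F pickleK_inv.
apply: negligible_bigcup => n; rewrite /F.
case: pickle_inv => [y|]; last exact: negligible_set0.
exact: finite_visits_ae.
Qed.

Lemma last_exit_exists (K : {fset V}) (w : walk G) : hits K w ->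
  (forall y, finite_set [set n | w n = y]) ->
  exists2 k, w k \in K & no_return K (walk_shift k w).
Proof.
move=> wK wfin; have finK : finite_set [set n | w n \in K].
  rewrite (_ : [set n | _] = \bigcup_(y in [set` K]) [set n | w n = y]).
    exact: bigcup_finite.
  by apply/seteqP; split=> [n wn|n [y yK] /= ->//]; exists (w n).
have Kub n : w n \in K -> (n <= \max_(i <- fset_set [set n | w n \in K]) i)%N.
  by move=> wn; apply: leq_bigmax_seq => //; rewrite in_fset_set// inE.
case: (ex_maxnP (P := fun n => w n \in K) wK Kub) => k wk kmax.
exists k => // n n0; apply/negP => /kmax.
by rewrite -{2}[k]addn0 leq_add2l leqn0 => /eqP n0'; rewrite n0' in n0.
Qed.

(** By transience, a walk that hits [K] almost surely has a last visit to [K], which is unique. *)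
Lemma law_hits (K : {fset V}) x :
  X x (hits K) = \sum_(y <- K) X x (exits_at y (no_return K)).
Proof.
have mE y : measurable (exits_at y (no_return K)).
  by apply: measurable_exits_at; exact: measurable_no_return.
have tE : trivIset [set` K] (fun y => exits_at y (no_return K)).
  move=> y z yK zK [w [[k _ [/= wk nk]] [l _ [/= wl nl]]]].
  have kl : k = l by apply: last_exit_unique nk nl; rewrite ?wk ?wl.
  by rewrite -wk -wl kl.
rewrite -(measure_fbigsetU (X x) (fun y _ => mE y) tE).
have mU : measurable (\big[setU/set0]_(y <- K) exits_at y (no_return K)).
  exact: bigsetU_measurable.
apply/eqP; rewrite eq_le; apply/andP; split.
  apply: (le_measure_negligible (measurable_hits K) mU (negligible_infinite_visits x)).
  move=> w wK.
  have [?|wfin] := pselect (exists y, ~ finite_set [set n | w n = y]); first by right.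
  left; have {}wfin y : finite_set [set n | w n = y].
    by apply: contrapT => wy; apply: wfin; exists y.
  have [k wk nk] := last_exit_exists wK wfin.
  by rewrite -bigcup_fset; exists (w k) => //; exists k.
rewrite le_measure ?inE//; first exact: measurable_hits.
by rewrite -bigcup_fset => w [y yK [k _ [/= wk _]]]; exists k; rewrite wk.
Qed.

End last_exit.

(** * Exit points from a large set are unlikely to lead back to [K] *)

Section exit_far_away.
Context {R : realType} {G : wgraph R} (X : transient_chain G).
Local Notation V := (site G).
Variable K : {fset V}.
Local Open Scope ereal_scope.

Let late (m : nat) : set (walk G) := walk_shift m @^-1` hits K.

Let measurable_late m : measurable (late m).
Proof. by apply: measurable_walk_shift_preimage; exact: measurable_hits. Qed.

Let late_anti m n : (m <= n)%N -> late n `<=` late m.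
Proof.
move=> mn w [k wk]; exists (n - m + k)%N.
by move: wk; rewrite /walk_shift addnA subnKC.
Qed.

(** The events [late n] decrease to a null event, as their intersection forces infinitely many
    visits to the finite set [K]. *)
Lemma late_hits_small y (e : R) : (0 < e)%R ->
  exists m, forall n, (m <= n)%N -> X y (late n) <= e%:E.
Proof.
move=> e0; have mI : measurable (\bigcap_n late n) by exact: bigcapT_measurable.
have I0 : X y (\bigcap_n late n) = 0.
  apply/eqP; rewrite -measure_le0; rewrite -[leRHS](measure0 (X y)).
  apply: (le_measure_negligible mI _ (negligible_infinite_visits X y)) => //.
  move=> w wl; right; apply: contrapT => wfin.
  have {}wfin z : finite_set [set n | w n = z].
    by apply: contrapT => wz; apply: wfin; exists z.
  have [k wk nk] := last_exit_exists (wl 0%N I) wfin.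
  have [l wl'] := wl k.+1 I.
  have := nk l.+1 isT.
  by rewrite /walk_shift /= addnS add0n; move: wl'; rewrite /walk_shift addSn => ->.
have : (fun m => X y (late m)) @ \oo --> 0.
  rewrite -I0; apply: (nonincreasing_cvg_mu (mu := X y)) => //.
    exact: (le_lt_trans (probability_le1 (X y) (measurable_late 0)) (ltry _)).
  by move=> m n mn; apply/subsetPset; exact: late_anti.
move=> /fine_cvgP[].
move=> _ /cvgrPdist_le/(_ _ e0)[m _ hm]; exists m => n mn.
have := hm n mn; rewrite /= sub0r normrN ger0_norm ?fine_ge0// => le.
by rewrite -[leLHS]fineK ?lee_fin// fin_num_measure.
Qed.

Let high (e : R) (x : V) := e%:E < X x (hits K).

Let high_after (e : R) (m : nat) : set (walk G) :=
  [set w | exists2 k, (m <= k)%N & high e (w k)].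

Let measurable_high_after e m : measurable (high_after e m).
Proof.
rewrite (_ : high_after e m = \bigcup_(k in [set k | (m <= k)%N])
  [set w : walk G | high e (w k)]).
  by apply: bigcup_measurable => k _; exact: (@measurable_coord _ _ k [set x | high e x]).
by apply/seteqP; split=> w [k mk wk]; exists k.
Qed.

(** Apply the Markov property at the first time [k >= m] with [high e (w k)]. *)
Lemma maximal_inequality e m y : (0 < e)%R ->
  e%:E * X y (high_after e m) <= X y (late m).
Proof.
move=> e0; pose T k := [set w : walk G |
  [/\ (m <= k)%N, high e (w k) & forall j, (m <= j < k)%N -> ~~ high e (w j)]].
have dT k : determined k (T k).
  move=> w w' ww' [mk wk wj]; split=> // [|j /andP[mj jk]].
    by rewrite -ww'.
  by rewrite -ww' ?wj ?mj// ltnW.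
have mT k : measurable (T k) := measurable_determined (dT k).
have tT : trivIset setT T.
  move=> k l _ _ [w [[mk wk wj] [ml wl wi]]].
  case: (ltngtP k l) => // kl.
    by have := wi k; rewrite mk kl wk => /(_ isT).
  by have := wj l; rewrite ml kl wl => /(_ isT).
have TE : high_after e m = \bigcup_k T k.
  apply/seteqP; split=> [w [k mk wk]|w [k _ [mk wk _]]]; last by exists k.
  have ex : exists k, (m <= k)%N && high e (w k) by exists k; rewrite mk wk.
  case: (ex_minnP ex) => l /andP[ml wl] lmin; exists l => //; split=> // j /andP[mj jl].
  by apply/negP => wj; have := lmin j; rewrite mj wj leqNgt jl => /(_ isT).
have mS k : measurable (walk_shift k @^-1` hits K).
  by apply: measurable_walk_shift_preimage; exact: measurable_hits.
have Tk k : e%:E * X y (T k) <= X y (T k `&` walk_shift k @^-1` hits K).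
  rewrite (measure_fibers _ (f := fun w : walk G => w k)); last first.
    by move=> z; apply: measurableI => //; exact: measurable_coord_eq.
  rewrite (measure_fibers (X y) (f := fun w : walk G => w k)
    (C := T k `&` walk_shift k @^-1` hits K)); last first.
    move=> z; apply: measurableI; last exact: measurable_coord_eq.
    exact: measurableI.
  rewrite -esumZl ?(ltW e0)//; apply: le_esum => z _.
  rewrite setIAC [leRHS](_ : _ = X y (T k `&` [set w : walk G | w k = z]) *
      X z (hits K)); last exact: (markov_determined X y z (dT k) (measurable_hits K)).
  have [hz|hz] := boolP (high e z).
    by rewrite muleC lee_wpmul2l// ltW.
  rewrite (_ : T k `&` _ = set0) ?measure0 ?mule0 ?mul0e//.
  by apply/seteqP; split=> // w [[_ wk _] /= wz]; move: hz; rewrite -wz wk.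
rewrite TE measure_semi_bigcup//; last exact: bigcupT_measurable.
rewrite -nneseriesZl//.
apply: (@le_trans _ _ (\sum_(k <oo) X y (T k `&` walk_shift k @^-1` hits K))).
  apply: lee_nneseries => [k _ _|k _]; last exact: (Tk k).
  by rewrite mule_ge0// lee_fin ltW.
have mTS k : measurable (T k `&` walk_shift k @^-1` hits K) by exact: measurableI.
rewrite -(measure_semi_bigcup (X y))//; last 2 first.
- by move=> k l _ _ [w [[Tw _] [Tw' _]]]; apply: (tT k l) => //; exists w.
- exact: bigcupT_measurable.
rewrite le_measure ?inE//; first exact: bigcupT_measurable.
by move=> w [k _ [[mk _ _]]]; exact: late_anti.
Qed.

(** The exit points with hitting probability at most [e / 2] contribute at most [e / 2] in total.
    The others are left at time [m] or later, since [K'] contains all paths of length [m] from [y],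
    and the maximal inequality bounds the probability of visiting one of them so late. *)
Lemma exit_hit_small (e : R) : (0 < e)%R -> exists m, forall (K' : {fset V}) y,
  y \in K ->
  (forall w : nat -> V, w 0%N = y -> (forall n, adj (w n) (w n.+1)) ->
     forall i, (i <= m)%N -> w i \in K') ->
  \sum_(x <- K') X x (hits K) * X y (exits_at x (no_return K')) <= e%:E.
Proof.
move=> e0; have e20 : (0 < e / 2)%R by rewrite divr_gt0.
(* The square makes up for the factor [e / 2] on the left of [maximal_inequality]. *)
have [f fP] := choice (fun y => late_hits_small y (mulr_gt0 e20 e20)).
exists (\max_(y <- K) f y)%N => K' y yK pathK'; set m := (\max_(y <- K) f y)%N.
have my : (f y <= m)%N by exact: leq_bigmax_seq.
have mE x : measurable (exits_at x (no_return K')).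
  by apply: measurable_exits_at; exact: measurable_no_return.
have tE (P : {fset V}) : (P `<=` K')%fset ->
    trivIset [set` P] (fun y => exits_at y (no_return K')).
  move=> PK x z xP zP [w [[k _ [/= wk nk]] [l _ [/= wl nl]]]].
  have xK := fsubsetP PK _ xP; have zK := fsubsetP PK _ zP.
  have kl : k = l by apply: last_exit_unique nk nl; rewrite ?wk ?wl.
  by rewrite -wk -wl kl.
pose H := [fset x in K' | high (e / 2) x]%fset.
have HK : (H `<=` K')%fset by exact: fset_sub.
have mU (P : {fset V}) : measurable (\big[setU/set0]_(x <- P) exits_at x (no_return K')).
  exact: bigsetU_measurable.
apply: (@le_trans _ _ ((e / 2)%:E * \sum_(x <- K') X y (exits_at x (no_return K')) +
    \sum_(x <- H) X y (exits_at x (no_return K')))).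
  rewrite -big_fset_condE [X in _ + X]big_mkcond/= ge0_sume_distrr//.
  rewrite -big_split/=; apply: lee_sum => x _.
  have [hx|hx] := boolP (high (e / 2) x).
    rewrite -[leLHS]add0e; apply: leeD; first by rewrite mule_ge0// lee_fin ltW.
    rewrite -[leRHS]mul1e; apply: lee_wpmul2r => //.
    exact: (probability_le1 (X x) (measurable_hits K)).
  by rewrite adde0; apply: lee_wpmul2r => //; rewrite leNgt.
rewrite [leRHS](_ : _ = (e / 2)%:E + (e / 2)%:E); last by rewrite -EFinD -splitr.
apply: leeD.
  rewrite -(measure_fbigsetU (X y) (fun y _ => mE y) (tE _ (fsubset_refl K'))).
  rewrite -[leRHS]mule1; apply: lee_wpmul2l; first by rewrite lee_fin ltW.
  exact: (probability_le1 (X y) (mU K')).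
rewrite -(measure_fbigsetU (X y) (fun y _ => mE y) (tE _ HK)).
have e20' : (0 <= e / 2)%R by exact: ltW.
apply: (@le_trans _ _ (X y (high_after (e / 2) m))); last first.
  rewrite -(@lee_pmul2l _ (e / 2)%:E)// -EFinM.
  apply: le_trans (fP y m my); exact: maximal_inequality.
have m0 : measurable [set w : walk G | w 0%N = y] by exact: measurable_coord_eq.
pose Z : set (walk G) := ~` [set w : walk G | w 0%N = y] `|`
  \bigcup_n [set w : walk G | ~ adj (w n) (w n.+1)].
have ZN : (X y).-negligible Z.
  apply: negligibleU; last by apply: negligible_bigcup => n; exact: nearest_neighbour_ae.
  exists (~` [set w : walk G | w 0%N = y]); split=> //; first exact: measurableC.
  have := probability_setC (X y) m0; have [-> _] := law_markov X y.
  by rewrite subee.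
apply: (le_measure_negligible (mU H) (measurable_high_after (e / 2) m) ZN).
move=> w; rewrite -bigcup_fset => -[x]; rewrite /= !inE => /andP[xK' hx] [k _ [/= wk nk]].
have [w0|w0] := pselect (w 0%N = y); last by right; left.
have [nn|/existsNP[n wn]] := pselect (forall n, adj (w n) (w n.+1)); last first.
  by right; right; exists n.
left; exists k; last by rewrite wk.
(* For [k < m], the next position [w k.+1] is still in [K'], so [k] is not the last visit. *)
rewrite leqNgt; apply/negP => km; have := nk 1%N isT.
by rewrite /walk_shift addn1 (pathK' w w0 nn).
Qed.

End exit_far_away.

(** * Trajectories and exit points *)

Section trajectory_measurability.
Context {R : realType} {G : wgraph R} (X : transient_chain G).
Local Notation V := (site G).
Local Open Scope ereal_scope.

Lemma measurable_ftraj_set : measurable (ftraj_set G : set (walk G)).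
Proof.
rewrite (_ : ftraj_set G = (\bigcap_n [set w : walk G | adj (w n) (w n.+1)]) `&`
    \bigcap_(x in [set: V]) \bigcup_N \bigcap_(n in [set n | (N <= n)%N])
      [set w : walk G | w n != x]).
  apply: measurableI.
    apply: bigcapT_measurable => n; apply: (@measurable_determined _ _ n.+1).
    by move=> w w' ww' /=; rewrite !ww'.
  rewrite -[X in measurable X]setCK setC_bigcap; apply: measurableC.
  apply: countable_bigcupT_measurable => // x; apply: measurableC.
  apply: bigcupT_measurable => N; apply: bigcap_measurable.
    by exists N => /=.
  by move=> n _; exact: (@measurable_coord _ _ n [set y | y != x]).
apply/seteqP; split=> [w [wadj wfin]|w [wadj wfin]]; split.
- by move=> n _; exact: wadj.
- move=> x _; have /finite_fsetP[F FE] := wfin x.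
  exists (\max_(i <- F) i).+1%N => //= n Fn; apply/eqP => wn.
  have nF : n \in F by have : [set` F] n by rewrite -FE.
  have := @leq_bigmax_seq _ _ xpredT id n nF isT.
  by rewrite leqNgt Fn.
- by move=> n; exact: wadj.
- move=> x; have [N _ wN] := wfin x I.
  apply: (@sub_finite_set _ _ `I_N); last exact: finite_II.
  by move=> n /= wn; rewrite ltnNge; apply/negP => /wN /= /eqP.
Qed.

Lemma law_ftraj_setC x : (X x).-negligible (~` (ftraj_set G : set (walk G))).
Proof.
apply: (@negligibleS _ _ _ _ ((\bigcup_n [set w : walk G | ~ adj (w n) (w n.+1)]) `|`
  [set w | exists y, ~ finite_set [set n | w n = y]])).
  move=> w /not_andP[/existsNP[n wn]|/existsNP[y wy]]; first by left; exists n.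
  by right; exists y.
apply: negligibleU; last exact: negligible_infinite_visits.
by apply: negligible_bigcup => n; exact: nearest_neighbour_ae.
Qed.

Lemma measurable_ftraj_preimage (C : set (walk G)) : measurable C ->
  measurable [set o : ftraj X | C (val o)].
Proof.
have mv : measurable_fun setT (fun o : ftraj X => (val o : walk G)).
  apply: (@measurability _ _ (ftraj X) (walk G) setT _
    (coord_sets (fun n (w : nat -> V) => w n))) => //.
  move=> _ [_ [n [B ->]] <-]; rewrite setTI.
  by apply: sub_sigma_algebra; exists n, B.
by move=> mC; rewrite -[X in measurable X]setTI; exact: mv.
Qed.

Lemma measurable_ftrajP (A : set (ftraj X)) : measurable A ->
  exists2 C : set (walk G), measurable C & A = [set o | C (val o)].
Proof.
move=> mA; have sA : sigma_algebra setT (preimage_set_system setT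
    (fun o : ftraj X => (val o : walk G)) (@measurable _ (walk G))).
  exact/sigma_algebra_preimage/sigma_algebra_measurable.
have [C mC <-] : preimage_set_system setT
    (fun o : ftraj X => (val o : walk G)) (@measurable _ (walk G)) A.
  move: A mA; apply: smallest_sub => // _ [n [B ->]].
  exists [set w : walk G | B (w n)]; first exact: measurable_coord.
  by rewrite setTI.
by exists C => //; rewrite setTI.
Qed.

(** W+ has full measure for the chain, so an event of the canonical space loses no mass when
    restricted to it. *)
Lemma law_walks_of x (C : set (walk G)) : measurable C ->
  X x (walks_of [set o : ftraj X | C (val o)]) = X x C.
Proof.
move=> mC.
have -> : walks_of [set o : ftraj X | C (val o)] = C `&` (ftraj_set G : set (walk G)).
  apply/seteqP; split=> [w [u Cu uw]|w [Cw wG]].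
    by rewrite -uw; split=> //; exact: set_mem (valP u).
  by exists (exist (fun w => w \in ftraj_set G) w (mem_set wG)).
have mCG : measurable (C `&` (ftraj_set G : set (walk G))).
  by apply: measurableI => //; exact: measurable_ftraj_set.
apply/eqP; rewrite eq_le; apply/andP; split.
  by rewrite le_measure ?inE.
apply: (le_measure_negligible mC mCG (law_ftraj_setC x)) => w Cw.
by have [?|?] := pselect (ftraj_set G w); [left|right].
Qed.

Section nuK.
Variables (K : {fset V}) (nuK : {measure set (itraj X) -> \bar R}).
Hypothesis hnuK : is_nu_on K nuK.

(** Taking the whole space for the backward half leaves only the equilibrium weight. If the chain
    almost surely returns to [K], the quotient is 0 by convention and both sides vanish. *)
Lemma nuK_start x (C : set (walk G)) : measurable C ->
  nuK [set w : itraj X | val w 0%R = x /\ C (val (fwd w))] =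
  if x \in K then (vweight x)%:E * X x (no_return K) * X x C else 0.
Proof.
move=> mC; pose B := [set o : ftraj X | C (val o)].
have mB : measurable B by exact: measurable_ftraj_preimage.
rewrite (_ : [set w | _] = [set w | [/\ setT (bwd w), val w 0%R = x & B (fwd w)]]); last first.
  by apply/seteqP; split=> w [].
have mno := measurable_no_return K.
rewrite hnuK// law_walks_of// /equilibrium; case: ifPn => xK; last first.
  by rewrite mulr0 mul0r.
rewrite /law_given_no_return.
rewrite (_ : walks_of setT `&` no_return K =
    walks_of [set u : ftraj X | no_return K (val u)]); last first.
  apply/seteqP; split=> [w [[u _ <-] nu]|w [u nu <-]]; first by exists u.
  by split=> //; exists u.
rewrite law_walks_of//.
rewrite -[in RHS](fineK (fin_num_measure (X x) _ mno)).
rewrite -[in RHS](fineK (fin_num_measure (X x) _ mC)) -!EFinM; congr _%:E.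
have [->|p0] := eqVneq (fine (X x (no_return K))) 0%R; first by rewrite !(mul0r, mulr0).
by congr (_ * _)%R; rewrite mulrCA divfK.
Qed.

End nuK.

End trajectory_measurability.

(** * Last visits of two-sided trajectories *)

Section last_visits.
Context {R : realType} {G : wgraph R} (X : transient_chain G).
Local Notation V := (site G).

Lemma measurable_itraj_coord (n : int) (B : set V) :
  measurable [set w : itraj X | B (val w n)].
Proof. by apply: sub_sigma_algebra; exists n, B. Qed.

Lemma measurable_hitting (K : {fset V}) : measurable (hitting K : set (itraj X)).
Proof.
rewrite (_ : hitting K = \bigcup_(n in [set: int]) [set w : itraj X | val w n \in K]).
  apply: countable_bigcupT_measurable => // n.
  exact: (@measurable_itraj_coord n [set x | x \in K]).
by apply/seteqP; split=> w [n]; [exists n|move=> _; exists n].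
Qed.

Lemma mhitting_pi (K : {fset V}) (w : itraj X) :
  mhitting K (\pi_(mtraj X)%qT w) <-> hitting K w.
Proof.
split=> [[w' [n wn] /eqmodP/asboolP[k <-]]|wK]; last by exists w.
by exists (n - k); rewrite /= subrK.
Qed.

Lemma measurable_mtraj (D : set (mtraj X)) :
  measurable D = measurable [set w : itraj X | D (\pi_(mtraj X)%qT w)].
Proof. by rewrite /measurable/= /mtraj_measurable /image_set_system /= setTI. Qed.

Lemma measurable_mhitting (K : {fset V}) : measurable (mhitting K : set (mtraj X)).
Proof.
rewrite measurable_mtraj (_ : [set w | _] = hitting K); first exact: measurable_hitting.
by apply/seteqP; split=> w /mhitting_pi.
Qed.

Lemma last_visit_unique (K : {fset V}) (w : itraj X) (k : int) :
  val w k \in K -> (forall n, k < n -> val w n \notin K) -> last_visit K w = k.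
Proof.
move=> wk nk; have wK : hitting K w by exists k.
have [wl lmax] := last_visitP wK; apply/le_anti; rewrite lmax// andbT leNgt.
by apply/negP => /nk; rewrite wl.
Qed.

Lemma val_out_traj (K : {fset V}) (w : itraj X) n :
  val (out_traj K w) n = val w (n%:Z + last_visit K w).
Proof. by []. Qed.

Lemma out_traj_no_return (K : {fset V}) (w : itraj X) : hitting K w ->
  val (out_traj K w) 0%N \in K /\ no_return K (val (out_traj K w) : walk G).
Proof.
move=> /last_visitP[wl lmax]; split; first by rewrite val_out_traj add0r.
move=> n n0; apply/negP; rewrite val_out_traj => /lmax.
by rewrite gerDr leNgt ltz_nat n0.
Qed.

(** A trajectory in [K] at time 0 has its last visit at a non-negative time, so its exit from [K] is
    read off the forward half, whose law is that of the chain. *)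
Lemma out_trajE (K : {fset V}) x (C : set (walk G)) (w : itraj X) :
  x \in K -> val w 0 \in K ->
  (val (out_traj K w) 0%N = x /\ C (val (out_traj K w))) <->
  exits_at x (C `&` no_return K) (val (fwd w)).
Proof.
move=> xK w0; have wK : hitting K w by exists 0.
have [wl lmax] := last_visitP wK.
have l0 : 0 <= last_visit K w by exact: lmax.
have lE : (`|last_visit K w|%N : int) = last_visit K w by rewrite gez0_abs.
have [_ nl] := out_traj_no_return wK.
have outE : walk_shift `|last_visit K w|%N (val (fwd w)) = val (out_traj K w).
  by apply/funext => i; rewrite val_out_traj -lE addrC.
split=> [[ox Co]|[k _ [/= wk [Ck nk]]]].
  exists `|last_visit K w|%N => //; split; last by rewrite /= outE.
  by rewrite /= -ox -outE /walk_shift addn0.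
have kl : last_visit K w = k%:Z.
  have wk' : val w k%:Z = x := wk.
  apply: last_visit_unique; first by rewrite wk'.
  move=> n kn; have := nk `|n - k%:Z|%N.
  rewrite absz_gt0 subr_eq0 gt_eqF// => /(_ isT).
  rewrite /walk_shift /= PoszD gez0_abs ?subr_ge0 ?ltW//.
  by rewrite addrCA subrr addr0.
have outk : walk_shift k (val (fwd w)) = val (out_traj K w) by rewrite -outE kl.
split; last by move: Ck; rewrite outk.
by apply: etrans (esym (congr1 (fun f => f 0%N) outk)) _; rewrite /walk_shift addn0.
Qed.

Lemma measurable_fwd_shift (k : int) (A : set (ftraj X)) : measurable A ->
  measurable [set w : itraj X | A (fwd (Defs.shift k w))].
Proof.
have mf : measurable_fun setT (fun w : itraj X => fwd (Defs.shift k w)).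
  apply: (@measurability _ _ (itraj X) (ftraj X) setT _
    (coord_sets (fun n (w : ftraj_base X) => val w n))) => //.
  move=> _ [_ [n [B ->]] <-]; rewrite setTI.
  exact: (@measurable_itraj_coord (n%:Z + k) B).
by move=> mA; rewrite -[X in measurable X]setTI; exact: mf.
Qed.

Lemma out_atom_not_hitting (K : {fset V}) (w : itraj X) : ~ hitting K w ->
  out_atom K (\pi_(mtraj X)%qT w) = inr (\pi_(mtraj X)%qT w).
Proof. by move=> wK; rewrite /out_atom ifF//; apply/negbTE/negP => /set_mem/mhitting_pi. Qed.

(** Measurability on W* is tested on W. There the last visit takes countably many values, and where
    it equals [k] the exit trajectory is the forward half after the fixed shift by [k]. *)
Lemma measurable_out_atom (K : {fset V}) (D : set (ftraj X + mtraj X)) :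
  measurable D -> measurable (out_atom K @^-1` D).
Proof.
move=> [mD1 mD2]; rewrite measurable_mtraj.
rewrite (_ : [set w | _] =
  (\bigcup_(k in [set: int]) ([set w : itraj X | val w k \in K /\
     forall n, k < n -> val w n \notin K] `&`
     [set w : itraj X | (inl @^-1` D) (fwd (Defs.shift k w))])) `|`
  (~` hitting K `&` [set w : itraj X | (inr @^-1` D) (\pi_(mtraj X)%qT w)])); last first.
  apply/seteqP; split=> w /=.
    have [wK|wK] := pselect (hitting K w); last by rewrite out_atom_not_hitting//; right.
    rewrite out_atom_pi// => Dw; left; exists (last_visit K w) => //; split=> //=.
    have [wl lmax] := last_visitP wK; split=> // n ln.
    by apply/negP => /lmax; rewrite leNgt ln.
  move=> [[k _ [[wk nk] Dw]]|[wK Dw]]; last by rewrite out_atom_not_hitting.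
  rewrite out_atom_pi; last by exists k.
  by rewrite /out_traj (last_visit_unique wk nk).
apply: measurableU; last first.
  apply: measurableI; first by apply: measurableC; exact: measurable_hitting.
  by rewrite -measurable_mtraj.
apply: countable_bigcupT_measurable => // k; apply: measurableI; last first.
  exact: measurable_fwd_shift.
rewrite (_ : [set w | _] = [set w : itraj X | val w k \in K] `&`
  ~` \bigcup_(n in [set: int]) (if k < n then [set w : itraj X | val w n \in K] else set0)).
  apply: measurableI; first exact: (@measurable_itraj_coord k [set x | x \in K]).
  apply: measurableC; apply: countable_bigcupT_measurable => // n.
  case: ifP => // _; exact: (@measurable_itraj_coord n [set x | x \in K]).
apply/seteqP; split=> w [wk nk]; split=> //.
  by move=> [n _]; case: ifP => // /nk /negP.
by move=> n kn; apply/negP => wn; apply: nk; exists n => //; rewrite kn.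
Qed.

End last_visits.

(** * Intensity of the trajectories with a given exit *)

Section exit_formula.
Context {R : realType} {G : wgraph R} (X : transient_chain G).
Local Notation V := (site G).
Local Open Scope ereal_scope.
Context (nuK : {fset V} -> {measure set (itraj X) -> \bar R})
  (nu : {measure set (mtraj X) -> \bar R}).
Hypothesis hnuK : forall K, is_nu_on K (nuK K).
Hypothesis hnu : is_intensity nuK nu.

Let start (y : V) : set (itraj X) := [set w | val w 0%R = y].

Let measurable_start y : measurable (start y).
Proof. exact: (@measurable_itraj_coord _ _ X 0%R [set y]). Qed.

(** By [nuK_start] with [C] the whole space, [nuK K] charges only trajectories that are in [K] at
    time 0. *)
Lemma nuK_decompose (K : {fset V}) (A : set (itraj X)) : measurable A ->
  nuK K A = \sum_(y <- K) nuK K (A `&` start y).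
Proof.
move=> mA; pose N : set (itraj X) := [set w | val w 0%R \notin K].
have mN : measurable N by exact: (@measurable_itraj_coord _ _ X 0%R [set x | x \notin K]).
have N0 : nuK K N = 0.
  rewrite (measure_fibers _ (f := fun w : itraj X => val w 0%R)); last first.
    by move=> y; apply: measurableI => //; exact: measurable_start.
  apply: esum1 => y _; have [yK|yK] := boolP (y \in K).
    rewrite (_ : N `&` _ = set0) ?measure0//; apply/seteqP; split=> // w [].
    by rewrite /N /= => wN wy; move: wN; rewrite wy yK.
  apply: (subset_measure0 (B := start y)) => //.
  - by apply: measurableI => //; exact: measurable_start.
  - have := nuK_start (hnuK K) y (measurableT : measurable [set: walk G]).
    rewrite (negbTE yK) => <-; congr (nuK K _).
    by apply/seteqP; split=> w; [move=> ?; split|case].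
have mAs y : measurable (A `&` start y) by exact: measurableI.
have tAs : trivIset [set` K] (fun y => A `&` start y).
  by move=> y z _ _ [w [[_ <-] [_ <-]]].
rewrite -(measure_fbigsetU (nuK K) (fun y _ => mAs y) tAs).
have mU : measurable (\big[setU/set0]_(y <- K) (A `&` start y)) by exact: bigsetU_measurable.
apply/eqP; rewrite eq_le; apply/andP; split.
  apply: (le_measure_negligible (N := N) mA mU).
    by exists N; split.
  move=> w Aw; have [wK|wK] := boolP (val w 0%R \in K); last by right.
  by left; rewrite -bigcup_fset; exists (val w 0%R).
rewrite le_measure ?inE// -bigcup_fset => w [y _ []]//.
Qed.

Definition exit_event (K : {fset V}) (x : V) (C : set (walk G)) : set (mtraj X) :=
  [set c | exists2 u, out_atom K c = inl u & val u 0%N = x /\ C (val u)].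

Lemma measurable_exit_event K x C : measurable C -> measurable (exit_event K x C).
Proof.
move=> mC; pose Q := [set a : ftraj X + mtraj X |
  exists2 u, a = inl u & val u 0%N = x /\ C (val u)].
apply: (@measurable_out_atom _ _ X K Q); split.
  rewrite (_ : inl @^-1` Q =
      [set u : ftraj X | ([set w : walk G | w 0%N = x] `&` C) (val u)]).
    apply: measurable_ftraj_preimage; apply: measurableI => //.
    exact: measurable_coord_eq.
  by apply/seteqP; split=> u; [move=> [_ [<-]]|move=> ?; exists u].
by rewrite (_ : inr @^-1` Q = set0)//; apply/seteqP; split=> // c [].
Qed.

(** On W_K^* the intensity is the image of [nuK K], whose trajectories are at time 0 in [K], hence
    in [K']; [out_trajE] thus applies to the exit from the larger set. *)
Lemma nu_exit_event (K K' : {fset V}) x C : (K `<=` K')%fset -> x \in K' ->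
  measurable C ->
  nu (exit_event K' x C `&` mhitting K) =
  \sum_(y <- K) (vweight y)%:E * X y (no_return K) *
    X y (exits_at x (C `&` no_return K')).
Proof.
move=> KK' xK' mC; have mE := measurable_exit_event K' x mC.
have mCn : measurable (C `&` no_return K').
  by apply: measurableI => //; exact: measurable_no_return.
rewrite hnu// nuK_decompose; last by rewrite -measurable_mtraj.
rewrite big_seq [RHS]big_seq; apply: eq_bigr => y yK.
have := nuK_start (hnuK K) y (measurable_exits_at x mCn).
rewrite yK => <-; congr (nuK K _).
have outE (w : itraj X) : val w 0%R = y ->
    exit_event K' x C (\pi_(mtraj X)%qT w) <-> exits_at x (C `&` no_return K') (val (fwd w)).
  move=> wy; have w0 : val w 0%R \in K' by rewrite wy (fsubsetP KK').
  rewrite -out_trajE// /exit_event /= out_atom_pi; last by exists 0%R.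
  by split=> [[u [<-]]//|ux]; exists (out_traj K' w).
by apply/seteqP; split=> w; rewrite /start /= => -[]; [move=> + wy|move=> wy +]; rewrite -outE.
Qed.

(** [law_exits_at_rev] moves the starting point from [y] to [x], and summing over the last point [y]
    visited in [K] gives [hits K]. The factor [X x (hits K)] does not depend on [C], which is the
    uniformity over the cells with exit point [x]. *)
Lemma nu_exit_eventE (K K' : {fset V}) x C : (K `<=` K')%fset -> x \in K' ->
  measurable C ->
  nu (exit_event K' x C `&` mhitting K) =
  (vweight x)%:E * X x (C `&` no_return K') * X x (hits K).
Proof.
move=> KK' xK' mC; rewrite (nu_exit_event KK' xK' mC) law_hits.
have mno := measurable_no_return K.
have mCn : measurable (C `&` no_return K').
  by apply: measurableI => //; exact: measurable_no_return.
rewrite ge0_sume_distrr//.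
rewrite big_seq [RHS]big_seq; apply: eq_bigr => y yK.
have sub : C `&` no_return K' `<=` no_return K' by move=> w [].
exact: (law_exits_at_rev X xK' yK (subset_refl _) sub mno mCn).
Qed.

Lemma nu_mhitting_lty (K : {fset V}) : nu (mhitting K) < +oo.
Proof.
rewrite -[mhitting K]setTI hnu// (nuK_decompose K (measurableT : measurable [set: itraj X])).
apply: lte_sum_pinfty => y yK; rewrite setTI.
have := nuK_start (hnuK K) y (measurableT : measurable [set: walk G]).
rewrite (_ : [set w | _] = start y); last by apply/seteqP; split=> w; [case|move=> ?; split].
move=> ->; case: ifP => _; last by rewrite ltry.
have f1 := fin_num_measure (X y) _ (measurable_no_return K).
have f2 := fin_num_measure (X y) _ measurableT.
by rewrite ltey_eq !fin_numM.
Qed.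

(** The case [K = K'] of [nu_exit_eventE], where [K] is hit at time 0. Requiring in addition a visit
    to a smaller set multiplies this value by the probability to hit that set from [x]. *)
Lemma nu_exit_event_total (K : {fset V}) x C : x \in K -> measurable C ->
  nu (exit_event K x C) = (vweight x)%:E * X x (C `&` no_return K).
Proof.
move=> xK mC.
have -> : exit_event K x C = exit_event K x C `&` mhitting K.
  apply/esym/setIidl => c [u]; rewrite /out_atom.
  by case: ifPn => // /set_mem.
rewrite (nu_exit_eventE (fsubset_refl K) xK mC).
have h1 : X x (hits K) = 1.
  apply/eqP; rewrite eq_le; apply/andP; split.
    exact: (probability_le1 (X x) (measurable_hits K)).
  rewrite -(law_markov X x).1 le_measure ?inE//.
  - exact: measurable_coord_eq.
  - exact: measurable_hits.
  - by move=> w /= w0; exists 0%N; rewrite w0.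
by rewrite h1 mule1.
Qed.

Lemma path_ball (K : {fset V}) m : exists2 B : {fset V}, (K `<=` B)%fset &
  forall w : nat -> V, w 0%N \in K -> (forall n, adj (w n) (w n.+1)) ->
    forall i, (i <= m)%N -> w i \in B.
Proof.
elim: m => [|m [B KB wB]]; first by exists K => // w w0 _ [|].
have : finite_set ([set` B] `|` \bigcup_(x in [set` B]) [set y : V | adj x y]).
  rewrite finite_setU; split=> //; apply: bigcup_finite => // x _.
  exact: adj_locfin.
move=> /finite_fsetP[B' BB']; exists B'.
  apply/fsubsetP => x xK; have : [set` B'] x; last by [].
  by rewrite -BB'; left; exact: (fsubsetP KB).
move=> w w0 wadj i; rewrite leq_eqVlt => /predU1P[->|im].
  have : [set` B'] (w m.+1); last by [].
  by rewrite -BB'; right; exists (w m); [exact: wB|exact: wadj].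
have : [set` B'] (w i); last by [].
by rewrite -BB'; left; exact: wB.
Qed.

Lemma exit_mass_small (K : {fset V}) (d : R) : (0 < d)%R ->
  exists2 K' : {fset V}, (K `<=` K')%fset &
  \sum_(x <- K') X x (hits K) * nu (exit_event K' x setT `&` mhitting K) <= d%:E.
Proof.
(* The sum bounds the mass of [nuK K], which multiplies the estimate of [exit_hit_small]; the 1
   makes [a] positive. *)
move=> d0; pose a : R := (1 + \sum_(y <- K) vweight y)%R.
have a0 : (0 < a)%R by rewrite ltr_pwDl// sumr_ge0// => y _; exact: vweight_ge0.
have [m hm] := exit_hit_small X K (divr_gt0 d0 a0).
have [K' KK' ball] := path_ball K m; exists K' => //.
have mno := measurable_no_return K'.
have c0 y : 0 <= (vweight y)%:E * X y (no_return K).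
  by rewrite mule_ge0// lee_fin vweight_ge0.
apply: (@le_trans _ _ (\sum_(y <- K) (vweight y)%:E * (d / a)%:E)); last first.
  under eq_bigr do rewrite -EFinM.
  rewrite sumEFin lee_fin -mulr_suml mulrCA ler_piMr ?(ltW d0)//.
  by rewrite ler_pdivrMr// mul1r /a ler_wpDl.
apply: (@le_trans _ _ (\sum_(y <- K) (vweight y)%:E * X y (no_return K) *
    (\sum_(x <- K') X x (hits K) * X y (exits_at x (no_return K'))))).
  have hE0 y x : 0 <= X x (hits K) * X y (exits_at x (no_return K')).
    by rewrite mule_ge0.
  rewrite [leRHS](eq_bigr (fun y => \sum_(x <- K') (vweight y)%:E *
    X y (no_return K) * (X x (hits K) * X y (exits_at x (no_return K'))))); last first.
    by move=> y _; rewrite ge0_sume_distrr.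
  rewrite [leRHS]exchange_big/= big_seq [leRHS]big_seq; apply: lee_sum => x xK'.
  rewrite (nu_exit_event KK' xK' measurableT) setTI ge0_sume_distrr//; last first.
    by move=> y _; rewrite mule_ge0.
  by apply: lee_sum => y _; rewrite muleCA.
rewrite big_seq [leRHS]big_seq; apply: lee_sum => y yK.
apply: (@le_trans _ _ ((vweight y)%:E * X y (no_return K) * (d / a)%:E)).
  apply: lee_wpmul2l => //; apply: hm => // w w0 wadj i im; apply: ball => //.
  by rewrite w0.
apply: lee_wpmul2r; first by rewrite lee_fin divr_ge0// ltW.
rewrite -[leRHS]mule1; apply: lee_wpmul2l; first by rewrite lee_fin vweight_ge0.
exact: (probability_le1 (X y) (measurable_no_return K)).
Qed.

End exit_formula.

(** * Counts of configurations and of their images *)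

Section configuration_counts.
Local Open Scope ereal_scope.

(** If the sum is finite, the partial sums are bounded non-decreasing integers, hence eventually
    constant. *)
Lemma nat_valued_nneseries (R : realType) (f : nat -> bool) :
  nat_valued (\sum_(i <oo) (f i)%:R%:E : \bar R).
Proof.
set s := \sum_(i <oo) _.
have f0 i : 0 <= (f i)%:R%:E :> \bar R by rewrite lee_fin.
have [->|sfin] := eqVneq s +oo; [by left|right].
have s0 : 0 <= s by exact: nneseries_ge0.
have sE : s = (fine s)%:E by rewrite fineK// ge0_fin_numE// ltey.
pose c n := (\sum_(i < n) f i)%N.
have cE n : \sum_(0 <= i < n) (f i)%:R%:E = (c n)%:R%:E :> \bar R.
  by rewrite big_mkord sumEFin -natr_sum.
have cs n : (c n)%:R%:E <= s.
  by rewrite -cE; exact: nneseries_lim_ge.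
have [b cb] : exists b, forall n, (c n <= b)%N.
  exists (Num.truncn (fine s)) => n; rewrite truncn_ge_nat ?fine_ge0//.
  by have := cs n; rewrite sE lee_fin.
have cmono m n : (m <= n)%N -> (c m <= c n)%N.
  by move=> mn; rewrite /c -(subnKC mn) big_split_ord/= leq_addr.
have ex : exists k, `[< exists n, c n = k >] by exists (c 0%N); apply/asboolP; exists 0%N.
have ub k : `[< exists n, c n = k >] -> (k <= b)%N by move=> /asboolP[n <-].
case: (ex_maxnP ex ub) => k /asboolP[n cn] kmax; exists k.
rewrite /s; apply/cvg_lim => //.
apply: (@cvg_near_cst _ _ _ _ _); exists n => // m /= nm.
rewrite cE; congr (_%:R%:E); apply/eqP; rewrite eqn_leq -{2}cn cmono// andbT.
by apply: kmax; apply/asboolP; exists m.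
Qed.

Lemma point_measure_series d (T : measurableType d) (R : realType)
    (s : nat -> option T) (D : set T) :
  point_measure R s D =
  \sum_(i <oo) (nat_of_bool (if s i is Some a then a \in D else false))%:R%:E.
Proof.
apply: eq_eseriesr => i _; case: (s i) => [a|]; last by [].
by rewrite /atom /= diracE.
Qed.

Lemma nat_valued_point_measure d (T : measurableType d) (R : realType)
    (s : nat -> option T) (D : set T) : nat_valued (point_measure R s D).
Proof.
rewrite point_measure_series.
exact: (nat_valued_nneseries R (fun i => if s i is Some a then a \in D else false)).
Qed.

Context {R : realType} {G : wgraph R} (X : transient_chain G).

Lemma nat_valued_config (om : config X) D : nat_valued (val om D).
Proof. by have [s ->] := config_atoms om; exact: nat_valued_point_measure. Qed.

Lemma measurable_config_count D : measurable D ->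
  measurable_fun setT (fun om : config X => val om D).
Proof.
move=> mD _ U mU; rewrite setTI; apply: sub_sigma_algebra.
by exists D => //; exists U => //; rewrite setTI.
Qed.

(** [out K om] is the image of [om] under [out_atom K]: its counts are counts of [om], and the
    enumeration chosen by [atoms] disappears. *)
Lemma out_count (K : {fset site G}) (om : config X) (D : set (ftraj X + mtraj X)) :
  val (out K om) D = val om (out_atom K @^-1` D).
Proof.
rewrite [in RHS](svalP (cid (config_atoms om))) /= -/(atoms om).
rewrite [LHS]point_measure_series [RHS]point_measure_series.
apply: eq_eseriesr => i _; case: (atoms om i) => [c|//].
by congr (nat_of_bool _)%:R%:E; apply/idP/idP => /set_mem ?; exact/mem_set.
Qed.

Definition exit_algebra (K : {fset site G}) : set (set (mtraj X)) :=
  preimage_set_system setT (out_atom K) measurable.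

Lemma sigma_algebra_exit (K : {fset site G}) : sigma_algebra setT (exit_algebra K).
Proof. exact/sigma_algebra_preimage/sigma_algebra_measurable. Qed.

Lemma exit_algebra_measurable (K : {fset site G}) : exit_algebra K `<=` measurable.
Proof. by move=> _ [D mD <-]; rewrite setTI; exact: measurable_out_atom. Qed.

Lemma future_algebra_exit E (K : {fset site G}) : future_algebra X E ->
  count_algebra (fun om : config X => val om) (exit_algebra K) E.
Proof.
move=> /(_ K I); rewrite /g_sigma_algebra_preimage.
rewrite -(@g_sigma_preimageE (config X) _ setT (out K)).
move: E; apply: smallest_sub; first exact: smallest_sigma_algebra.
move=> _ [_ [D mD [U mU <-]] <-]; apply: sub_sigma_algebra.
have TD : exit_algebra K (out_atom K @^-1` D) by exists D => //; rewrite setTI.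
exists (exist _ _ TD), U => //=.
by rewrite !setTI; apply/seteqP; split=> om /=; rewrite out_count.
Qed.

End configuration_counts.

(** * The partition by exit point *)

Section exit_cells.
Context {R : realType} {G : wgraph R} (X : transient_chain G).
Local Notation V := (site G).

(** On images by [out_atom K], [None] means that the trajectory misses [K], since by
    [out_traj_no_return] the exit trajectory of one that hits [K] starts in [K]. *)
Definition exit_label (K : {fset V}) (a : ftraj X + mtraj X) : option K :=
  if a is inl u then insub (val u 0%N) else None.

Definition exit_point (K : {fset V}) (c : mtraj X) : option K :=
  exit_label K (out_atom K c).

Lemma exit_algebra_cell (K : {fset V}) (j : option K) :
  exit_algebra K (cell (exit_point K) j).
Proof.
exists (exit_label K @^-1` [set j]); last by rewrite setTI.
split.
  apply: (@measurable_ftraj_preimage _ _ X [set w : walk G | insub (w 0%N) = j]).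
  exact: (@measurable_coord _ _ 0%N [set x | insub x = j]).
have [->|j0] := eqVneq j None.
  by rewrite (_ : _ @^-1` _ = setT)//; apply/seteqP; split.
rewrite (_ : _ @^-1` _ = set0)//; apply/seteqP; split=> // c /= jN.
by move: j0; rewrite -jN.
Qed.

Lemma exit_point_None (K : {fset V}) (c : mtraj X) :
  mhitting K c -> exit_point K c <> None.
Proof.
move=> -[w wK <-]; rewrite /exit_point out_atom_pi//= => h.
have [oK _] := out_traj_no_return wK.
by move: h; rewrite insubT.
Qed.

(** A cell with label [Some x] only sees the left summand, so every set of the exit algebra becomes
    there an exit event, whose intensity is known. *)
Lemma cell_exit_event (K : {fset V}) (x : K) (D : set (ftraj X + mtraj X)) (C : set (walk G)) :
  inl @^-1` D = [set u : ftraj X | C (val u)] ->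
  out_atom K @^-1` D `&` cell (exit_point K) (Some x) = exit_event K (val x) C.
Proof.
move=> DC; have DCu u : D (inl u) <-> C (val u).
  by have := congr1 (fun A : set (ftraj X) => A u) DC => /= ->.
apply/seteqP; split=> [c [/= Dc]|c [u cu [ux /DCu Du]]].
  rewrite /cell /exit_point /=; case E : (out_atom K c) Dc => [u|//] /= /DCu Cu.
  by case: insubP => // y _ yE [xy]; exists u => //; split=> //; rewrite -xy; exact/esym.
rewrite /cell /exit_point /= cu; split=> //=.
by rewrite ux valK.
Qed.

End exit_cells.

Theorem theorem10 (R : realType) (G : wgraph R) (X : transient_chain G)
  (nuK : {fset site G} -> {measure set (itraj X) -> \bar R})
  (hnuK : forall K, is_nu_on K (nuK K))
  (nu : {measure set (mtraj X) -> \bar R})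
  (hnu : is_intensity nuK nu)
  (PP : probability (config X) R)
  (hPP : is_poisson nu PP)
  (E : set (config X)) (hE : future_algebra X E) :
  PP E = 0%E \/ PP E = 1%E.
Proof.
pose N (om : config X) : {measure set (mtraj X) -> \bar R} := val om.
have mN D : measurable D -> measurable_fun setT (N ^~ D).
  exact: measurable_config_count.
have vN om D : measurable D -> nat_valued (N om D).
  by move=> _; exact: nat_valued_config.
have sE : count_algebra N measurable E.
  have := future_algebra_exit (K := fset0) hE; apply: generated_algebra_subP => -[B TB].
  exact: (measurable_fun_generated (N := fun (B : {B | measurable B}) om => N om (sval B))
    (exist _ _ (exit_algebra_measurable TB))).
have mE : measurable E.
  move: (E) sE; apply: generated_algebra_sub; first exact: sigma_algebra_measurable.
  by move=> [B mB] U mU; rewrite -[X in measurable X]setTI; exact: mN.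
(* The vertices of code below [n]: an increasing exhaustion of the vertex set, which provides the
   windows. *)
pose Kn n : {fset site G} :=
  [fset x in pmap (@pickle_inv (site G)) (iota 0 n)]%fset.
have KnE n (x : site G) : (x \in Kn n) = (choice.pickle x < n)%N.
  rewrite inE /= mem_pmap; apply/mapP/idP => [[i]|xn]; last first.
    by exists (choice.pickle x); [rewrite mem_iota|rewrite pickleK_inv].
  rewrite mem_iota add0n /= => ni xi.
  by have := @pickle_invK (site G) i; rewrite -xi /= => ->.
apply: (poisson_zero_one (P := PP) mN vN hPP (W := fun n => mhitting (Kn n))) => //.
- by move=> n; exact: measurable_mhitting.
- by move=> n; exact: (nu_mhitting_lty hnuK hnu).
- move=> m n mn _ [w [k wk] <-]; exists w => //; exists k.
  by move: wk; rewrite !KnE => /leq_trans; exact.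
- apply/seteqP; split=> // c _; exists (choice.pickle (val (repr c) 0 : site G)).+1 => //.
  exists (repr c); last by rewrite reprK.
  by exists 0; rewrite KnE.
move=> n d d0; have [K' KK' small] := exit_mass_small hnuK hnu (Kn n) d0.
(* The value 0 at [None] is correct because a trajectory missing [K'] misses its subset [Kn n]; it
   also covers the only cell of possibly infinite intensity. *)
pose h (j : option K') : R := if j is Some x then fine (X (val x) (hits (Kn n))) else 0.
have hE' (x : site G) : (fine (X x (hits (Kn n))))%:E = X x (hits (Kn n)).
  by rewrite fineK// fin_num_measure//; exact: measurable_hits.
have subK : mhitting (Kn n) `<=` (mhitting K' : set (mtraj X)).
  by move=> _ [w [k wk] <-]; exists w => //; exists k; exact: (fsubsetP KK').
have cellT (x : K') :
    cell (exit_point (X := X) K') (Some x) = exit_event K' (val x) setT.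
  by have := @cell_exit_event _ _ X K' x setT setT erefl; rewrite preimage_setT setTI.
exists (exit_algebra K'), (option K' : finType), (exit_point K'), h; split; split.
- exact: sigma_algebra_exit.
- exact: exit_algebra_measurable.
- exact: future_algebra_exit.
- exact: exit_algebra_cell.
- by case=> [x|]; rewrite /h// fine_ge0.
- move=> [x|] B.
    move=> [D [mD1 _] <-]; have [C mC DC] := measurable_ftrajP mD1.
    rewrite setTI (cell_exit_event x DC) setIC.
    rewrite (nu_exit_eventE hnuK hnu KK' (valP x) mC).
    rewrite (nu_exit_event_total hnuK hnu (valP x) mC) /h hE'.
    by rewrite muleC.
  move=> _; rewrite mul0e (_ : _ `&` _ = set0) ?measure0//.
  by apply/seteqP; split=> // c [/subK /exit_point_None cK [_ /cK]].
- move=> [x|]; last by rewrite eqxx.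
  move=> _; apply: (le_lt_trans _ (nu_mhitting_lty hnuK hnu K')).
  rewrite le_measure ?inE//; [|exact: measurable_mhitting|].
    by apply: exit_algebra_measurable; exact: exit_algebra_cell.
  by rewrite cellT => c [u]; rewrite /out_atom; case: ifPn => // /set_mem.
(* The sum over the labels is that of [exit_mass_small], the term at [None] being 0. *)
rewrite -lee_fin; apply: le_trans small.
rewrite -sumEFin (bigD1 None)//= mul0r add0e.
rewrite (reindex_omap Some id)/=; last by case.
rewrite big_seq_fsetE/= le_eqVlt; apply/orP; left; apply/eqP.
apply: eq_big => [x|x _]; first by rewrite eqxx.
rewrite EFinM hE' cellT setIC fineK// ge0_fin_numE//.
apply: (le_lt_trans _ (nu_mhitting_lty hnuK hnu (Kn n))).
rewrite le_measure ?inE//; last exact: measurable_mhitting.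
apply: measurableI; last exact: measurable_mhitting.
exact: measurable_exit_event.
Qed.
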